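(* Let $k$ be the general-affine curvature, as a function of a general-affine length parameter, of a nondegenerate general-affine extremal plane curve in $\mathbf{A}^2$ without affine inflection points, and let $\epsilon=\pm1$ be the sign of this plane curve. Put $M=\epsilon k$. Then the data $\{k,M,\epsilon\}$ define a space curve (the nondegenerate curve in $\mathbf{A}^3$, unique up to general-affine transformation, parametrized by general-affine length, with first general-affine curvature $k$, second general-affine curvature $M$ and sign $\epsilon$) that is general-affine extremal and belongs to a linear complex.
   Context: All curves are smooth. Plane curves: $x(t)$ in $\mathbf{A}^2$ is nondegenerate if $x',x''$ are linearly independent. Then there exist a frame $e_1,e_2$ along $x$ (with $e_1$ a positive multiple of $dx/dt$), a $1$-form $\omega$ and a function $\ell$ such that $dx=\omega e_1$, $de_1=\omega e_2$, $de_2=-\ell\omega e_1$, unique up to $\tilde e_i=\lambda^ie_i$ ($i=1,2$), $\tilde\omega=\lambda^{-1}\omega$, $\tilde\ell=\lambda^2\ell$ with a constant $\lambda>0$. Space curves: $x(t)$ in $\mathbf{A}^3$ is nondegenerate if $x',x'',x'''$ are linearly independent. Then there exist a frame $e_1,e_2,e_3$ along $x$ (with $e_1$ a positive multiple of $dx/dt$), a $1$-form $\omega$ and functions $\ell,m$ such that $dx=\omega e_1$, $de_1=\omega e_2$, $de_2=\omega e_3$, $de_3=-m\omega e_1-\ell\omega e_2$, unique up to $\tilde e_i=\lambda^ie_i$ ($i=1,2,3$), $\tilde\omega=\lambda^{-1}\omega$, $\tilde\ell=\lambda^2\ell$, $\tilde m=\lambda^3m$ with a constant $\lambda>0$. In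 both cases a point with $\ell=0$ is an affine inflection point; where $\ell\neq0$ the sign is $\epsilon=\mathrm{sign}(\ell)$, the general-affine length element is $\omega_s=\sqrt{\epsilon\ell}\,\omega$, a general-affine length parameter is a parameter $s$ with $ds=\omega_s$, and the general-affine curvature (first general-affine curvature for space curves) $k$ is defined by $d\ell/\ell=k\,\omega_s$. For space curves the second general-affine curvature is $M=m/(\epsilon\ell)^{3/2}$. For given functions $k,M$ on an interval and $\epsilon=\pm1$ there is a space curve with these data, unique up to $\mathrm{GA}(3)=\mathrm{GL}(3,\mathbf{R})\ltimes\mathbf{R}^3$. Variations (plane or space): a compactly supported deformation of $x$ is a smooth family of nondegenerate curves $x_\eta$, $\eta$ near $0$, with $x_0=x$, with $x_\eta(t)=x(t)$ for $t$ outside a compact set $C$ of parameters, and such that no $x_\eta$ has an affine inflection point. The curve $x$ is general-affine extremal if, for every compactly supported deformation, $L(\eta)=\int_C\omega_s(\eta)$ satisfies $\frac{dL}{d\eta}\big|_{\eta=0}=0$. Linear complex: regard the space curve $x$ as the curve $t\mapsto[1:x(t)]$ in $\mathbf{P}^3$. It belongs to a linear complex if the curve of its tangent lines, viewed in the $5$-dimensional projective space containing the (Plücker) manifold of lines of $\mathbf{P}^3$, lies in a $4$-dimensional hyperplane. In terms of a homogeneous lift satisfying $y''''+6P_2y''+4P_3y'+P_4y=0$, this is the condition $\theta_3:=P_3-\tfrac32P_2'\equiv0$. *)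

(* Defs.v *)
From Stdlib Require Import Reals List.
From Coquelicot Require Import Coquelicot.
Import ListNotations.
Open Scope R_scope.

Notation A2 := (R * R)%type.
Notation A3 := (R * R * R)%type.

Definition coords2 : list (A2 -> R) := [fst; snd].
Definition coords3 : list (A3 -> R) :=
  [fun p => fst (fst p); fun p => snd (fst p); snd].

Definition is_open_interval (I : R -> Prop) : Prop :=
  open I /\ (exists t, I t) /\
  (forall a b t, I a -> I b -> a <= t <= b -> I t).

Definition smooth_curve {V : Type} (coords : list (V -> R)) (I : R -> Prop)
    (x : R -> V) : Prop :=
  forall p, In p coords -> forall n t, I t ->
    ex_derive_n (fun u => p (x u)) n t.

(* [X eta t], jointly smooth for |eta| < delta and t in I. *)
Definition smooth_family {V : Type} (coords : list (V -> R)) (I : R -> Prop)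
    (delta : R) (X : R -> R -> V) : Prop :=
  forall p, In p coords -> forall n eta t, Rabs eta < delta -> I t ->
    ex_diff_n (fun h u => p (X h u)) n eta t.

Definition deriv2 (n : nat) (x : R -> A2) (t : R) : A2 :=
  (Derive_n (fun u => fst (x u)) n t, Derive_n (fun u => snd (x u)) n t).

Definition deriv3 (n : nat) (x : R -> A3) (t : R) : A3 :=
  (Derive_n (fun u => fst (fst (x u))) n t,
   Derive_n (fun u => snd (fst (x u))) n t,
   Derive_n (fun u => snd (x u)) n t).

Definition lin_indep2 (u v : A2) : Prop :=
  forall a b : R, plus (scal a u) (scal b v) = zero -> a = 0 /\ b = 0.

Definition lin_indep3 (u v w : A3) : Prop :=
  forall a b c : R, plus (plus (scal a u) (scal b v)) (scal c w) = zero ->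
    a = 0 /\ b = 0 /\ c = 0.

Definition nondegenerate2 (I : R -> Prop) (x : R -> A2) : Prop :=
  forall t, I t -> lin_indep2 (deriv2 1 x t) (deriv2 2 x t).

Definition nondegenerate3 (I : R -> Prop) (x : R -> A3) : Prop :=
  forall t, I t ->
    lin_indep3 (deriv3 1 x t) (deriv3 2 x t) (deriv3 3 x t).

(* The 1-form omega is written [w dt]; [0 < w] says that e1 is a positive
   multiple of dx/dt.  Smoothness of the e_i, w, l and m follows from that
   of x and is not required separately. *)
Definition frame2 (I : R -> Prop) (x e1 e2 : R -> A2) (w l : R -> R) : Prop :=
  forall t, I t ->
    lin_indep2 (e1 t) (e2 t) /\ 0 < w t /\
    is_derive x t (scal (w t) (e1 t)) /\
    is_derive e1 t (scal (w t) (e2 t)) /\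
    is_derive e2 t (scal (- l t * w t) (e1 t)).

Definition frame3 (I : R -> Prop) (x e1 e2 e3 : R -> A3) (w l m : R -> R)
    : Prop :=
  forall t, I t ->
    lin_indep3 (e1 t) (e2 t) (e3 t) /\ 0 < w t /\
    is_derive x t (scal (w t) (e1 t)) /\
    is_derive e1 t (scal (w t) (e2 t)) /\
    is_derive e2 t (scal (w t) (e3 t)) /\
    is_derive e3 t
      (plus (scal (- m t * w t) (e1 t)) (scal (- l t * w t) (e2 t))).

(* [w] and [l] (and [m]) are only determined by x up to a constant scaling,
   so they are attached to a curve as a relation. *)
Definition invariants2 (I : R -> Prop) (x : R -> A2) (w l : R -> R) : Prop :=
  exists e1 e2, frame2 I x e1 e2 w l.

Definition invariants3 (I : R -> Prop) (x : R -> A3) (w l m : R -> R) : Prop :=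
  exists e1 e2 e3, frame3 I x e1 e2 e3 w l m.

Definition omega_l3 (I : R -> Prop) (x : R -> A3) (w l : R -> R) : Prop :=
  exists m, invariants3 I x w l m.

(* omega_s = [ga_length w l t] dt, where sign (l) * l is epsilon * l; this
   does not depend on the scaling of (w, l). *)
Definition ga_length (w l : R -> R) (t : R) : R :=
  sqrt (sign (l t) * l t) * w t.

Definition ga_length_parameter (I : R -> Prop) (w l s : R -> R) : Prop :=
  forall t, I t -> is_derive s t (ga_length w l t).

(* d l / l = kt * omega_s, with kt a function of the parameter t. *)
Definition ga_curvature (I : R -> Prop) (w l kt : R -> R) : Prop :=
  forall t, I t ->
    is_derive l t (l t * (kt t * ga_length w l t)).

(* In the next three definitions [omega_l I x w l] says that (w, l) are
   invariants of the curve x : R -> V on I. *)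
Definition no_inflection {V : Type}
    (omega_l : (R -> Prop) -> (R -> V) -> (R -> R) -> (R -> R) -> Prop)
    (I : R -> Prop) (x : R -> V) : Prop :=
  forall w l, omega_l I x w l -> forall t, I t -> l t <> 0.

(* The compact set of parameters is the interval [a, b]. *)
Definition compact_deformation {V : Type} (coords : list (V -> R))
    (nondegenerate : (R -> Prop) -> (R -> V) -> Prop)
    (omega_l : (R -> Prop) -> (R -> V) -> (R -> R) -> (R -> R) -> Prop)
    (I : R -> Prop) (x : R -> V) (X : R -> R -> V) (delta a b : R) : Prop :=
  0 < delta /\ a <= b /\ I a /\ I b /\
  smooth_family coords I delta X /\
  (forall t, I t -> X 0 t = x t) /\
  (forall eta t, Rabs eta < delta -> I t -> ~ (a <= t <= b) ->
     X eta t = x t) /\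
  (forall eta, Rabs eta < delta ->
     nondegenerate I (X eta) /\ no_inflection omega_l I (X eta)).

Definition ga_extremal {V : Type} (coords : list (V -> R))
    (nondegenerate : (R -> Prop) -> (R -> V) -> Prop)
    (omega_l : (R -> Prop) -> (R -> V) -> (R -> R) -> (R -> R) -> Prop)
    (I : R -> Prop) (x : R -> V) : Prop :=
  forall (X : R -> R -> V) (delta a b : R),
    compact_deformation coords nondegenerate omega_l I x X delta a b ->
    forall w l : R -> R -> R,
      (forall eta, Rabs eta < delta -> omega_l I (X eta) (w eta) (l eta)) ->
      is_derive (fun eta => RInt (ga_length (w eta) (l eta)) a b) 0 0.

Definition no_inflection2 := no_inflection invariants2.
Definition ga_extremal2 := ga_extremal coords2 nondegenerate2 invariants2.
Definition ga_extremal3 := ga_extremal coords3 nondegenerate3 omega_l3.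

(* y is parametrized by general-affine length and has curvatures k, M and
   sign eps. *)
Definition space_curve_with_data (J : R -> Prop) (k M : R -> R) (eps : R)
    (y : R -> A3) : Prop :=
  smooth_curve coords3 J y /\ nondegenerate3 J y /\
  exists w l m,
    invariants3 J y w l m /\
    (forall s, J s -> l s <> 0 /\ sign (l s) = eps) /\
    ga_length_parameter J w l (fun s => s) /\
    ga_curvature J w l k /\
    (forall s, J s -> M s = m s / Rpower (eps * l s) (3 / 2)).

Definition general_affine3 (g : A3 -> A3) : Prop :=
  exists (A B : A3 -> A3) (v : A3),
    is_linear A /\ (forall p, B (A p) = p) /\ (forall p, A (B p) = p) /\
    (forall p, g p = plus (A p) v).

(* The homogeneous lift [1 : p] of a point p of A^3 to P^3. *)
Definition homogeneous (p : A3) (i : nat) : R :=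
  match i with
  | 0%nat => 1
  | 1%nat => fst (fst p)
  | 2%nat => snd (fst p)
  | _ => snd p
  end.

Definition plucker (X Y : nat -> R) (i j : nat) : R := X i * Y j - X j * Y i.

Definition tangent_line (x : R -> A3) (t : R) : nat -> nat -> R :=
  plucker (homogeneous (x t))
          (fun i => Derive (fun u => homogeneous (x u) i) t).

Definition in_linear_complex (I : R -> Prop) (x : R -> A3) : Prop :=
  exists c01 c02 c03 c12 c13 c23 : R,
    ~ (c01 = 0 /\ c02 = 0 /\ c03 = 0 /\ c12 = 0 /\ c13 = 0 /\ c23 = 0) /\
    forall t, I t ->
      let p := tangent_line x t in
      c01 * p 0%nat 1%nat + c02 * p 0%nat 2%nat + c03 * p 0%nat 3%nat +
      c12 * p 1%nat 2%nat + c13 * p 1%nat 3%nat + c23 * p 2%nat 3%nat = 0.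

(* Main.v *)
Require Import Defs.
From Stdlib Require Import Reals List Lra Lia ClassicalEpsilon.
From Coquelicot Require Import Coquelicot.
Open Scope R_scope.

(** Write [D] for the derivative along the affine arclength [w dt] of the curve at hand, and
    [h = |l|^(-1/2)], so that [k = -2 D h].

    Two facts make the statement true. The first is that [M = eps k] says exactly that
    [m = D l]. Then the last structure equation of the space curve integrates:
    [c = e3 + l e1] is a constant vector, and [a = e1 x e2 - y x c] is another one. Pairing
    [a] with [e1] is a linear relation between the Pluecker coordinates of the tangent line
    ([frame3_linear_complex]). It also shows what the space curve is: it is the lift of the
    plane curve along the contact form [dz = x1 dx2 - x2 dx1] ([contact_lift]), so existence
    requires an antiderivative and no differential equation. Uniqueness up to affine maps
    holds because two frames with the same invariants obey the same linear system
    ([normalized_frame], [frame3_congruent]).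

    The second is that both extremality conditions are the same equation for [h]. The square
    of the length density is, up to sign, a rational function of the derivatives of the curve
    ([planeQ_frame], [spaceQ_frame]), so its variation [dQ] is a linear differential
    expression in the variation field. Integrating [h dQ] by parts moves all derivatives onto
    [h] and the dual frame. In the plane the result is an exact derivative plus
    [D^4 h + l D^2 h] times the normal component of the field ([plane_concomitant]); testing
    with bump functions gives [D^4 h + l D^2 h = 0] ([plane_euler_lagrange]). In space, when
    [m = D l], the coefficients produced by the integration by parts are multiples of the
    same quantity [D^4 h + l D^2 h], so that for our curve [h dQ] is exact and the length is
    stationary ([space_concomitant], [space_extremal]).

    The invariants [w], [l], [h] of the plane curve are carried to the space curve by the
    inverse of the length parameter ([inverse_function], [frame3_reparam]). *)

(** * Derivatives of real functions *)

Lemma deriv_const (c x : R) : is_derive (fun _ : R => c) x 0.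
Proof. apply (is_derive_const (K := R_AbsRing) (V := R_NormedModule)). Qed.

Lemma deriv_id (x : R) : is_derive (fun t : R => t) x 1.
Proof. apply (is_derive_id (K := R_AbsRing)). Qed.

Lemma deriv_plus (f g : R -> R) (x a b : R) :
  is_derive f x a -> is_derive g x b -> is_derive (fun t => f t + g t) x (a + b).
Proof. apply (is_derive_plus (K := R_AbsRing) (V := R_NormedModule)). Qed.

Lemma deriv_minus (f g : R -> R) (x a b : R) :
  is_derive f x a -> is_derive g x b -> is_derive (fun t => f t - g t) x (a - b).
Proof. apply (is_derive_minus (K := R_AbsRing) (V := R_NormedModule)). Qed.

Lemma deriv_opp (f : R -> R) (x a : R) :
  is_derive f x a -> is_derive (fun t => - f t) x (- a).
Proof. apply (is_derive_opp (K := R_AbsRing) (V := R_NormedModule)). Qed.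

Lemma deriv_mult (f g : R -> R) (x a b : R) :
  is_derive f x a -> is_derive g x b ->
  is_derive (fun t => f t * g t) x (a * g x + f x * b).
Proof.
  intros Hf Hg. apply (is_derive_mult f g); auto. intros; apply Rmult_comm.
Qed.

Lemma deriv_scal (f : R -> R) (c x a : R) :
  is_derive f x a -> is_derive (fun t => c * f t) x (c * a).
Proof.
  intros Hf. replace (c * a) with (0 * f x + c * a) by ring.
  apply (deriv_mult (fun _ => c) f); auto. apply deriv_const.
Qed.

Lemma deriv_inv (f : R -> R) (x a : R) :
  f x <> 0 -> is_derive f x a -> is_derive (fun t => / f t) x (- a / f x ^ 2).
Proof. intros H Hf. now apply (is_derive_inv f). Qed.

Lemma deriv_div (f g : R -> R) (x a b : R) :
  g x <> 0 -> is_derive f x a -> is_derive g x b ->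
  is_derive (fun t => f t / g t) x (a / g x - f x * b / g x ^ 2).
Proof.
  intros H Hf Hg.
  replace (a / g x - f x * b / g x ^ 2)
    with (a * / g x + f x * (- b / g x ^ 2)) by (field; auto).
  apply (deriv_mult f (fun t => / g t)); auto. now apply deriv_inv.
Qed.

Lemma deriv_comp (f g : R -> R) (x a b : R) :
  is_derive f (g x) a -> is_derive g x b ->
  is_derive (fun t => f (g t)) x (b * a).
Proof. apply (is_derive_comp f g). Qed.

Lemma deriv_val (f : R -> R) (x a b : R) :
  is_derive f x a -> a = b -> is_derive f x b.
Proof. now intros H <-. Qed.

Lemma deriv_unique (f : R -> R) (x a b : R) :
  is_derive f x a -> is_derive f x b -> a = b.
Proof.
  intros Ha Hb. rewrite <- (is_derive_unique _ _ _ Ha).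
  now apply is_derive_unique.
Qed.

Lemma deriv_ext_on (K : R -> Prop) (f g : R -> R) (x a : R) :
  open K -> K x -> (forall t, K t -> f t = g t) ->
  is_derive f x a -> is_derive g x a.
Proof.
  intros HK Hx E. apply is_derive_ext_loc.
  apply filter_imp with (2 := HK x Hx). exact E.
Qed.

Lemma deriv_eq_on (K : R -> Prop) (f g : R -> R) (x a b : R) :
  open K -> K x -> (forall t, K t -> f t = g t) ->
  is_derive f x a -> is_derive g x b -> a = b.
Proof.
  intros HK Hx E Ha. apply deriv_unique. now apply (deriv_ext_on K f).
Qed.

(** * Smooth functions of one and two variables *)

Definition open2 (U : R -> R -> Prop) : Prop :=
  forall x y, U x y -> locally_2d U x y.

Definition Ck (U : R -> R -> Prop) (n : nat) (f : R -> R -> R) : Prop :=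
  forall x y, U x y -> ex_diff_n f n x y.

Definition smooth2 (U : R -> R -> Prop) (f : R -> R -> R) : Prop :=
  forall n, Ck U n f.

Definition D1 (f : R -> R -> R) (x y : R) : R := Derive (fun z => f z y) x.
Definition D2 (f : R -> R -> R) (x y : R) : R := Derive (fun z => f x z) y.

Lemma locally_2d_snd (P : R -> R -> Prop) (x y : R) :
  locally_2d P x y -> locally y (fun v => P x v).
Proof.
  intros [d Hd]; exists d; intros u Hu.
  apply Hd; [rewrite Rminus_eq_0, Rabs_R0; apply cond_pos | exact Hu].
Qed.

Lemma Ck_ext U n f g :
  open2 U -> (forall x y, U x y -> f x y = g x y) -> Ck U n f -> Ck U n g.
Proof.
  intros HU E Hf x y Hxy. apply ex_diff_n_ext_loc with f; [|now apply Hf].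
  apply locally_2d_impl with (2 := HU _ _ Hxy). now apply locally_2d_forall.
Qed.

Lemma Ck_le U n m f : (m <= n)%nat -> Ck U n f -> Ck U m f.
Proof. intros H Hf x y Hxy. apply ex_diff_n_m with n; auto. Qed.

Lemma Ck_continuity U n f x y : Ck U n f -> U x y -> continuity_2d_pt f x y.
Proof. intros Hf Hxy. destruct n; apply (Hf x y Hxy). Qed.

Lemma Ck_derive1 U n f x y : Ck U (S n) f -> U x y ->
  is_derive (fun z => f z y) x (D1 f x y).
Proof. intros Hf Hxy. apply Derive_correct, (Hf x y Hxy). Qed.

Lemma Ck_derive2 U n f x y : Ck U (S n) f -> U x y ->
  is_derive (fun z => f x z) y (D2 f x y).
Proof. intros Hf Hxy. apply Derive_correct, (Hf x y Hxy). Qed.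

Lemma Ck_D1 U n f : Ck U (S n) f -> Ck U n (D1 f).
Proof. intros Hf x y Hxy. apply (Hf x y Hxy). Qed.

Lemma Ck_D2 U n f : Ck U (S n) f -> Ck U n (D2 f).
Proof. intros Hf x y Hxy. apply (Hf x y Hxy). Qed.

Lemma Ck_intro U n f f1 f2 :
  open2 U ->
  (forall x y, U x y -> continuity_2d_pt f x y) ->
  (forall x y, U x y -> is_derive (fun z => f z y) x (f1 x y)) ->
  (forall x y, U x y -> is_derive (fun z => f x z) y (f2 x y)) ->
  Ck U n f1 -> Ck U n f2 -> Ck U (S n) f.
Proof.
  intros HU Hc H1 H2 C1 C2 x y Hxy.
  split; [now apply Hc|]. split; [eexists; now apply H1|].
  split; [eexists; now apply H2|]. split.
  - apply (Ck_ext U n f1); auto.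
    intros u v Huv. symmetry. now apply is_derive_unique, H1.
  - apply (Ck_ext U n f2); auto.
    intros u v Huv. symmetry. now apply is_derive_unique, H2.
Qed.

Lemma Ck_0 U f : (forall x y, U x y -> continuity_2d_pt f x y) -> Ck U 0 f.
Proof. intros H x y Hxy. split; auto. Qed.

Lemma Ck_const U n c : open2 U -> Ck U n (fun _ _ => c).
Proof.
  intros HU. revert c. induction n; intros c.
  - apply Ck_0. intros; apply continuity_2d_pt_const.
  - apply Ck_intro with (fun _ _ => 0) (fun _ _ => 0); auto.
    + intros; apply continuity_2d_pt_const.
    + intros; apply deriv_const.
    + intros; apply deriv_const.
Qed.

Lemma Ck_fst U n : open2 U -> Ck U n (fun x _ => x).
Proof.
  intros HU. destruct n.
  - apply Ck_0. intros; apply continuity_2d_pt_id1.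
  - apply Ck_intro with (fun _ _ => 1) (fun _ _ => 0); auto using Ck_const.
    + intros; apply continuity_2d_pt_id1.
    + intros; apply deriv_id.
    + intros; apply deriv_const.
Qed.

Lemma Ck_snd U n : open2 U -> Ck U n (fun _ y => y).
Proof.
  intros HU. destruct n.
  - apply Ck_0. intros; apply continuity_2d_pt_id2.
  - apply Ck_intro with (fun _ _ => 0) (fun _ _ => 1); auto using Ck_const.
    + intros; apply continuity_2d_pt_id2.
    + intros; apply deriv_const.
    + intros; apply deriv_id.
Qed.

Lemma Ck_plus U n f g : open2 U ->
  Ck U n f -> Ck U n g -> Ck U n (fun x y => f x y + g x y).
Proof.
  intros HU. revert f g. induction n; intros f g Hf Hg.
  - apply Ck_0. intros; apply continuity_2d_pt_plus;
      eapply Ck_continuity; eauto.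
  - apply Ck_intro with (fun x y => D1 f x y + D1 g x y)
                        (fun x y => D2 f x y + D2 g x y); auto using Ck_D1, Ck_D2.
    + intros; apply continuity_2d_pt_plus; eapply Ck_continuity; eauto.
    + intros; apply deriv_plus;
        eapply Ck_derive1; eauto.
    + intros; apply deriv_plus;
        eapply Ck_derive2; eauto.
Qed.

Lemma Ck_mult U n f g : open2 U ->
  Ck U n f -> Ck U n g -> Ck U n (fun x y => f x y * g x y).
Proof.
  intros HU. revert f g. induction n; intros f g Hf Hg.
  - apply Ck_0. intros; apply continuity_2d_pt_mult;
      eapply Ck_continuity; eauto.
  - assert (Hf' := Ck_le U (S n) n f ltac:(lia) Hf).
    assert (Hg' := Ck_le U (S n) n g ltac:(lia) Hg).
    apply Ck_intro with (fun x y => D1 f x y * g x y + f x y * D1 g x y)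
                        (fun x y => D2 f x y * g x y + f x y * D2 g x y); auto.
    + intros; apply continuity_2d_pt_mult; eapply Ck_continuity; eauto.
    + intros x y Hxy.
      apply (deriv_mult (fun z => f z y) (fun z => g z y));
        eapply Ck_derive1; eauto.
    + intros x y Hxy.
      apply (deriv_mult (fun z => f x z) (fun z => g x z));
        eapply Ck_derive2; eauto.
    + apply Ck_plus; auto using Ck_D1.
    + apply Ck_plus; auto using Ck_D2.
Qed.

Lemma Ck_inv U n f : open2 U -> (forall x y, U x y -> f x y <> 0) ->
  Ck U n f -> Ck U n (fun x y => / f x y).
Proof.
  intros HU H0. induction n; intros Hf.
  - apply Ck_0. intros; apply continuity_2d_pt_inv; auto.
    eapply Ck_continuity; eauto.
  - assert (Hi := IHn (Ck_le U (S n) n f ltac:(lia) Hf)).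
    apply Ck_intro with (fun x y => (-1) * D1 f x y * (/ f x y * / f x y))
                        (fun x y => (-1) * D2 f x y * (/ f x y * / f x y)); auto.
    + intros; apply continuity_2d_pt_inv; auto. eapply Ck_continuity; eauto.
    + intros x y Hxy.
      replace ((-1) * D1 f x y * (/ f x y * / f x y))
        with (- D1 f x y / f x y ^ 2) by (field; auto).
      apply (deriv_inv (fun z => f z y)); auto. eapply Ck_derive1; eauto.
    + intros x y Hxy.
      replace ((-1) * D2 f x y * (/ f x y * / f x y))
        with (- D2 f x y / f x y ^ 2) by (field; auto).
      apply (deriv_inv (fun z => f x z)); auto. eapply Ck_derive2; eauto.
    + repeat apply Ck_mult; auto using Ck_const, Ck_D1.
    + repeat apply Ck_mult; auto using Ck_const, Ck_D2.
Qed.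

Lemma is_derive_continuity_pt f (x l : R) : is_derive f x l -> continuity_pt f x.
Proof.
  intros H. apply continuity_pt_filterlim.
  apply (ex_derive_continuous (K := R_AbsRing) (V := R_NormedModule)).
  now exists l.
Qed.

Definition strip (K : R -> Prop) : R -> R -> Prop := fun _ t => K t.

(** A function of one variable is treated as a function of two variables that ignores the
    first one, so that a single calculus serves curves and families of curves. *)
Definition smooth1 (K : R -> Prop) (g : R -> R) : Prop :=
  smooth2 (strip K) (fun _ t => g t).

(** By induction on the order: the partial derivatives of [g (f x y)] are those of [f] times
    the composite of [f] with the derivative of [g], one order lower. *)
Lemma Ck_comp U K n f g : open2 U -> open2 (strip K) ->
  (forall x y, U x y -> K (f x y)) ->
  Ck (strip K) n (fun _ t => g t) -> Ck U n f ->
  Ck U n (fun x y => g (f x y)).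
Proof.
  intros HU HK HUK. revert g. induction n; intros g Hg Hf.
  - apply Ck_0. intros x y Hxy. apply continuity_1d_2d_pt_comp.
    + assert (Hc := Ck_continuity _ _ _ 0 (f x y) Hg (HUK _ _ Hxy)).
      intros e He. destruct (Hc (mkposreal e He)) as [d Hd].
      exists d. split; [apply cond_pos|]. intros u [_ Hu].
      apply (Hd 0 u); [rewrite Rminus_eq_0, Rabs_R0; apply cond_pos|exact Hu].
    + eapply Ck_continuity; eauto.
  - assert (Hf' := Ck_le U (S n) n f ltac:(lia) Hf).
    assert (Hg' : forall t, K t -> is_derive g t (Derive g t)).
    { intros t Ht. exact (Ck_derive2 _ _ _ 0 t Hg Ht). }
    assert (C : Ck U n (fun x y => Derive g (f x y))).
    { apply IHn; auto. exact (Ck_D2 _ _ _ Hg). }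
    apply Ck_intro with (fun x y => D1 f x y * Derive g (f x y))
                        (fun x y => D2 f x y * Derive g (f x y)); auto.
    + intros x y Hxy. apply continuity_1d_2d_pt_comp.
      * eapply is_derive_continuity_pt, Hg'; auto.
      * eapply Ck_continuity; eauto.
    + intros x y Hxy.
      apply (deriv_comp g (fun z => f z y)); auto.
      eapply Ck_derive1; eauto.
    + intros x y Hxy.
      apply (deriv_comp g (fun z => f x z)); auto.
      eapply Ck_derive2; eauto.
    + apply (Ck_mult U n (D1 f) (fun x y => Derive g (f x y))); auto using Ck_D1.
    + apply (Ck_mult U n (D2 f) (fun x y => Derive g (f x y))); auto using Ck_D2.
Qed.

Lemma smooth2_const U c : open2 U -> smooth2 U (fun _ _ => c).
Proof. intros HU n. now apply Ck_const. Qed.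

Lemma smooth2_plus U f g : open2 U -> smooth2 U f -> smooth2 U g ->
  smooth2 U (fun x y => f x y + g x y).
Proof. intros HU Hf Hg n. now apply Ck_plus. Qed.

Lemma smooth2_mult U f g : open2 U -> smooth2 U f -> smooth2 U g ->
  smooth2 U (fun x y => f x y * g x y).
Proof. intros HU Hf Hg n. now apply Ck_mult. Qed.

Lemma smooth2_ext U f g : open2 U -> (forall x y, U x y -> f x y = g x y) ->
  smooth2 U f -> smooth2 U g.
Proof. intros HU E Hf n. now apply Ck_ext with f. Qed.

Lemma smooth2_opp U f : open2 U -> smooth2 U f -> smooth2 U (fun x y => - f x y).
Proof.
  intros HU Hf. apply smooth2_ext with (fun x y => (-1) * f x y); auto.
  - intros; ring.
  - apply smooth2_mult; auto using smooth2_const.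
Qed.

Lemma smooth2_minus U f g : open2 U -> smooth2 U f -> smooth2 U g ->
  smooth2 U (fun x y => f x y - g x y).
Proof.
  intros HU Hf Hg. apply (smooth2_plus U f (fun x y => - g x y)); auto.
  now apply smooth2_opp.
Qed.

Lemma smooth2_inv U f : open2 U -> (forall x y, U x y -> f x y <> 0) ->
  smooth2 U f -> smooth2 U (fun x y => / f x y).
Proof. intros HU H0 Hf n. now apply Ck_inv. Qed.

Lemma smooth2_div U f g : open2 U -> (forall x y, U x y -> g x y <> 0) ->
  smooth2 U f -> smooth2 U g -> smooth2 U (fun x y => f x y / g x y).
Proof.
  intros HU H0 Hf Hg. apply smooth2_mult; auto. now apply smooth2_inv.
Qed.

Lemma smooth2_pow U f n : open2 U -> smooth2 U f ->
  smooth2 U (fun x y => f x y ^ n).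
Proof.
  intros HU Hf. induction n; simpl.
  - now apply smooth2_const.
  - now apply smooth2_mult.
Qed.

Lemma smooth2_comp U K f g : open2 U -> open2 (strip K) ->
  (forall x y, U x y -> K (f x y)) ->
  smooth1 K g -> smooth2 U f -> smooth2 U (fun x y => g (f x y)).
Proof. intros HU HK H Hg Hf n. now apply Ck_comp with K. Qed.

Lemma smooth2_D1 U f : smooth2 U f -> smooth2 U (D1 f).
Proof. intros Hf n. apply Ck_D1, Hf. Qed.

Lemma smooth2_D2 U f : smooth2 U f -> smooth2 U (D2 f).
Proof. intros Hf n. apply Ck_D2, Hf. Qed.

Lemma smooth2_derive1 U f x y : smooth2 U f -> U x y ->
  is_derive (fun z => f z y) x (D1 f x y).
Proof. intros Hf. apply (Ck_derive1 U 0), Hf. Qed.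

Lemma smooth2_derive2 U f x y : smooth2 U f -> U x y ->
  is_derive (fun z => f x z) y (D2 f x y).
Proof. intros Hf. apply (Ck_derive2 U 0), Hf. Qed.

Lemma smooth2_continuity U f x y : smooth2 U f -> U x y ->
  continuity_2d_pt f x y.
Proof. intros Hf. apply (Ck_continuity U 0), Hf. Qed.

(** Commuting the two partial derivatives is what lets the variation of a derivative be
    computed as the derivative of the variation. *)
Lemma smooth2_schwarz U f x y : open2 U -> smooth2 U f -> U x y ->
  D1 (D2 f) x y = D2 (D1 f) x y.
Proof.
  intros HU Hf Hxy. unfold D1, D2. apply Schwarz.
  - apply locally_2d_impl with (2 := HU _ _ Hxy), locally_2d_forall.
    intros u v Huv. repeat split; eexists.
    + now apply (smooth2_derive1 U).
    + now apply (smooth2_derive2 U).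
    + apply (smooth2_derive1 U (D2 f)); auto using smooth2_D2.
    + apply (smooth2_derive2 U (D1 f)); auto using smooth2_D1.
  - apply (smooth2_continuity U (D1 (D2 f))); auto using smooth2_D1, smooth2_D2.
  - apply (smooth2_continuity U (D2 (D1 f))); auto using smooth2_D1, smooth2_D2.
Qed.

Lemma open2_strip K : open K -> open2 (strip K).
Proof.
  intros HK x y Hy. destruct (HK y Hy) as [d Hd]. exists d.
  intros u v _ Hv. now apply Hd.
Qed.

Lemma smooth1_smooth2 U K g : open2 U -> open2 (strip K) ->
  (forall x y, U x y -> K y) -> smooth1 K g -> smooth2 U (fun _ y => g y).
Proof.
  intros HU HK H Hg. apply (smooth2_comp U K (fun _ y => y) g); auto.
  intros n. now apply Ck_snd.
Qed.

Lemma smooth1_derive K g t : smooth1 K g -> K t -> is_derive g t (Derive g t).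
Proof. intros Hg Ht. exact (smooth2_derive2 _ _ 0 t Hg Ht). Qed.

Lemma smooth1_Derive K g : smooth1 K g -> smooth1 K (Derive g).
Proof. intros Hg. exact (smooth2_D2 _ _ Hg). Qed.

Lemma smooth1_continuous K g t : smooth1 K g -> K t -> continuous g t.
Proof.
  intros Hg Ht. apply (ex_derive_continuous (K := R_AbsRing) (V := R_NormedModule)).
  eexists. now apply (smooth1_derive K).
Qed.

Lemma continuity_2d_pt_snd g x y : continuity_pt g y ->
  continuity_2d_pt (fun _ v => g v) x y.
Proof.
  intros H. apply (continuity_1d_2d_pt_comp g (fun _ v => v)); auto.
  apply continuity_2d_pt_id2.
Qed.

Lemma Ck_intro1 K n g g' : open K ->
  (forall t, K t -> is_derive g t (g' t)) ->
  Ck (strip K) n (fun _ t => g' t) -> Ck (strip K) (S n) (fun _ t => g t).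
Proof.
  intros HK Hg C. apply Ck_intro with (fun _ _ => 0) (fun _ t => g' t); auto.
  - now apply open2_strip.
  - intros x y Hy. apply continuity_2d_pt_snd.
    eapply is_derive_continuity_pt, Hg, Hy.
  - intros; apply deriv_const.
  - apply Ck_const. now apply open2_strip.
Qed.

Lemma smooth1_intro K g g' : open K ->
  (forall t, K t -> is_derive g t (g' t)) -> smooth1 K g' -> smooth1 K g.
Proof.
  intros HK Hg Hs n. apply Ck_le with (S n); [lia|].
  now apply Ck_intro1 with g'.
Qed.

Lemma Derive_n_S f n t : Derive_n f (S n) t = Derive_n (Derive f) n t.
Proof.
  revert t. induction n; intros t; [reflexivity|].
  change (Derive (Derive_n f (S n)) t = Derive (Derive_n (Derive f) n) t).
  now apply Derive_ext.
Qed.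

(** The bridge between smoothness of curves, stated by iterated derivatives, and the
    two-variable calculus. *)
Lemma smooth1_iff K g : open K ->
  smooth1 K g <-> (forall n t, K t -> ex_derive_n g n t).
Proof.
  intros HK. split.
  - intros Hg n t Ht. revert g Hg t Ht.
    destruct n as [|n]; [easy|]. simpl.
    induction n; intros g Hg t Ht.
    + eexists. now apply (smooth1_derive K).
    + apply ex_derive_ext with (Derive_n (Derive g) n).
      { intros u. symmetry. exact (Derive_n_S g n u). }
      apply IHn; auto. now apply smooth1_Derive.
  - intros Hg n. revert g Hg. induction n; intros g Hg.
    + apply Ck_0. intros x y Hy. apply continuity_2d_pt_snd.
      eapply is_derive_continuity_pt, Derive_correct, (Hg 1%nat), Hy.
    + apply Ck_intro1 with (Derive g); auto.
      * intros t Ht. apply Derive_correct, (Hg 1%nat), Ht.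
      * apply IHn. intros m t Ht. destruct m as [|m]; [easy|]. simpl.
        apply ex_derive_ext with (Derive_n g (S m)).
        { intros u. apply Derive_n_S. }
        exact (Hg (S (S m)) t Ht).
Qed.

(** * Elementary smooth functions *)

Lemma smooth1_exp : smooth1 (fun _ => True) exp.
Proof.
  intros n. induction n.
  - apply Ck_0. intros x y _. apply continuity_2d_pt_snd.
    eapply is_derive_continuity_pt, is_derive_exp.
  - apply Ck_intro1 with exp; auto.
    + apply open_true.
    + intros t _. apply is_derive_exp.
Qed.

Lemma smooth1_inv : smooth1 (fun t => 0 < t) Rinv.
Proof.
  assert (HU := open2_strip _ (open_gt 0)).
  apply (smooth2_inv (strip (fun t => 0 < t)) (fun _ t => t)); auto.
  - intros x y Hy. apply Rgt_not_eq, Hy.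
  - intros n. now apply Ck_snd.
Qed.

Lemma smooth1_ln : smooth1 (fun t => 0 < t) ln.
Proof.
  apply smooth1_intro with Rinv; auto using smooth1_inv.
  - apply open_gt.
  - intros t Ht. now apply is_derive_ln.
Qed.

Lemma smooth1_sqrt : smooth1 (fun t => 0 < t) sqrt.
Proof.
  assert (HU := open2_strip _ (open_gt 0)).
  assert (Hd : forall t, 0 < t -> is_derive sqrt t (/ 2 * / sqrt t)).
  { intros t Ht. apply deriv_val with (1 / (2 * sqrt t)).
    - apply (is_derive_sqrt (fun u => u)); auto. apply deriv_id.
    - field. apply Rgt_not_eq, sqrt_lt_R0, Ht. }
  intros n. induction n.
  - apply Ck_0. intros x y Hy. apply continuity_2d_pt_snd.
    eapply is_derive_continuity_pt, Hd, Hy.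
  - apply Ck_intro1 with (fun t => / 2 * / sqrt t); auto.
    + apply open_gt.
    + apply (Ck_mult _ n (fun _ _ => / 2) (fun _ t => / sqrt t)); auto.
      * now apply Ck_const.
      * apply Ck_inv; auto.
        intros x y Hy. apply Rgt_not_eq, sqrt_lt_R0, Hy.
Qed.

Lemma smooth1_Rpower a : smooth1 (fun t => 0 < t) (fun t => Rpower t a).
Proof.
  assert (HU := open2_strip _ (open_gt 0)).
  apply (smooth2_comp (strip (fun t => 0 < t)) (fun _ => True)
           (fun _ t => a * ln t) exp); auto.
  - apply open2_strip, open_true.
  - apply smooth1_exp.
  - apply (smooth2_mult _ (fun _ _ => a) (fun _ t => ln t)); auto.
    + now apply smooth2_const.
    + apply smooth1_ln.
Qed.

(** * Inverse functions on open intervals *)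

Lemma interval_increasing (I : R -> Prop) (s s' : R -> R) :
  is_open_interval I ->
  (forall t, I t -> is_derive s t (s' t)) -> (forall t, I t -> 0 < s' t) ->
  forall a b, I a -> I b -> a < b -> s a < s b.
Proof.
  intros (_ & _ & Hc) Hd Hp a b Ia Ib Hab.
  assert (HI : forall t, a <= t <= b -> I t) by (intros; now apply (Hc a b)).
  destruct (MVT_gen s a b s') as (c & Hc1 & Hc2).
  - intros t Ht. rewrite Rmin_left, Rmax_right in Ht by lra. apply Hd, HI; lra.
  - intros t Ht. rewrite Rmin_left, Rmax_right in Ht by lra.
    eapply is_derive_continuity_pt, Hd, HI; lra.
  - rewrite Rmin_left, Rmax_right in Hc1 by lra.
    assert (0 < s' c) by (apply Hp, HI; lra). nra.
Qed.

Lemma interval_constant (I : R -> Prop) (f : R -> R) :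
  is_open_interval I -> (forall t, I t -> is_derive f t 0) ->
  forall a b, I a -> I b -> f a = f b.
Proof.
  intros (_ & _ & Hc) Hd.
  assert (W : forall a b, I a -> I b -> a <= b -> f a = f b).
  { intros a b Ia Ib Hab.
    destruct (MVT_gen f a b (fun _ => 0)) as (c & _ & E).
    - intros t Ht. rewrite Rmin_left, Rmax_right in Ht by lra.
      apply Hd, (Hc a b); auto; lra.
    - intros t Ht. rewrite Rmin_left, Rmax_right in Ht by lra.
      eapply is_derive_continuity_pt, Hd, (Hc a b); auto; lra.
    - lra. }
  intros a b Ia Ib. destruct (Rle_dec a b) as [H|H]; [now apply W|].
  symmetry. apply W; auto; lra.
Qed.

Lemma interval_intermediate (I : R -> Prop) (s : R -> R) :
  is_open_interval I -> (forall t, I t -> continuity_pt s t) ->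
  forall a b y, I a -> I b -> a < b -> s a <= y <= s b ->
  exists t, a <= t <= b /\ s t = y.
Proof.
  intros (_ & _ & Hc) Hs a b y Ia Ib Hab [[H1|H1] [H2|H2]];
    [|exists b; lra|exists a; lra|exists a; lra].
  destruct (Ranalysis5.IVT_interv (fun t => s t - y) a b) as (z & Hz & E);
    try lra.
  - intros t Ht. apply continuity_pt_minus.
    + apply Hs, (Hc a b); auto.
    + now apply continuity_pt_const.
  - exists z. split; auto. lra.
Qed.

Lemma interval_around (I : R -> Prop) t : open I -> I t ->
  exists d, 0 < d /\ forall u, t - d <= u <= t + d -> I u.
Proof.
  intros HI Ht. destruct (HI t Ht) as [d Hd].
  exists (d / 2). assert (Hp := cond_pos d). split; [lra|].
  intros u Hu. apply Hd. change (Rabs (u - t) < d). apply Rabs_lt_between. lra.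
Qed.

Definition image (I : R -> Prop) (s : R -> R) : R -> Prop :=
  fun sigma => exists t, I t /\ s t = sigma.

Lemma inverse_function (I : R -> Prop) (s s' : R -> R) :
  is_open_interval I ->
  (forall t, I t -> is_derive s t (s' t)) -> (forall t, I t -> 0 < s' t) ->
  is_open_interval (image I s) /\
  exists tau, (forall t, I t -> tau (s t) = t) /\
    (forall t, I t -> is_derive tau (s t) (/ s' t)).
Proof.
  intros HI Hd Hp.
  assert (Hinc := interval_increasing I s s' HI Hd Hp).
  assert (Hs : forall t, I t -> continuity_pt s t)
    by (intros; eapply is_derive_continuity_pt, Hd; auto).
  assert (Hivt := interval_intermediate I s HI Hs).
  destruct (HI) as (HIo & [i0 Hi0] & Hc).
  assert (Hinj : forall a b, I a -> I b -> s a = s b -> a = b).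
  { intros a b Ia Ib E. destruct (Rtotal_order a b) as [H|[H|H]]; auto.
    - apply Hinc in H; auto; lra.
    - apply Hinc in H; auto; lra. }
  split.
  { split; [|split].
    - intros y (t & It & <-).
      destruct (interval_around I t HIo It) as (d & Hd0 & HdI).
      assert (I (t - d)) by (apply HdI; lra).
      assert (I (t + d)) by (apply HdI; lra).
      assert (A1 : s (t - d) < s t) by (apply Hinc; auto; lra).
      assert (A2 : s t < s (t + d)) by (apply Hinc; auto; lra).
      assert (Hm : 0 < Rmin (s t - s (t - d)) (s (t + d) - s t))
        by (apply Rmin_pos; lra).
      exists (mkposreal _ Hm). intros u Hu.
      change (Rabs (u - s t) < Rmin (s t - s (t - d)) (s (t + d) - s t)) in Hu.
      apply Rabs_lt_between in Hu.
      assert (B1 := Rmin_l (s t - s (t - d)) (s (t + d) - s t)).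
      assert (B2 := Rmin_r (s t - s (t - d)) (s (t + d) - s t)).
      destruct (Hivt (t - d) (t + d) u) as (v & Hv & E); auto; try lra.
      exists v. split; auto.
    - exists (s i0), i0; auto.
    - intros a b y (ta & Ia & <-) (tb & Ib & <-) Hy.
      destruct (Rtotal_order ta tb) as [H|[H|H]].
      + destruct (Hivt ta tb y) as (v & Hv & E); auto.
        exists v. split; auto. now apply (Hc ta tb).
      + subst tb. exists ta. split; auto; lra.
      + apply Hinc in H; auto. lra. }
  set (tau := fun y => epsilon (inhabits 0) (fun t => I t /\ s t = y)).
  assert (Htau : forall y, image I s y -> I (tau y) /\ s (tau y) = y).
  { intros y Hy. exact (epsilon_spec (inhabits 0) _ Hy). }
  assert (Hts : forall t, I t -> tau (s t) = t).
  { intros t It. apply Hinj; try apply Htau; auto; exists t; auto. }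
  exists tau. split; auto.
  intros t It. apply is_derive_Reals. intros e He.
  assert (Hp0 := Hp t It).
  (* If the difference quotient of [s] is within [c] of [s' t], its reciprocal is within [e]
     of [/ s' t]: the first term keeps the quotient above [s' t / 2]. *)
  set (c := Rmin (s' t / 2) (e * (s' t) ^ 2 / 2)).
  assert (Hc0 : 0 < c) by (apply Rmin_pos; [lra|]; apply Rdiv_lt_0_compat; [|lra];
    apply Rmult_lt_0_compat; [lra|]; apply pow_lt; lra).
  assert (Hq := Hd t It). apply is_derive_Reals in Hq.
  destruct (Hq c Hc0) as [d1 Hd1]. clear Hq.
  destruct (interval_around I t HIo It) as (d2 & Hd2 & HdI).
  assert (Hd1p := cond_pos d1).
  set (d := Rmin (d1 / 2) d2).
  assert (Hdp : 0 < d) by (apply Rmin_pos; lra).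
  assert (Hdl := Rmin_l (d1 / 2) d2 : d <= _).
  assert (Hdr := Rmin_r (d1 / 2) d2 : d <= _).
  assert (Im : I (t - d)) by (apply HdI; lra).
  assert (IM : I (t + d)) by (apply HdI; lra).
  assert (A1 : s (t - d) < s t) by (apply Hinc; auto; lra).
  assert (A2 : s t < s (t + d)) by (apply Hinc; auto; lra).
  assert (Hm : 0 < Rmin (s t - s (t - d)) (s (t + d) - s t))
    by (apply Rmin_pos; lra).
  exists (mkposreal _ Hm). simpl. intros h Hh0 Hh. apply Rabs_lt_between in Hh.
  assert (B1 := Rmin_l (s t - s (t - d)) (s (t + d) - s t)).
  assert (B2 := Rmin_r (s t - s (t - d)) (s (t + d) - s t)).
  destruct (Hivt (t - d) (t + d) (s t + h)) as (v & Hv & E); auto; try lra.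
  assert (Iv : I v) by (apply (Hc (t - d) (t + d)); auto).
  rewrite <- E, !Hts by auto.
  assert (Hvt : v - t <> 0).
  { intros H. apply Hh0. replace v with t in E by lra. lra. }
  assert (Hv1 : Rabs (v - t) < d1) by (apply Rabs_lt_between; lra).
  specialize (Hd1 (v - t) Hvt Hv1). replace (t + (v - t)) with v in Hd1 by ring.
  replace h with (s v - s t) by lra.
  set (q := (s v - s t) / (v - t)) in *.
  assert (C1 := Rmin_l (s' t / 2) (e * (s' t) ^ 2 / 2) : c <= _).
  assert (C2 := Rmin_r (s' t / 2) (e * (s' t) ^ 2 / 2) : c <= _).
  assert (Hq0 : s' t / 2 < q) by (apply Rabs_lt_between in Hd1; lra).
  assert (Hsv : s v - s t <> 0) by lra.
  replace ((v - t) / (s v - s t) - / s' t) with (- (q - s' t) / (q * s' t)).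
  2:{ unfold q. field. repeat split; lra. }
  unfold Rdiv at 1. rewrite Rabs_mult, Rabs_Ropp, Rabs_inv.
  rewrite (Rabs_pos_eq (q * s' t)) by nra.
  apply Rmult_lt_reg_r with (q * s' t); [nra|].
  rewrite Rmult_assoc, Rinv_l by nra. rewrite Rmult_1_r.
  apply Rlt_le_trans with c; auto. apply Rle_trans with (1 := C2). nra.
Qed.

(** Each derivative of the inverse is a smooth expression in the inverse itself, so
    smoothness climbs one order at a time. *)
Lemma inverse_smooth (I : R -> Prop) (s s' tau : R -> R) :
  open I -> open (image I s) ->
  (forall t, I t -> 0 < s' t) -> smooth1 I s' ->
  (forall t, I t -> tau (s t) = t) ->
  (forall t, I t -> is_derive tau (s t) (/ s' t)) ->
  smooth1 (image I s) tau.
Proof.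
  intros HI HJ Hp Hs' Hts Hd n.
  assert (UJ := open2_strip _ HJ). assert (UI := open2_strip _ HI).
  induction n.
  - apply Ck_0. intros x y (t & It & <-). apply continuity_2d_pt_snd.
    eapply is_derive_continuity_pt, Hd, It.
  - apply Ck_intro1 with (fun y => / s' (tau y)); auto.
    + intros y (t & It & <-). rewrite Hts; auto.
    + apply Ck_inv; auto.
      * intros x y (t & It & <-). rewrite Hts; auto. apply Rgt_not_eq, Hp, It.
      * apply (Ck_comp (strip (image I s)) I n (fun _ y => tau y) s'); auto.
        intros x y (t & It & <-). rewrite Hts; auto.
Qed.

(** * Bump functions *)

Lemma pow_exp_bound n : exists C, 0 < C /\ forall x, 0 < x -> exp (- / x) <= C * x ^ n.
Proof.
  exists (INR (Factorial.fact n)). split; [apply lt_0_INR, Factorial.lt_O_fact|].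
  intros x Hx.
  assert (Hix : 0 < / x) by now apply Rinv_0_lt_compat.
  assert (H : (/ x) ^ n / INR (Factorial.fact n) <= exp (/ x)).
  { assert (H := exp_ge_taylor (/ x) n ltac:(lra)).
    assert (H2 : (/ x) ^ n / INR (Factorial.fact n)
                 <= sum_f_R0 (fun k => (/ x) ^ k / INR (Factorial.fact k)) n).
    { destruct n as [|n]; [simpl; lra|]. rewrite tech5.
      assert (0 <= sum_f_R0 (fun k => (/ x) ^ k / INR (Factorial.fact k)) n); [|lra].
      apply cond_pos_sum. intros k. apply Rlt_le, Rdiv_lt_0_compat;
        [now apply pow_lt|apply lt_0_INR, Factorial.lt_O_fact]. }
    lra. }
  rewrite exp_Ropp.
  assert (Hf : 0 < INR (Factorial.fact n)) by apply lt_0_INR, Factorial.lt_O_fact.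
  assert (Hpn : 0 < (/ x) ^ n) by now apply pow_lt.
  replace (INR (Factorial.fact n) * x ^ n) with (/ ((/ x) ^ n / INR (Factorial.fact n))).
  - apply Rinv_le_contravar; auto. now apply Rdiv_lt_0_compat.
  - rewrite pow_inv. field.
    assert (0 < x ^ n) by now apply pow_lt. split; lra.
Qed.

(** The functions [x^-k exp(-1/x)], extended by zero: their span is closed under
    differentiation. *)
Definition flat (k : nat) (x : R) : R :=
  if Rlt_dec 0 x then (/ x) ^ k * exp (- / x) else 0.

(** The quadratic bound gives the derivative at the origin, where no formula applies. *)
Lemma flat_bound k : exists C, 0 < C /\ forall x, Rabs (flat k x) <= C * x ^ 2.
Proof.
  destruct (pow_exp_bound (k + 2)) as (C & HC & H). exists C. split; auto.
  intros x. unfold flat. destruct (Rlt_dec 0 x) as [Hx|Hx].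
  - assert (Hk : 0 < (/ x) ^ k) by (apply pow_lt, Rinv_0_lt_compat, Hx).
    rewrite Rabs_pos_eq by (apply Rmult_le_pos; [lra|apply Rlt_le, exp_pos]).
    apply Rle_trans with ((/ x) ^ k * (C * x ^ (k + 2))).
    + apply Rmult_le_compat_l; [lra|]. now apply H.
    + apply Req_le. rewrite pow_add, pow_inv. field.
      apply Rgt_not_eq, pow_lt, Hx.
  - rewrite Rabs_R0. assert (0 <= x ^ 2) by apply pow2_ge_0. nra.
Qed.

Lemma deriv_pow_exp k x : 0 < x ->
  is_derive (fun u => (/ u) ^ k * exp (- / u)) x
    ((/ x) ^ (k + 2) * exp (- / x) - INR k * ((/ x) ^ (k + 1) * exp (- / x))).
Proof.
  intros Hx. auto_derive; [repeat split; lra|].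
  destruct k as [|k].
  - simpl. field. lra.
  - rewrite !pow_add. change (Init.Nat.pred (S k)) with k. simpl. field. lra.
Qed.

Lemma flat_derive k x :
  is_derive (flat k) x (flat (k + 2) x - INR k * flat (k + 1) x).
Proof.
  destruct (Rtotal_order x 0) as [Hx|[Hx|Hx]].
  - apply (deriv_ext_on (fun u => u < 0) (fun _ => 0)); auto.
    + apply open_lt.
    + intros t Ht. unfold flat. destruct (Rlt_dec 0 t); lra.
    + apply deriv_val with 0; [apply deriv_const|].
      unfold flat. destruct (Rlt_dec 0 x); lra.
  - subst x. apply deriv_val with 0.
    2:{ unfold flat. destruct (Rlt_dec 0 0); lra. }
    apply is_derive_Reals. intros e He.
    destruct (flat_bound k) as (C & HC & H).
    assert (Hd : 0 < e / C) by now apply Rdiv_lt_0_compat.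
    exists (mkposreal _ Hd). simpl. intros h Hh Hhd.
    assert (E : flat k 0 = 0) by (unfold flat; destruct (Rlt_dec 0 0); lra).
    rewrite E, Rplus_0_l, !Rminus_0_r.
    assert (Hh' : 0 < Rabs h) by now apply Rabs_pos_lt.
    unfold Rdiv. rewrite Rabs_mult, Rabs_inv.
    apply Rmult_lt_reg_r with (Rabs h); auto.
    rewrite Rmult_assoc, Rinv_l, Rmult_1_r by lra.
    apply Rle_lt_trans with (1 := H h).
    rewrite <- (pow2_abs h).
    apply Rmult_lt_compat_r with (r := C) in Hhd; auto.
    unfold Rdiv in Hhd. rewrite Rmult_assoc, Rinv_l in Hhd by lra. nra.
  - apply (deriv_ext_on (fun u => 0 < u) (fun u => (/ u) ^ k * exp (- / u))); auto.
    + apply open_gt.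
    + intros t Ht. unfold flat. destruct (Rlt_dec 0 t); lra.
    + apply deriv_val with (1 := deriv_pow_exp k x Hx).
      unfold flat. destruct (Rlt_dec 0 x); lra.
Qed.

Lemma smooth1_flat : smooth1 (fun _ => True) (flat 0).
Proof.
  assert (HU := open2_strip _ open_true).
  intros n. generalize 0%nat. induction n; intros k.
  - apply Ck_0. intros x y _. apply continuity_2d_pt_snd.
    eapply is_derive_continuity_pt, flat_derive.
  - apply Ck_intro1 with (fun x => flat (k + 2) x + (- INR k) * flat (k + 1) x).
    + apply open_true.
    + intros t _. apply deriv_val with (1 := flat_derive k t). ring.
    + apply (Ck_plus _ n (fun _ x => flat (k + 2) x)
               (fun _ x => (- INR k) * flat (k + 1) x)); auto.
      apply (Ck_mult _ n (fun _ _ => - INR k) (fun _ x => flat (k + 1) x)); auto.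
      now apply Ck_const.
Qed.

Definition bump (a b t : R) : R := flat 0 (t - a) * flat 0 (b - t).

Lemma flat_pos x : 0 < x -> 0 < flat 0 x.
Proof.
  intros Hx. unfold flat. destruct (Rlt_dec 0 x); [|lra]. simpl.
  rewrite Rmult_1_l. apply exp_pos.
Qed.

Lemma bump_pos a b t : a < t < b -> 0 < bump a b t.
Proof. intros H. apply Rmult_lt_0_compat; apply flat_pos; lra. Qed.

Lemma bump_zero a b t : ~ (a < t < b) -> bump a b t = 0.
Proof.
  intros H. unfold bump, flat.
  destruct (Rlt_dec 0 (t - a)); destruct (Rlt_dec 0 (b - t)); lra.
Qed.

Lemma smooth1_bump a b : smooth1 (fun _ => True) (bump a b).
Proof.
  assert (HU := open2_strip _ open_true).
  assert (Hid : smooth2 (strip (fun _ => True)) (fun _ t => t))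
    by (intros n; now apply Ck_snd).
  apply (smooth2_mult _ (fun _ t => flat 0 (t - a)) (fun _ t => flat 0 (b - t))); auto.
  - apply (smooth2_comp (strip (fun _ => True)) (fun _ => True)
             (fun _ t => t - a) (flat 0)); auto using smooth1_flat.
    apply (smooth2_minus _ (fun _ t => t) (fun _ _ => a)); auto using smooth2_const.
  - apply (smooth2_comp (strip (fun _ => True)) (fun _ => True)
             (fun _ t => b - t) (flat 0)); auto using smooth1_flat.
    apply (smooth2_minus _ (fun _ _ => b) (fun _ t => t)); auto using smooth2_const.
Qed.

Lemma smooth1_restrict (K L : R -> Prop) g :
  (forall t, K t -> L t) -> smooth1 L g -> smooth1 K g.
Proof. intros H Hg n x y Hy. apply Hg. now apply H. Qed.

(** * Vectors and determinants *)

Definition det2 (u v : A2) : R := fst u * snd v - snd u * fst v.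

Definition det3 (u v w : A3) : R :=
  fst (fst u) * (snd (fst v) * snd w - snd v * snd (fst w))
  - snd (fst u) * (fst (fst v) * snd w - snd v * fst (fst w))
  + snd u * (fst (fst v) * snd (fst w) - snd (fst v) * fst (fst w)).

Ltac vec_unfold := unfold det2, det3;
  repeat (progress (unfold minus, plus, opp, scal, zero, mult,
    prod_plus, prod_opp, prod_scal, prod_zero; cbn)).

Lemma lin_indep2_det u v : lin_indep2 u v <-> det2 u v <> 0.
Proof.
  destruct u as [u1 u2], v as [v1 v2]. unfold lin_indep2. split.
  - intros H D.
    assert (H2 := H v2 (- u2)). assert (H1 := H (- v1) u1). assert (H0 := H 1 0).
    revert D H0 H1 H2. vec_unfold. intros D H0 H1 H2.
    destruct H2 as [-> E2]; [f_equal; lra|].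
    destruct H1 as [E1 E1']; [f_equal; nra|].
    destruct H0; [f_equal; nra|]. lra.
  - intros D a b. vec_unfold. intros E. injection E as E1 E2.
    revert D. vec_unfold. intros D. split.
    + apply Rmult_eq_reg_r with (u1 * v2 - u2 * v1); auto.
      transitivity ((a * u1 + b * v1) * v2 - (a * u2 + b * v2) * v1); [ring|].
      rewrite E1, E2. ring.
    + apply Rmult_eq_reg_r with (u1 * v2 - u2 * v1); auto.
      transitivity ((a * u2 + b * v2) * u1 - (a * u1 + b * v1) * u2); [ring|].
      rewrite E1, E2. ring.
Qed.

(** If the determinant vanishes, the cross products are the coefficients of a linear
    relation, so they vanish too; then the vectors are parallel to the first. *)
Lemma lin_indep3_det u v w : lin_indep3 u v w <-> det3 u v w <> 0.
Proof.
  destruct u as [[u1 u2] u3], v as [[v1 v2] v3], w as [[w1 w2] w3].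
  unfold lin_indep3. split.
  - intros H D.
    assert (H1 := H (v2 * w3 - v3 * w2) (w2 * u3 - w3 * u2) (u2 * v3 - u3 * v2)).
    assert (H2 := H (v3 * w1 - v1 * w3) (w3 * u1 - w1 * u3) (u3 * v1 - u1 * v3)).
    assert (H3 := H (v1 * w2 - v2 * w1) (w1 * u2 - w2 * u1) (u1 * v2 - u2 * v1)).
    assert (G1 := H (- v1) u1 0). assert (G2 := H (- v2) u2 0).
    assert (G3 := H (- v3) u3 0).
    assert (H0 := H 1 0 0). clear H.
    revert D H0 H1 H2 H3 G1 G2 G3. vec_unfold. intros D H0 H1 H2 H3 G1 G2 G3.
    destruct H1 as (_ & _ & H1); [f_equal; [f_equal|]; lra|].
    destruct H2 as (_ & _ & H2); [f_equal; [f_equal|]; lra|].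
    destruct H3 as (_ & _ & H3); [f_equal; [f_equal|]; lra|].
    destruct G1 as (_ & G1 & _); [f_equal; [f_equal|]; lra|].
    destruct G2 as (_ & G2 & _); [f_equal; [f_equal|]; lra|].
    destruct G3 as (_ & G3 & _); [f_equal; [f_equal|]; lra|].
    destruct H0 as (H0 & _); [f_equal; [f_equal|]; lra|]. lra.
  - intros D a b c. vec_unfold. intros E. injection E as E1 E2 E3.
    revert D. vec_unfold.
    set (d := u1 * _ - _ + _). intros D.
    repeat split; apply Rmult_eq_reg_r with d; auto; unfold d.
    + transitivity ((a * u1 + b * v1 + c * w1) * (v2 * w3 - v3 * w2)
        - (a * u2 + b * v2 + c * w2) * (v1 * w3 - v3 * w1)
        + (a * u3 + b * v3 + c * w3) * (v1 * w2 - v2 * w1)); [ring|].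
      rewrite E1, E2, E3. ring.
    + transitivity (- (a * u1 + b * v1 + c * w1) * (u2 * w3 - u3 * w2)
        + (a * u2 + b * v2 + c * w2) * (u1 * w3 - u3 * w1)
        - (a * u3 + b * v3 + c * w3) * (u1 * w2 - u2 * w1)); [ring|].
      rewrite E1, E2, E3. ring.
    + transitivity ((a * u1 + b * v1 + c * w1) * (u2 * v3 - u3 * v2)
        - (a * u2 + b * v2 + c * w2) * (u1 * v3 - u3 * v1)
        + (a * u3 + b * v3 + c * w3) * (u1 * v2 - u2 * v1)); [ring|].
      rewrite E1, E2, E3. ring.
Qed.

Lemma is_derive_linear {U V : NormedModule R_AbsRing} (L : U -> V) (f : R -> U) t l :
  is_linear L -> is_derive f t l -> is_derive (fun u => L (f u)) t (L l).
Proof.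
  intros HL Hf. unfold is_derive in *.
  apply filterdiff_ext_lin with (fun y : R => L (scal y l)).
  - apply (filterdiff_comp' f L t (fun y : R => scal y l) L); auto.
    now apply filterdiff_linear.
  - intros y. apply (linear_scal L HL).
Qed.

Lemma is_derive_pair {U V : NormedModule R_AbsRing} (f : R -> U) (g : R -> V) t a b :
  is_derive f t a -> is_derive g t b -> is_derive (fun u => (f u, g u)) t (a, b).
Proof.
  intros Hf Hg. unfold is_derive in *.
  apply filterdiff_ext_lin with (fun y : R => (scal y a, scal y b)); [|easy].
  apply (filterdiff_comp'_2 f g (fun x y => (x, y)) t _ _ (fun x y => (x, y)) Hf Hg).
  apply filterdiff_ext with (fun z => z).
  - now intros [].
  - apply filterdiff_ext_lin with (fun z => z); [apply filterdiff_id|now intros []].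
Qed.

Lemma is_derive_A2 (f : R -> A2) (t : R) (v : A2) :
  is_derive f t v <->
  is_derive (fun u => fst (f u)) t (fst v) /\ is_derive (fun u => snd (f u)) t (snd v).
Proof.
  split.
  - intros H. split.
    + exact (is_derive_linear (fun p : A2 => fst p) f t v is_linear_fst H).
    + exact (is_derive_linear (fun p : A2 => snd p) f t v is_linear_snd H).
  - intros [H1 H2]. destruct v as [v1 v2].
    apply is_derive_ext with (fun u => (fst (f u), snd (f u))).
    + intros u. symmetry. apply surjective_pairing.
    + now apply (is_derive_pair (fun u => fst (f u)) (fun u => snd (f u))).
Qed.

Lemma is_derive_A3 (f : R -> A3) (t : R) (v : A3) :
  is_derive f t v <->
  is_derive (fun u => fst (fst (f u))) t (fst (fst v)) /\
  is_derive (fun u => snd (fst (f u))) t (snd (fst v)) /\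
  is_derive (fun u => snd (f u)) t (snd v).
Proof.
  split.
  - intros H.
    assert (H1 := is_derive_linear (fun p : A3 => fst p) f t v is_linear_fst H).
    apply (is_derive_A2 (fun u => fst (f u)) t) in H1. destruct H1 as [H1 H2].
    split; [exact H1|split; [exact H2|]].
    exact (is_derive_linear (fun p : A3 => snd p) f t v is_linear_snd H).
  - intros (H1 & H2 & H3). destruct v as [v12 v3].
    apply is_derive_ext with (fun u => (fst (f u), snd (f u))).
    + intros u. symmetry. apply surjective_pairing.
    + apply (is_derive_pair (fun u => fst (f u)) (fun u => snd (f u))); auto.
      now apply (is_derive_A2 (fun u => fst (f u))).
Qed.

Lemma deriv_det2 (u v : R -> A2) (t : R) (u' v' : A2) :
  is_derive u t u' -> is_derive v t v' ->
  is_derive (fun z => det2 (u z) (v z)) t (det2 u' (v t) + det2 (u t) v').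
Proof.
  intros Hu Hv. apply is_derive_A2 in Hu, Hv.
  destruct Hu as [Hu1 Hu2], Hv as [Hv1 Hv2]. unfold det2.
  eapply deriv_val.
  - apply deriv_minus; apply deriv_mult; eassumption.
  - cbv beta. ring.
Qed.

Lemma deriv_det3 (u v w : R -> A3) (t : R) (u' v' w' : A3) :
  is_derive u t u' -> is_derive v t v' -> is_derive w t w' ->
  is_derive (fun z => det3 (u z) (v z) (w z)) t
    (det3 u' (v t) (w t) + det3 (u t) v' (w t) + det3 (u t) (v t) w').
Proof.
  intros Hu Hv Hw. apply is_derive_A3 in Hu, Hv, Hw.
  destruct Hu as (Hu1 & Hu2 & Hu3), Hv as (Hv1 & Hv2 & Hv3),
    Hw as (Hw1 & Hw2 & Hw3). unfold det3.
  eapply deriv_val.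
  - apply deriv_plus; [apply deriv_minus|];
      (apply deriv_mult; [eassumption|]; apply deriv_minus; apply deriv_mult;
       eassumption).
  - cbv beta. ring.
Qed.

Lemma scal_inj2 (a : R) (u v : A2) : a <> 0 -> scal a u = scal a v -> u = v.
Proof.
  destruct u as [u1 u2], v as [v1 v2]. vec_unfold. intros Ha E.
  injection E as E1 E2. f_equal; now apply Rmult_eq_reg_l with a.
Qed.

Lemma scal_inj3 (a : R) (u v : A3) : a <> 0 -> scal a u = scal a v -> u = v.
Proof.
  destruct u as [[u1 u2] u3], v as [[v1 v2] v3]. vec_unfold. intros Ha E.
  injection E as E1 E2 E3. f_equal; [f_equal|]; now apply Rmult_eq_reg_l with a.
Qed.

Lemma is_derive_unique2 (f : R -> A2) (t : R) (u v : A2) :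
  is_derive f t u -> is_derive f t v -> u = v.
Proof.
  intros H1 H2. apply is_derive_A2 in H1, H2.
  destruct H1 as [A1 A2'], H2 as [B1 B2], u, v; simpl in *.
  f_equal; eapply deriv_unique; eassumption.
Qed.

Lemma is_derive_unique3 (f : R -> A3) (t : R) (u v : A3) :
  is_derive f t u -> is_derive f t v -> u = v.
Proof.
  intros H1 H2. apply is_derive_A3 in H1, H2.
  destruct H1 as (A1 & A2' & A3'), H2 as (B1 & B2 & B3), u as [[u1 u2] u3],
    v as [[v1 v2] v3]; simpl in *.
  f_equal; [f_equal|]; eapply deriv_unique; eassumption.
Qed.

(** * The length density of a curve in an arbitrary gauge *)

(** Fix a weight [w0] and put [D = (1/w0) d/dt]. The arguments of [planeQ] and [spaceQ] are
    the derivatives [D X, D^2 X, ...] of a curve, and the values are [l (w/w0)^2], that is,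
    up to the sign, the square of the general-affine length density relative to [w0 dt].
    Unlike [w] and [l], they are rational in the derivatives of the curve. *)
Definition planeQ (X1 X2 X3 X4 : A2) : R :=
  (4 * det2 X2 X3 + det2 X1 X4) / (3 * det2 X1 X2)
  - 5 / 9 * (det2 X1 X3 / det2 X1 X2) ^ 2.

Definition spaceQ (X1 X2 X3 X4 X5 : A3) : R :=
  (5 * det3 X1 X3 X4 + 2 * det3 X1 X2 X5) / (3 * det3 X1 X2 X3)
  - 35 / 36 * (det3 X1 X2 X4 / det3 X1 X2 X3) ^ 2.

Definition tower_on {V : NormedModule R_AbsRing} (I : R -> Prop) (w0 : R -> R)
  (N : nat) (X : nat -> R -> V) : Prop :=
  forall n t, (n < N)%nat -> I t -> is_derive (X n) t (scal (w0 t) (X (S n) t)).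

Lemma frame2_det_const I x e1 e2 w l t : frame2 I x e1 e2 w l -> I t ->
  is_derive (fun z => det2 (e1 z) (e2 z)) t 0.
Proof.
  intros HF It. destruct (HF t It) as (_ & _ & _ & H1 & H2).
  eapply deriv_val; [apply deriv_det2; eassumption|].
  destruct (e1 t) as [a b], (e2 t) as [c d]. vec_unfold. ring.
Qed.

Lemma frame3_det_const I x e1 e2 e3 w l m t : frame3 I x e1 e2 e3 w l m -> I t ->
  is_derive (fun z => det3 (e1 z) (e2 z) (e3 z)) t 0.
Proof.
  intros HF It. destruct (HF t It) as (_ & _ & _ & H1 & H2 & H3).
  eapply deriv_val; [apply deriv_det3; eassumption|].
  destruct (e1 t) as [[a1 b1] c1], (e2 t) as [[a2 b2] c2], (e3 t) as [[a3 b3] c3].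
  vec_unfold. ring.
Qed.

Lemma det2_cramer (e1 e2 u v : A2) :
  det2 u v * det2 e1 e2
  = det2 u e2 * det2 e1 v - det2 e1 u * det2 v e2.
Proof. unfold det2. ring. Qed.

Lemma det3_cramer (e1 e2 e3 u v w : A3) :
  det3 u v w * (det3 e1 e2 e3) ^ 2
  = det3 u e2 e3 * (det3 e1 v e3 * det3 e1 e2 w - det3 e1 e2 v * det3 e1 w e3)
  - det3 e1 u e3 * (det3 v e2 e3 * det3 e1 e2 w - det3 e1 e2 v * det3 w e2 e3)
  + det3 e1 e2 u * (det3 v e2 e3 * det3 e1 w e3 - det3 e1 v e3 * det3 w e2 e3).
Proof. unfold det3. ring. Qed.

(** Expand the derivatives [X n] in the frame of the curve. The first is [r e1] with
    [r = w/w0]; each relation found between the coefficients is differentiated to give the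
    next coefficient, so that all of them become expressions in [r] and its derivatives,
    which cancel from [planeQ]. *)
Lemma planeQ_frame (I : R -> Prop) (w0 : R -> R) (X : nat -> R -> A2) e1 e2 w l :
  open I -> (forall t, I t -> 0 < w0 t) -> tower_on I w0 4 X ->
  frame2 I (X 0%nat) e1 e2 w l ->
  forall t, I t ->
    det2 (X 1%nat t) (X 2%nat t) = (w t / w0 t) ^ 3 * det2 (e1 t) (e2 t) /\
    planeQ (X 1%nat t) (X 2%nat t) (X 3%nat t) (X 4%nat t) = l t * (w t / w0 t) ^ 2.
Proof.
  intros HI Hw0 HX HF.
  set (d := fun t => det2 (e1 t) (e2 t)).
  set (A := fun n t => det2 (X n t) (e2 t)).
  set (B := fun n t => det2 (e1 t) (X n t)).
  set (r := fun t => w t / w0 t).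
  assert (Hw0' : forall t, I t -> w0 t <> 0) by (intros t It; apply Rgt_not_eq, Hw0, It).
  assert (Hd : forall t, I t -> d t <> 0).
  { intros t It. apply lin_indep2_det. apply (HF t It). }
  assert (Hd' : forall t, I t -> is_derive d t 0)
    by (intros; now apply (frame2_det_const I (X 0%nat) e1 e2 w l)).
  assert (Hr : forall t, I t -> r t <> 0).
  { intros t It. destruct (HF t It) as (_ & Hw & _). apply Rgt_not_eq.
    apply Rdiv_lt_0_compat; auto. }
  assert (HA : forall n t, (n < 4)%nat -> I t ->
    is_derive (A n) t (w0 t * (A (S n) t + l t * r t * B n t))).
  { intros n t Hn It. destruct (HF t It) as (_ & _ & _ & _ & H2).
    eapply deriv_val; [apply deriv_det2; [now apply HX|exact H2]|].
    assert (w0 t <> 0) by auto. unfold A, B, r.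
    destruct (X n t), (X (S n) t), (e1 t), (e2 t). vec_unfold. field. auto. }
  assert (HB : forall n t, (n < 4)%nat -> I t ->
    is_derive (B n) t (w0 t * (B (S n) t - r t * A n t))).
  { intros n t Hn It. destruct (HF t It) as (_ & _ & _ & H1 & _).
    eapply deriv_val; [apply deriv_det2; [exact H1|now apply HX]|].
    assert (w0 t <> 0) by auto. unfold A, B, r.
    destruct (X n t), (X (S n) t), (e1 t), (e2 t). vec_unfold. field. auto. }
  assert (E1 : forall t, I t -> X 1%nat t = scal (r t) (e1 t)).
  { intros t It. destruct (HF t It) as (_ & _ & H0 & _).
    apply scal_inj2 with (w0 t); auto.
    apply eq_trans with (1 := is_derive_unique2 _ _ _ _ (HX 0%nat t ltac:(lia) It) H0).
    unfold r. assert (w0 t <> 0) by auto.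
    destruct (e1 t). vec_unfold. f_equal; field; auto. }
  assert (A1 : forall t, I t -> A 1%nat t = r t * d t).
  { intros t It. unfold A, d. rewrite E1 by auto. destruct (e1 t), (e2 t).
    vec_unfold. ring. }
  assert (B1 : forall t, I t -> 0 = B 1%nat t).
  { intros t It. unfold B. rewrite E1 by auto. destruct (e1 t). vec_unfold. ring. }
  assert (B2 : forall t, I t -> r t * r t * d t = B 2%nat t).
  { intros t It. assert (H := deriv_eq_on I _ _ t _ _ HI It B1 (deriv_const 0 t)
      (HB 1%nat t ltac:(lia) It)).
    rewrite A1 in H by auto. symmetry in H. apply Rmult_integral in H.
    destruct H as [H|H]; [now apply Hw0' in H|]. lra. }
  assert (Hr' : forall t, I t -> is_derive r t (w0 t * (A 2%nat t / d t))).
  { intros t It. apply (deriv_ext_on I (fun t => A 1%nat t / d t)); auto.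
    - intros z Iz. rewrite A1 by auto. field. auto.
    - eapply deriv_val;
        [exact (deriv_div _ _ t _ _ (Hd t It) (HA 1%nat t ltac:(lia) It) (Hd' t It))|].
      rewrite <- B1 by auto. field. auto. }
  assert (B3 : forall t, I t -> 3 * (r t * A 2%nat t) = B 3%nat t).
  { intros t It. assert (H := deriv_eq_on I _ _ t _ _ HI It B2
      (deriv_mult _ _ t _ _ (deriv_mult _ _ t _ _ (Hr' t It) (Hr' t It)) (Hd' t It))
      (HB 2%nat t ltac:(lia) It)).
    apply Rmult_eq_reg_l with (w0 t); auto.
    transitivity (w0 t * (B 3%nat t - r t * A 2%nat t) + w0 t * (r t * A 2%nat t)); [|ring].
    rewrite <- H. field. auto. }
  intros t It.
  assert (B4 : B 4%nat t = r t * A 3%nat t + 3 * (A 2%nat t * A 2%nat t / d t)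
     + 3 * r t * (A 3%nat t + l t * r t * (r t * r t * d t))).
  { assert (H := deriv_eq_on I _ _ t _ _ HI It B3
      (deriv_scal _ 3 t _ (deriv_mult _ _ t _ _ (Hr' t It) (HA 2%nat t ltac:(lia) It)))
      (HB 3%nat t ltac:(lia) It)).
    rewrite <- B2 in H by auto.
    apply Rmult_eq_reg_l with (w0 t); auto.
    transitivity (w0 t * (B 4%nat t - r t * A 3%nat t) + w0 t * (r t * A 3%nat t)); [ring|].
    rewrite <- H. field. auto. }
  assert (Hdt := Hd t It). assert (Hrt := Hr t It).
  assert (C : forall i j, det2 (X i t) (X j t) = (A i t * B j t - B i t * A j t) / d t).
  { intros i j. unfold A, B, d in *.
    apply Rmult_eq_reg_r with (det2 (e1 t) (e2 t)); auto.
    rewrite (det2_cramer (e1 t) (e2 t)). field. auto. }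
  assert (C12 : det2 (X 1%nat t) (X 2%nat t) = r t ^ 3 * d t).
  { rewrite C, A1, <- B1, <- B2 by auto. field. auto. }
  split; [exact C12|].
  - unfold planeQ. rewrite C12, !C, B4, A1, <- B1, <- B2, <- B3 by auto.
    fold (r t). field. auto.
Qed.

(** The same elimination as in the plane, with three coefficients at each order. *)
Lemma spaceQ_frame (I : R -> Prop) (w0 : R -> R) (X : nat -> R -> A3) e1 e2 e3 w l m :
  open I -> (forall t, I t -> 0 < w0 t) -> tower_on I w0 5 X ->
  frame3 I (X 0%nat) e1 e2 e3 w l m ->
  forall t, I t ->
    det3 (X 1%nat t) (X 2%nat t) (X 3%nat t)
    = (w t / w0 t) ^ 6 * det3 (e1 t) (e2 t) (e3 t) /\
    spaceQ (X 1%nat t) (X 2%nat t) (X 3%nat t) (X 4%nat t) (X 5%nat t)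
    = l t * (w t / w0 t) ^ 2.
Proof.
  intros HI Hw0 HX HF.
  set (d := fun t => det3 (e1 t) (e2 t) (e3 t)).
  set (A := fun n t => det3 (X n t) (e2 t) (e3 t)).
  set (B := fun n t => det3 (e1 t) (X n t) (e3 t)).
  set (C := fun n t => det3 (e1 t) (e2 t) (X n t)).
  set (r := fun t => w t / w0 t).
  assert (Hw0' : forall t, I t -> w0 t <> 0) by (intros t It; apply Rgt_not_eq, Hw0, It).
  assert (Hd : forall t, I t -> d t <> 0).
  { intros t It. apply lin_indep3_det. apply (HF t It). }
  assert (Hd' : forall t, I t -> is_derive d t 0)
    by (intros; now apply (frame3_det_const I (X 0%nat) e1 e2 e3 w l m)).
  assert (Hr : forall t, I t -> r t <> 0).
  { intros t It. destruct (HF t It) as (_ & Hw & _). apply Rgt_not_eq.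
    apply Rdiv_lt_0_compat; auto. }
  assert (HA : forall n t, (n < 5)%nat -> I t ->
    is_derive (A n) t (w0 t * (A (S n) t + m t * r t * C n t))).
  { intros n t Hn It. destruct (HF t It) as (_ & _ & _ & H1 & H2 & H3).
    eapply deriv_val; [apply deriv_det3; [now apply HX|exact H2|exact H3]|].
    assert (w0 t <> 0) by auto. unfold A, B, C, r.
    destruct (X n t) as [[? ?] ?], (X (S n) t) as [[? ?] ?], (e1 t) as [[? ?] ?],
      (e2 t) as [[? ?] ?], (e3 t) as [[? ?] ?]. vec_unfold. field. auto. }
  assert (HB : forall n t, (n < 5)%nat -> I t ->
    is_derive (B n) t (w0 t * (B (S n) t - r t * A n t + l t * r t * C n t))).
  { intros n t Hn It. destruct (HF t It) as (_ & _ & _ & H1 & H2 & H3).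
    eapply deriv_val; [apply deriv_det3; [exact H1|now apply HX|exact H3]|].
    assert (w0 t <> 0) by auto. unfold A, B, C, r.
    destruct (X n t) as [[? ?] ?], (X (S n) t) as [[? ?] ?], (e1 t) as [[? ?] ?],
      (e2 t) as [[? ?] ?], (e3 t) as [[? ?] ?]. vec_unfold. field. auto. }
  assert (HC : forall n t, (n < 5)%nat -> I t ->
    is_derive (C n) t (w0 t * (C (S n) t - r t * B n t))).
  { intros n t Hn It. destruct (HF t It) as (_ & _ & _ & H1 & H2 & H3).
    eapply deriv_val; [apply deriv_det3; [exact H1|exact H2|now apply HX]|].
    assert (w0 t <> 0) by auto. unfold A, B, C, r.
    destruct (X n t) as [[? ?] ?], (X (S n) t) as [[? ?] ?], (e1 t) as [[? ?] ?],
      (e2 t) as [[? ?] ?], (e3 t) as [[? ?] ?]. vec_unfold. field. auto. }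
  assert (E1 : forall t, I t -> X 1%nat t = scal (r t) (e1 t)).
  { intros t It. destruct (HF t It) as (_ & _ & H0 & _).
    apply scal_inj3 with (w0 t); auto.
    apply eq_trans with (1 := is_derive_unique3 _ _ _ _ (HX 0%nat t ltac:(lia) It) H0).
    unfold r. assert (w0 t <> 0) by auto.
    destruct (e1 t) as [[? ?] ?]. vec_unfold. f_equal; [f_equal|]; field; auto. }
  assert (A1 : forall t, I t -> A 1%nat t = r t * d t).
  { intros t It. unfold A, d. rewrite E1 by auto.
    destruct (e1 t) as [[? ?] ?], (e2 t) as [[? ?] ?], (e3 t) as [[? ?] ?].
    vec_unfold. ring. }
  assert (B1 : forall t, I t -> 0 = B 1%nat t).
  { intros t It. unfold B. rewrite E1 by auto.
    destruct (e1 t) as [[? ?] ?], (e3 t) as [[? ?] ?]. vec_unfold. ring. }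
  assert (C1 : forall t, I t -> 0 = C 1%nat t).
  { intros t It. unfold C. rewrite E1 by auto.
    destruct (e1 t) as [[? ?] ?], (e2 t) as [[? ?] ?]. vec_unfold. ring. }
  assert (C2 : forall t, I t -> 0 = C 2%nat t).
  { intros t It. assert (H := deriv_eq_on I _ _ t _ _ HI It C1 (deriv_const 0 t)
      (HC 1%nat t ltac:(lia) It)).
    rewrite <- B1 in H by auto. symmetry in H. apply Rmult_integral in H.
    destruct H as [H|H]; [now apply Hw0' in H|]. lra. }
  assert (B2 : forall t, I t -> r t * r t * d t = B 2%nat t).
  { intros t It. assert (H := deriv_eq_on I _ _ t _ _ HI It B1 (deriv_const 0 t)
      (HB 1%nat t ltac:(lia) It)).
    rewrite A1, <- C1 in H by auto. symmetry in H. apply Rmult_integral in H.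
    destruct H as [H|H]; [now apply Hw0' in H|]. lra. }
  assert (C3 : forall t, I t -> r t * (r t * r t) * d t = C 3%nat t).
  { intros t It. assert (H := deriv_eq_on I _ _ t _ _ HI It C2 (deriv_const 0 t)
      (HC 2%nat t ltac:(lia) It)).
    rewrite <- B2 in H by auto. symmetry in H. apply Rmult_integral in H.
    destruct H as [H|H]; [now apply Hw0' in H|]. lra. }
  assert (Hr' : forall t, I t -> is_derive r t (w0 t * (A 2%nat t / d t))).
  { intros t It. apply (deriv_ext_on I (fun t => A 1%nat t / d t)); auto.
    - intros z Iz. rewrite A1 by auto. field. auto.
    - eapply deriv_val;
        [exact (deriv_div _ _ t _ _ (Hd t It) (HA 1%nat t ltac:(lia) It) (Hd' t It))|].
      rewrite <- C1 by auto. field. auto. }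
  assert (HA2 : forall t, I t -> is_derive (A 2%nat) t (w0 t * A 3%nat t)).
  { intros t It. eapply deriv_val; [exact (HA 2%nat t ltac:(lia) It)|].
    rewrite <- C2 by auto. ring. }
  assert (B3 : forall t, I t -> 3 * (r t * A 2%nat t) = B 3%nat t).
  { intros t It. assert (H := deriv_eq_on I _ _ t _ _ HI It B2
      (deriv_mult _ _ t _ _ (deriv_mult _ _ t _ _ (Hr' t It) (Hr' t It)) (Hd' t It))
      (HB 2%nat t ltac:(lia) It)).
    rewrite <- C2 in H by auto.
    apply Rmult_eq_reg_l with (w0 t); auto.
    transitivity (w0 t * (B 3%nat t - r t * A 2%nat t + l t * r t * 0)
                  + w0 t * (r t * A 2%nat t)); [|ring].
    rewrite <- H. field. auto. }
  assert (C4 : forall t, I t -> 6 * (r t * r t * A 2%nat t) = C 4%nat t).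
  { intros t It. assert (H := deriv_eq_on I _ _ t _ _ HI It C3
      (deriv_mult _ _ t _ _ (deriv_mult _ _ t _ _ (Hr' t It)
        (deriv_mult _ _ t _ _ (Hr' t It) (Hr' t It))) (Hd' t It))
      (HC 3%nat t ltac:(lia) It)).
    rewrite <- B3 in H by auto.
    apply Rmult_eq_reg_l with (w0 t); auto.
    transitivity (w0 t * (C 4%nat t - r t * (3 * (r t * A 2%nat t)))
                  + w0 t * (3 * (r t * r t * A 2%nat t))); [|ring].
    rewrite <- H. field. auto. }
  intros t It.
  assert (B4 : B 4%nat t = r t * A 3%nat t + 3 * (A 2%nat t * A 2%nat t / d t)
     + 3 * r t * A 3%nat t - l t * r t * (r t * (r t * r t) * d t)).
  { assert (H := deriv_eq_on I _ _ t _ _ HI It B3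
      (deriv_scal _ 3 t _ (deriv_mult _ _ t _ _ (Hr' t It) (HA2 t It)))
      (HB 3%nat t ltac:(lia) It)).
    rewrite <- C3 in H by auto.
    apply Rmult_eq_reg_l with (w0 t); auto.
    transitivity (w0 t * (B 4%nat t - r t * A 3%nat t
         + l t * r t * (r t * (r t * r t) * d t))
       + w0 t * (r t * A 3%nat t - l t * r t * (r t * (r t * r t) * d t))); [ring|].
    rewrite <- H. field. auto. }
  assert (C5 : C 5%nat t = r t * B 4%nat t + 12 * r t * (A 2%nat t * A 2%nat t / d t)
     + 6 * (r t * r t * A 3%nat t)).
  { assert (H := deriv_eq_on I _ _ t _ _ HI It C4
      (deriv_scal _ 6 t _ (deriv_mult _ _ t _ _ (deriv_mult _ _ t _ _ (Hr' t It) (Hr' t It))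
         (HA2 t It)))
      (HC 4%nat t ltac:(lia) It)).
    apply Rmult_eq_reg_l with (w0 t); auto.
    transitivity (w0 t * (C 5%nat t - r t * B 4%nat t)
       + w0 t * (r t * B 4%nat t)); [ring|].
    rewrite <- H. field. auto. }
  assert (Hdt := Hd t It). assert (Hrt := Hr t It).
  assert (K : forall i j k, det3 (X i t) (X j t) (X k t)
    = (A i t * (B j t * C k t - C j t * B k t)
       - B i t * (A j t * C k t - C j t * A k t)
       + C i t * (A j t * B k t - B j t * A k t)) / d t ^ 2).
  { intros i j k. unfold A, B, C, d in *.
    apply Rmult_eq_reg_r with ((det3 (e1 t) (e2 t) (e3 t)) ^ 2); [|now apply pow_nonzero].
    rewrite (det3_cramer (e1 t) (e2 t) (e3 t)). field. auto. }
  assert (C123 : det3 (X 1%nat t) (X 2%nat t) (X 3%nat t) = r t ^ 6 * d t).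
  { rewrite K, A1, <- B1, <- C1, <- B2, <- C2, <- C3 by auto. field. auto. }
  split; [exact C123|].
  - unfold spaceQ. rewrite C123, !K, C5, B4, A1, <- B1, <- C1, <- B2, <- C2, <- C3, <- B3,
      <- C4 by auto.
    fold (r t). field. auto.
Qed.

(** * Towers of derivatives and compactly supported variations *)

Definition band (delta : R) (I : R -> Prop) : R -> R -> Prop :=
  fun eta t => Rabs eta < delta /\ I t.

Lemma open2_band delta I : open I -> open2 (band delta I).
Proof.
  intros HI x y [Hx Hy]. destruct (HI y Hy) as [d Hd].
  assert (Hm : 0 < Rmin d (delta - Rabs x)) by (apply Rmin_pos; [apply cond_pos|lra]).
  exists (mkposreal _ Hm). simpl. intros u v Hu Hv. split.
  - assert (M := Rmin_r d (delta - Rabs x)).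
    assert (H := Rabs_triang (u - x) x).
    replace (u - x + x) with u in H by ring. lra.
  - apply Hd. assert (M := Rmin_l d (delta - Rabs x)).
    change (Rabs (v - y) < d). lra.
Qed.

Fixpoint dtower (w : R -> R) (f : R -> R -> R) (n : nat) : R -> R -> R :=
  match n with
  | 0%nat => f
  | S n => fun eta t => / w t * D2 (dtower w f n) eta t
  end.

Lemma smooth2_dtower U w f n : open2 U -> (forall x t, U x t -> w t <> 0) ->
  smooth2 U (fun _ t => w t) -> smooth2 U f -> smooth2 U (dtower w f n).
Proof.
  intros HU Hw Hws Hf. induction n; auto. simpl.
  apply (smooth2_mult U (fun _ t => / w t) (D2 (dtower w f n))); auto using smooth2_D2.
  now apply smooth2_inv.
Qed.

Lemma dtower_derive2 U w f n x t : open2 U -> (forall x t, U x t -> w t <> 0) ->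
  smooth2 U (fun _ t => w t) -> smooth2 U f -> U x t ->
  is_derive (fun z => dtower w f n x z) t (w t * dtower w f (S n) x t).
Proof.
  intros HU Hw Hws Hf Hxt. simpl.
  eapply deriv_val.
  - apply (smooth2_derive2 U (dtower w f n)); auto. now apply smooth2_dtower.
  - field. now apply (Hw x).
Qed.

Lemma D2_ext_on U f g x t : open2 U -> U x t -> (forall u v, U u v -> f u v = g u v) ->
  D2 f x t = D2 g x t.
Proof.
  intros HU Hxt E. apply Derive_ext_loc.
  apply filter_imp with (2 := locally_2d_snd _ _ _ (HU x t Hxt)). intros v. apply E.
Qed.

(** Taking the variation commutes with differentiating along [w dt], because the weight [w]
    is that of the undeformed curve. *)
Lemma dtower_D1 U w f n x t : open2 U -> (forall x t, U x t -> w t <> 0) ->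
  smooth2 U (fun _ t => w t) -> smooth2 U f -> U x t ->
  is_derive (fun z => dtower w f n z t) x (dtower w (D1 f) n x t).
Proof.
  intros HU Hw Hws Hf. revert x t. induction n; intros x t Hxt.
  - now apply (smooth2_derive1 U).
  - simpl. apply (deriv_scal (fun z => D2 (dtower w f n) z t)).
    assert (Hs : smooth2 U (dtower w f n)) by now apply smooth2_dtower.
    eapply deriv_val.
    + apply (smooth2_derive1 U (D2 (dtower w f n))); auto using smooth2_D2.
    + rewrite (smooth2_schwarz U); auto.
      apply (D2_ext_on U); auto. intros u v Huv.
      apply is_derive_unique. now apply IHn.
Qed.

Lemma dtower_local_zero (K : R -> Prop) w f n x t : open K -> K t ->
  (forall u, K u -> f x u = 0) -> dtower w f n x t = 0.
Proof.
  intros HK Kt H. revert t Kt. induction n; intros t Kt; auto. simpl.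
  replace (D2 (dtower w f n) x t) with 0; [ring|].
  symmetry. apply is_derive_unique.
  apply (deriv_ext_on K (fun _ => 0)); auto.
  - intros u Ku. symmetry. now apply IHn.
  - apply deriv_const.
Qed.

Lemma continuous_zero_end (I : R -> Prop) (f : R -> R) (a b : R) : open I -> I a -> I b ->
  a <= b -> (forall t, I t -> continuity_pt f t) ->
  (forall t, I t -> ~ (a <= t <= b) -> f t = 0) -> f a = 0 /\ f b = 0.
Proof.
  intros HI Ia Ib Hab Hc Hz.
  assert (W : forall c, I c -> (forall d, 0 < d -> exists u, Rabs (u - c) < d /\ ~ (a <= u <= b)) ->
     f c = 0).
  { intros c Ic Hu. destruct (Req_dec (f c) 0) as [E|E]; auto. exfalso.
    destruct (Hc c Ic (Rabs (f c)) (Rabs_pos_lt _ E)) as (d & Hd & H).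
    destruct (interval_around I c HI Ic) as (d2 & Hd2 & HI2).
    destruct (Hu (Rmin d d2)) as (u & Hu1 & Hu2); [apply Rmin_pos; auto|].
    assert (M1 := Rmin_l d d2). assert (M2 := Rmin_r d d2).
    assert (Iu : I u) by (apply HI2; apply Rabs_lt_between in Hu1; lra).
    assert (Huc : c <> u) by (intros ->; apply E, Hz; auto).
    assert (H' : Rabs (f u - f c) < Rabs (f c)).
    { apply H. split; [split; [exact Logic.I|exact Huc]|]. unfold R_dist, dist; simpl.
      unfold R_dist. lra. }
    rewrite Hz in H' by auto.
    replace (0 - f c) with (- f c) in H' by ring. rewrite Rabs_Ropp in H'. lra. }
  split; apply W; auto; intros d Hd.
  - exists (a - d / 2). split; [|lra]. apply Rabs_lt_between. lra.
  - exists (b + d / 2). split; [|lra]. apply Rabs_lt_between. lra.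
Qed.

Lemma open_outside (I : R -> Prop) (a b : R) : open I -> a <= b ->
  open (fun u => I u /\ ~ (a <= u <= b)).
Proof.
  intros HI Hab. apply open_and; auto.
  apply open_ext with (fun u => u < a \/ b < u).
  - intros u. split; [intros [?|?]; lra|]. intros H.
    destruct (Rlt_dec u a); [now left|right; lra].
  - apply open_or; [apply open_lt|apply open_gt].
Qed.

(** Outside the support every derivative of the variation vanishes, and by continuity it
    does so at both ends; this kills the boundary terms of the integrations by parts. *)
Lemma dtower_support (I : R -> Prop) delta w f n a b : open I -> 0 < delta ->
  I a -> I b -> a <= b -> (forall t, I t -> w t <> 0) -> smooth1 I w ->
  smooth2 (band delta I) f ->
  (forall t, I t -> ~ (a <= t <= b) -> f 0 t = 0) ->
  dtower w f n 0 a = 0 /\ dtower w f n 0 b = 0.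
Proof.
  intros HI Hd Ia Ib Hab Hw Hws Hf Hz.
  assert (HU := open2_band delta I HI).
  assert (H0 : forall t, I t -> band delta I 0 t) by (intros; split; auto; now rewrite Rabs_R0).
  assert (Hs : smooth2 (band delta I) (dtower w f n)).
  { apply smooth2_dtower; auto.
    - intros x t [_ H]; auto.
    - apply smooth1_smooth2 with I; auto using open2_strip. intros x y [_ H]; auto. }
  apply (continuous_zero_end I (fun t => dtower w f n 0 t)); auto.
  - intros t It. eapply is_derive_continuity_pt.
    apply (smooth2_derive2 (band delta I) (dtower w f n)); auto.
  - intros t It Ht.
    apply (dtower_local_zero (fun u => I u /\ ~ (a <= u <= b))); auto.
    + now apply open_outside.
    + intros u [Iu Hu]; auto.
Qed.

Lemma compact_pos (f : R -> R -> R) (a b : R) : a <= b ->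
  (forall t, a <= t <= b -> continuity_2d_pt f 0 t) ->
  (forall t, a <= t <= b -> 0 < f 0 t) ->
  exists delta, 0 < delta /\
    forall eta t, Rabs eta < delta -> a <= t <= b -> 0 < f eta t.
Proof.
  intros Hab Hc Hp.
  destruct (continuity_ab_min (fun t => f 0 t) a b Hab) as (m & Hm & Hmab).
  { intros t Ht e He. destruct (Hc t Ht (mkposreal e He)) as [d Hd].
    exists d. split; [apply cond_pos|]. intros u [_ Hu].
    apply (Hd 0 u); [rewrite Rminus_eq_0, Rabs_R0; apply cond_pos|exact Hu]. }
  destruct (uniform_continuity_2d_1d' f a b 0 Hc (mkposreal _ (Hp m Hmab))) as [d Hd].
  exists d. split; [apply cond_pos|]. intros eta t Heta Ht.
  assert (H := Hd t 0 t eta). simpl in H.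
  assert (Hd0 := cond_pos d). apply Rabs_lt_between in Heta.
  assert (H' : Rabs (f eta t - f 0 t) < f 0 m).
  { apply H; try lra. rewrite Rminus_eq_0, Rabs_R0. lra. }
  apply Rabs_lt_between in H'. assert (H2 := Hm t Ht). lra.
Qed.

(** * First variation of a length *)

Lemma sign_eps x eps : (eps = 1 \/ eps = -1) -> sign x = eps -> 0 < eps * x.
Proof.
  intros He Hs. destruct (Rtotal_order x 0) as [H|[H|H]].
  - rewrite sign_eq_m1 in Hs by auto. subst eps. lra.
  - subst x. rewrite sign_0 in Hs. lra.
  - rewrite sign_eq_1 in Hs by auto. subst eps. lra.
Qed.

Lemma eps_sign x eps : (eps = 1 \/ eps = -1) -> 0 < eps * x -> sign x = eps.
Proof.
  intros [-> | ->] H; [apply sign_eq_1|apply sign_eq_m1]; lra.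
Qed.

(** No curve of a deformation has an inflection, so the sign of each of them can be read off
    at [eta = 0], one parameter value at a time. *)
Lemma nonvanishing_sign (Q : R -> R) eps delta eta :
  (forall z, Rabs z < delta -> continuity_pt Q z) ->
  (forall z, Rabs z < delta -> Q z <> 0) ->
  0 < eps * Q 0 -> Rabs eta < delta -> 0 < eps * Q eta.
Proof.
  intros Hc H0 Hp Heta.
  assert (Hd : 0 < delta) by (apply Rle_lt_trans with (2 := Heta), Rabs_pos).
  assert (HI : is_open_interval (fun z => Rabs z < delta)).
  { split; [|split].
    - apply open_ext with (fun z => z < delta /\ - delta < z).
      + intros z. rewrite Rabs_lt_between. lra.
      + apply open_and; [apply open_lt|apply open_gt].
    - exists 0. now rewrite Rabs_R0.
    - intros a b z. rewrite !Rabs_lt_between. lra. }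
  assert (I0 : Rabs 0 < delta) by now rewrite Rabs_R0.
  assert (He : eps <> 0) by (intros ->; lra).
  assert (Hc' : forall s t, Rabs t < delta -> continuity_pt (fun z => s * eps * Q z) t).
  { intros s t Ht. apply (continuity_pt_mult (fun _ => s * eps) Q); auto.
    now apply continuity_pt_const. }
  assert (Hn : eps * Q eta <> 0) by (apply Rmult_integral_contrapositive_currified; auto).
  destruct (Rlt_dec 0 (eps * Q eta)) as [H|H]; auto. exfalso.
  destruct (Rtotal_order 0 eta) as [L|[L|L]].
  - destruct (interval_intermediate _ (fun z => (-1) * eps * Q z) HI (Hc' (-1)) 0 eta 0)
      as (z & Hz & E); auto; try lra.
    apply (H0 z); [apply (proj2 (proj2 HI) 0 eta); auto|].
    apply Rmult_eq_reg_l with (- 1 * eps); lra.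
  - subst eta. lra.
  - destruct (interval_intermediate _ (fun z => 1 * eps * Q z) HI (Hc' 1) eta 0 0)
      as (z & Hz & E); auto; try lra.
    apply (H0 z); [apply (proj2 (proj2 HI) eta 0); auto|].
    apply Rmult_eq_reg_l with (1 * eps); lra.
Qed.

(** Differentiation under the integral sign for the length of a family whose length
    density is [sqrt |Q|] times a fixed weight. *)
Lemma length_variation (I : R -> Prop) (delta eps a b : R) (Q ga : R -> R -> R) (w0 : R -> R) :
  is_open_interval I -> 0 < delta -> (eps = 1 \/ eps = -1) ->
  I a -> I b -> a <= b ->
  smooth2 (band delta I) Q -> smooth1 I w0 ->
  (forall eta t, Rabs eta < delta -> I t -> Q eta t <> 0) ->
  (forall t, I t -> 0 < eps * Q 0 t) ->
  (forall eta t, Rabs eta < delta -> I t -> ga eta t = sqrt (sign (Q eta t) * Q eta t) * w0 t) ->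
  exists g : R -> R,
    is_derive (fun eta => RInt (ga eta) a b) 0 (RInt g a b) /\
    (forall t, I t -> continuous g t) /\
    (forall t q, I t -> is_derive (fun eta => Q eta t) 0 q ->
       g t = eps * q / (2 * sqrt (eps * Q 0 t)) * w0 t).
Proof.
  intros (HI & _ & Hcon) Hd He Ia Ib Hab HQ Hw0 Hn Hp Hga.
  assert (HU := open2_band delta I HI).
  assert (B0 : forall t, I t -> band delta I 0 t) by (intros; split; auto; now rewrite Rabs_R0).
  assert (Hpos : forall eta t, band delta I eta t -> 0 < eps * Q eta t).
  { intros eta t [Heta It].
    apply (nonvanishing_sign (fun z => Q z t) eps delta); auto.
    intros z Hz. eapply is_derive_continuity_pt.
    apply (smooth2_derive1 (band delta I) Q); auto. now split. }
  set (G := fun eta t => sqrt (eps * Q eta t) * w0 t).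
  assert (HsQ : smooth2 (band delta I) (fun eta t => eps * Q eta t)).
  { apply (smooth2_mult _ (fun _ _ => eps) Q); auto. now apply smooth2_const. }
  assert (HG : smooth2 (band delta I) G).
  { apply (smooth2_mult _ (fun eta t => sqrt (eps * Q eta t)) (fun _ t => w0 t)); auto.
    - apply (smooth2_comp _ (fun z => 0 < z) (fun eta t => eps * Q eta t) sqrt);
        auto using smooth1_sqrt. apply open2_strip, open_gt.
    - apply smooth1_smooth2 with I; auto using open2_strip. now intros x y [_ H]. }
  assert (EG : forall eta t, Rabs eta < delta -> I t -> ga eta t = G eta t).
  { intros eta t Heta It. rewrite Hga by auto. unfold G.
    now rewrite (eps_sign _ eps He (Hpos eta t (conj Heta It))). }
  assert (Hloc : locally 0 (fun eta => Rabs eta < delta)).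
  { exists (mkposreal _ Hd). intros z Hz. change (Rabs (z - 0) < delta) in Hz.
    now rewrite Rminus_0_r in Hz. }
  assert (HIab : forall t, Rmin a b <= t <= Rmax a b -> I t).
  { intros t. rewrite Rmin_left, Rmax_right by auto. now apply Hcon. }
  exists (fun t => D1 G 0 t). split; [|split].
  - apply is_derive_ext_loc with (fun eta => RInt (fun t => G eta t) a b).
    { apply filter_imp with (2 := Hloc). intros eta Heta.
      apply RInt_ext. intros t Ht. symmetry. apply EG; auto. apply HIab; lra. }
    apply (is_derive_RInt_param G).
    + apply filter_imp with (2 := Hloc). intros eta Heta t Ht. eexists.
      apply (smooth2_derive1 (band delta I) G); auto. split; auto.
    + intros t Ht. apply (smooth2_continuity (band delta I) (D1 G)); auto.
      now apply smooth2_D1.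
    + apply filter_imp with (2 := Hloc). intros eta Heta.
      apply (ex_RInt_continuous (V := R_CompleteNormedModule)). intros t Ht.
      apply (ex_derive_continuous (K := R_AbsRing) (V := R_NormedModule)). eexists.
      apply (smooth2_derive2 (band delta I) G); auto. split; auto.
  - intros t It. apply (ex_derive_continuous (K := R_AbsRing) (V := R_NormedModule)). eexists.
    apply (smooth2_derive2 (band delta I) (D1 G)); auto using smooth2_D1.
  - intros t q It Hq. apply is_derive_unique. unfold G.
    assert (Hs : 0 < sqrt (eps * Q 0 t)) by (apply sqrt_lt_R0, Hpos, B0, It).
    eapply deriv_val.
    + apply (deriv_mult (fun z => sqrt (eps * Q z t)) (fun _ => w0 t)).
      * apply (is_derive_sqrt (fun z => eps * Q z t)); [|apply Hpos, B0, It].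
        apply deriv_scal, Hq.
      * apply deriv_const.
    + simpl. field. lra.
Qed.

Lemma RInt_exact (I : R -> Prop) (Phi g : R -> R) a b : is_open_interval I ->
  I a -> I b -> a <= b -> (forall t, I t -> is_derive Phi t (g t)) ->
  (forall t, I t -> continuous g t) -> Phi a = 0 -> Phi b = 0 -> RInt g a b = 0.
Proof.
  intros (HI & _ & Hcon) Ia Ib Hab HP Hg Ea Eb.
  assert (HIab : forall t, Rmin a b <= t <= Rmax a b -> I t).
  { intros t. rewrite Rmin_left, Rmax_right by auto. now apply Hcon. }
  apply is_RInt_unique. replace 0 with (minus (Phi b) (Phi a)).
  - apply (is_RInt_derive Phi g); auto.
  - rewrite Ea, Eb. unfold minus, plus, opp; simpl. ring.
Qed.

(** * The two first-variation identities *)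

Ltac derive_rules :=
  cbv beta;
  lazymatch goal with
  | |- is_derive (fun _ => ?c) _ _ => apply deriv_const
  | |- is_derive (fun z => @?f z + @?g z) _ _ => apply (deriv_plus f g); derive_rules
  | |- is_derive (fun z => @?f z - @?g z) _ _ => apply (deriv_minus f g); derive_rules
  | |- is_derive (fun z => @?f z * @?g z) _ _ => apply (deriv_mult f g); derive_rules
  | |- is_derive (fun z => - @?f z) _ _ => apply (deriv_opp f); derive_rules
  | _ => eassumption
  end.

(** The first variation of the plane length density, written as an exact derivative minus
    the Euler-Lagrange term. Here [a] and [b] are the tower of the variation field paired
    with [e1] and [e2], and [h] is the tower of [|l|^(-1/2)]; integrating by parts against
    [h] moves every derivative off the field. *)
Lemma plane_concomitant (w l L1 h0 h1 h2 h3 a0 a1 a2 a3 b0 b1 b2 : R -> R) (h4 a4 b3 t : R) :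
  is_derive h0 t (w t * h1 t) -> is_derive h1 t (w t * h2 t) ->
  is_derive h2 t (w t * h3 t) -> is_derive h3 t (w t * h4) ->
  is_derive l t (w t * L1 t) ->
  is_derive a0 t (w t * (b0 t + a1 t)) -> is_derive a1 t (w t * (b1 t + a2 t)) ->
  is_derive a2 t (w t * (b2 t + a3 t)) -> is_derive a3 t (w t * (b3 + a4)) ->
  is_derive b0 t (w t * (b1 t - l t * a0 t)) -> is_derive b1 t (w t * (b2 t - l t * a1 t)) ->
  is_derive b2 t (w t * (b3 - l t * a2 t)) ->
  h0 t <> 0 -> L1 t * h0 t + 2 * (l t * h1 t) = 0 ->
  is_derive (fun z => / 3 * (h0 z * (a3 z + l z * a1 z)) + (h0 z * b2 z - / 3 * (h1 z * a2 z))
      + (a1 z * (l z * h0 z + / 3 * h2 z) - 2 / 3 * (h1 z * b1 z))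
      + / 3 * (b0 z * h2 z - a0 z * h3 z)) t
    (w t * (h0 t * (/ 3 * a4 + 4 / 3 * b3 + / 3 * (l t * a2 t) + 4 / 3 * (l t * b1 t)
        + / 3 * (L1 t * a1 t)) - / 3 * (a0 t * (h4 + l t * h2 t)))).
Proof.
  intros. eapply deriv_val; [derive_rules|].
  replace (L1 t) with (- 2 * (l t * h1 t) / h0 t) by (field_simplify_eq; lra).
  field. assumption.
Qed.

(** The space analogue. Once [h] satisfies the plane Euler-Lagrange equation and [m] is the
    derivative of [l], the variation of the density is exact: no condition is left on the
    variation field. *)
Lemma space_concomitant (w l L1 m h0 h1 h2 h3 a0 a1 a2 a3 a4 b0 b1 b2 b3 c0 c1 c2 : R -> R)
    (M1 a5 b4 c3 t : R) :
  is_derive h0 t (w t * h1 t) -> is_derive h1 t (w t * h2 t) ->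
  is_derive h2 t (w t * h3 t) -> is_derive h3 t (w t * (- l t * h2 t)) ->
  is_derive l t (w t * L1 t) -> is_derive m t (w t * M1) ->
  is_derive a0 t (w t * (b0 t + a1 t)) -> is_derive a1 t (w t * (b1 t + a2 t)) ->
  is_derive a2 t (w t * (b2 t + a3 t)) -> is_derive a3 t (w t * (b3 t + a4 t)) ->
  is_derive a4 t (w t * (b4 + a5)) ->
  is_derive b0 t (w t * (c0 t - l t * a0 t + b1 t)) ->
  is_derive b1 t (w t * (c1 t - l t * a1 t + b2 t)) ->
  is_derive b2 t (w t * (c2 t - l t * a2 t + b3 t)) ->
  is_derive b3 t (w t * (c3 - l t * a3 t + b4)) ->
  is_derive c0 t (w t * (m t * a0 t + c1 t)) -> is_derive c1 t (w t * (m t * a1 t + c2 t)) ->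
  is_derive c2 t (w t * (m t * a2 t + c3)) ->
  h0 t <> 0 -> L1 t * h0 t + 2 * (l t * h1 t) = 0 -> m t = L1 t ->
  is_derive (fun z => 2 / 3 * (h0 z * (a4 z + l z * a2 z + m z * a1 z))
      + (h0 z * b3 z - 2 / 3 * (h1 z * a3 z))
      - (h0 z * (c2 z - l z * a2 z) + / 3 * (h1 z * b2 z) - 2 / 3 * (h2 z * a2 z))
      + (4 / 3 * (h1 z * (c1 z - l z * a1 z)) - / 3 * (h2 z * b1 z) - 2 / 3 * (h3 z * a1 z)
         - 2 / 3 * (l z * h1 z * a1 z))
      - (h2 z * (c0 z - l z * a0 z) - h3 z * b0 z)) t
    (w t * (h0 t * (2 / 3 * (a5 + b4 + l t * a3 t + (L1 t + m t) * a2 t + l t * b2 t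
        + M1 * a1 t + m t * b1 t) + b4 + l t * b2 t + m t * b1 t))).
Proof.
  intros. eapply deriv_val; [derive_rules|].
  replace (m t) with (L1 t) by auto.
  replace (L1 t) with (- 2 * (l t * h1 t) / h0 t) by (field_simplify_eq; lra).
  field. assumption.
Qed.

Definition comb2 (a b : R) (u v : A2) : A2 := plus (scal a u) (scal b v).
Definition comb3 (a b c : R) (u v x : A3) : A3 :=
  plus (plus (scal a u) (scal b v)) (scal c x).

(** At an equi-affinely parametrized curve the quadratic term of [planeQ] vanishes to
    second order, so only the determinants that are linear in the variation survive. *)
Lemma planeQ_variation (X1 X2 X3 X4 : R -> A2) (V1 V2 V3 V4 e1 e2 : A2) (l L1 x : R) :
  is_derive X1 x V1 -> is_derive X2 x V2 -> is_derive X3 x V3 -> is_derive X4 x V4 ->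
  X1 x = e1 -> X2 x = e2 -> X3 x = comb2 (- l) 0 e1 e2 -> X4 x = comb2 (- L1) (- l) e1 e2 ->
  det2 e1 e2 <> 0 ->
  is_derive (fun z => planeQ (X1 z) (X2 z) (X3 z) (X4 z)) x
    ((/ 3 * det2 e1 V4 + 4 / 3 * det2 e2 V3 + / 3 * (l * det2 e1 V2) + 4 / 3 * (l * det2 e2 V1)
      + / 3 * (L1 * det2 e1 V1)) / det2 e1 e2).
Proof.
  intros H1 H2 H3 H4 E1 E2 E3 E4 Hd. unfold planeQ.
  assert (Hd' : det2 (X1 x) (X2 x) <> 0) by now rewrite E1, E2.
  eapply deriv_val.
  - apply deriv_minus.
    + apply deriv_div.
      * apply Rmult_integral_contrapositive_currified; auto; lra.
      * apply deriv_plus; [apply deriv_scal|]; apply deriv_det2; eassumption.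
      * apply deriv_scal, deriv_det2; eassumption.
    + apply deriv_scal, (is_derive_pow (fun z => det2 (X1 z) (X3 z) / det2 (X1 z) (X2 z)) 2).
      apply deriv_div; [assumption|apply deriv_det2; eassumption..].
  - cbv beta. rewrite E1, E2, E3, E4. revert Hd. clear. unfold comb2.
    destruct e1, e2, V1, V2, V3, V4. vec_unfold. intros Hd. field. auto.
Qed.

Lemma spaceQ_variation (X1 X2 X3 X4 X5 : R -> A3) (V1 V2 V3 V4 V5 e1 e2 e3 : A3)
    (l L1 m M1 x : R) :
  is_derive X1 x V1 -> is_derive X2 x V2 -> is_derive X3 x V3 -> is_derive X4 x V4 ->
  is_derive X5 x V5 ->
  X1 x = e1 -> X2 x = e2 -> X3 x = e3 -> X4 x = comb3 (- m) (- l) 0 e1 e2 e3 ->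
  X5 x = comb3 (- M1) (- (m + L1)) (- l) e1 e2 e3 ->
  det3 e1 e2 e3 <> 0 ->
  is_derive (fun z => spaceQ (X1 z) (X2 z) (X3 z) (X4 z) (X5 z)) x
    ((2 / 3 * (det3 e1 e2 V5 + det3 e1 e3 V4 + l * det3 e1 e2 V3 + (L1 + m) * det3 e1 e2 V2
        + l * det3 e1 e3 V2 + M1 * det3 e1 e2 V1 + m * det3 e1 e3 V1)
      + det3 e1 e3 V4 + l * det3 e1 e3 V2 + m * det3 e1 e3 V1) / det3 e1 e2 e3).
Proof.
  intros H1 H2 H3 H4 H5 E1 E2 E3 E4 E5 Hd. unfold spaceQ.
  assert (Hd' : det3 (X1 x) (X2 x) (X3 x) <> 0) by now rewrite E1, E2, E3.
  eapply deriv_val.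
  - apply deriv_minus.
    + apply deriv_div.
      * apply Rmult_integral_contrapositive_currified; auto; lra.
      * apply deriv_plus; apply deriv_scal, deriv_det3; eassumption.
      * apply deriv_scal, deriv_det3; eassumption.
    + apply deriv_scal,
        (is_derive_pow (fun z => det3 (X1 z) (X2 z) (X4 z) / det3 (X1 z) (X2 z) (X3 z)) 2).
      apply deriv_div; [assumption|apply deriv_det3; eassumption..].
  - cbv beta. rewrite E1, E2, E3, E4, E5. revert Hd. clear. unfold comb3.
    destruct e1 as [[? ?] ?], e2 as [[? ?] ?], e3 as [[? ?] ?], V1 as [[? ?] ?],
      V2 as [[? ?] ?], V3 as [[? ?] ?], V4 as [[? ?] ?], V5 as [[? ?] ?].
    vec_unfold. intros Hd. field. auto.
Qed.

(** * Families of curves *)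

Ltac smooth_rules :=
  cbv beta;
  lazymatch goal with
  | |- smooth2 _ (fun _ _ => ?c) => apply smooth2_const; assumption
  | |- smooth2 _ (fun x y => @?f x y + @?g x y) =>
      apply (smooth2_plus _ f g); [assumption|smooth_rules..]
  | |- smooth2 _ (fun x y => @?f x y - @?g x y) =>
      apply (smooth2_minus _ f g); [assumption|smooth_rules..]
  | |- smooth2 _ (fun x y => @?f x y * @?g x y) =>
      apply (smooth2_mult _ f g); [assumption|smooth_rules..]
  | |- smooth2 _ (fun x y => - @?f x y) =>
      apply (smooth2_opp _ f); [assumption|smooth_rules]
  | |- smooth2 _ (fun x y => (@?f x y) ^ ?n) =>
      apply (smooth2_pow _ f n); [assumption|smooth_rules]
  | |- smooth2 _ (fun x y => @?f x y / @?g x y) =>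
      apply (smooth2_div _ f g); [assumption| |smooth_rules..]
  | |- smooth2 _ (fun x y => / @?f x y) =>
      apply (smooth2_inv _ f); [assumption| |smooth_rules]
  | _ => auto
  end.

(** The derivatives along [w dt] of all curves of a family are taken with one weight [w],
    that of the undeformed curve. *)
Definition family2 (w : R -> R) (X : R -> R -> A2) (n : nat) (eta t : R) : A2 :=
  (dtower w (fun h u => fst (X h u)) n eta t, dtower w (fun h u => snd (X h u)) n eta t).

Definition family3 (w : R -> R) (X : R -> R -> A3) (n : nat) (eta t : R) : A3 :=
  (dtower w (fun h u => fst (fst (X h u))) n eta t,
   dtower w (fun h u => snd (fst (X h u))) n eta t,
   dtower w (fun h u => snd (X h u)) n eta t).

Definition variation2 (X : R -> R -> A2) (eta t : R) : A2 :=
  (D1 (fun h u => fst (X h u)) eta t, D1 (fun h u => snd (X h u)) eta t).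

Definition variation3 (X : R -> R -> A3) (eta t : R) : A3 :=
  (D1 (fun h u => fst (fst (X h u))) eta t,
   D1 (fun h u => snd (fst (X h u))) eta t,
   D1 (fun h u => snd (X h u)) eta t).

Definition smooth_family2 U (X : R -> R -> A2) : Prop :=
  smooth2 U (fun h u => fst (X h u)) /\ smooth2 U (fun h u => snd (X h u)).

Definition smooth_family3 U (X : R -> R -> A3) : Prop :=
  smooth2 U (fun h u => fst (fst (X h u))) /\
  smooth2 U (fun h u => snd (fst (X h u))) /\ smooth2 U (fun h u => snd (X h u)).

Lemma frame2_ext I x x' e1 e2 w l : open I -> (forall t, I t -> x t = x' t) ->
  frame2 I x e1 e2 w l -> frame2 I x' e1 e2 w l.
Proof.
  intros HI E H t It. destruct (H t It) as (Q1 & Q2 & Q3 & Q4).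
  split; [exact Q1|]. split; [exact Q2|]. split; [|exact Q4].
  apply is_derive_ext_loc with x; auto. apply filter_imp with (2 := HI t It). exact E.
Qed.

Lemma frame3_ext I x x' e1 e2 e3 w l m : open I -> (forall t, I t -> x t = x' t) ->
  frame3 I x e1 e2 e3 w l m -> frame3 I x' e1 e2 e3 w l m.
Proof.
  intros HI E H t It. destruct (H t It) as (Q1 & Q2 & Q3 & Q4).
  split; [exact Q1|]. split; [exact Q2|]. split; [|exact Q4].
  apply is_derive_ext_loc with x; auto. apply filter_imp with (2 := HI t It). exact E.
Qed.

Lemma family2_tower U I w X N eta : open2 U -> (forall x t, U x t -> w t <> 0) ->
  smooth2 U (fun _ t => w t) -> smooth_family2 U X -> (forall t, I t -> U eta t) ->
  tower_on I w N (fun n t => family2 w X n eta t).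
Proof.
  intros HU Hw Hws (S1 & S2) HI n t _ It. apply is_derive_A2.
  split; apply (dtower_derive2 U); auto.
Qed.

Lemma family3_tower U I w X N eta : open2 U -> (forall x t, U x t -> w t <> 0) ->
  smooth2 U (fun _ t => w t) -> smooth_family3 U X -> (forall t, I t -> U eta t) ->
  tower_on I w N (fun n t => family3 w X n eta t).
Proof.
  intros HU Hw Hws (S1 & S2 & S3) HI n t _ It. apply is_derive_A3.
  split; [|split]; apply (dtower_derive2 U); auto.
Qed.

Lemma family2_variation U w X n eta t : open2 U -> (forall x t, U x t -> w t <> 0) ->
  smooth2 U (fun _ t => w t) -> smooth_family2 U X -> U eta t ->
  is_derive (fun z => family2 w X n z t) eta (family2 w (variation2 X) n eta t).
Proof.
  intros HU Hw Hws (S1 & S2) Hx. apply is_derive_A2.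
  split; apply (dtower_D1 U); auto.
Qed.

Lemma family3_variation U w X n eta t : open2 U -> (forall x t, U x t -> w t <> 0) ->
  smooth2 U (fun _ t => w t) -> smooth_family3 U X -> U eta t ->
  is_derive (fun z => family3 w X n z t) eta (family3 w (variation3 X) n eta t).
Proof.
  intros HU Hw Hws (S1 & S2 & S3) Hx. apply is_derive_A3.
  split; [|split]; apply (dtower_D1 U); auto.
Qed.

Lemma smooth_family2_variation U X : smooth_family2 U X -> smooth_family2 U (variation2 X).
Proof. intros (S1 & S2). split; simpl; apply smooth2_D1; assumption. Qed.

Lemma smooth_family3_variation U X : smooth_family3 U X -> smooth_family3 U (variation3 X).
Proof.
  intros (S1 & S2 & S3).
  split; [|split]; simpl; apply smooth2_D1; assumption.
Qed.

Lemma smooth2_planeQ U w X : open2 U -> (forall x t, U x t -> w t <> 0) ->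
  smooth2 U (fun _ t => w t) -> smooth_family2 U X ->
  (forall x t, U x t -> det2 (family2 w X 1 x t) (family2 w X 2 x t) <> 0) ->
  smooth2 U (fun x t => planeQ (family2 w X 1 x t) (family2 w X 2 x t)
                          (family2 w X 3 x t) (family2 w X 4 x t)).
Proof.
  intros HU Hw Hws (S1 & S2) Hd.
  assert (T1 := fun n => smooth2_dtower U w _ n HU Hw Hws S1).
  assert (T2 := fun n => smooth2_dtower U w _ n HU Hw Hws S2).
  unfold family2, planeQ, det2 in *. cbn [fst snd] in *.
  set (x1 := dtower w (fun h u => fst (X h u))) in *.
  set (x2 := dtower w (fun h u => snd (X h u))) in *. clearbody x1 x2.
  smooth_rules; try (apply T1 || apply T2); auto.
Qed.

Lemma smooth2_spaceQ U w X : open2 U -> (forall x t, U x t -> w t <> 0) ->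
  smooth2 U (fun _ t => w t) -> smooth_family3 U X ->
  (forall x t, U x t ->
     det3 (family3 w X 1 x t) (family3 w X 2 x t) (family3 w X 3 x t) <> 0) ->
  smooth2 U (fun x t => spaceQ (family3 w X 1 x t) (family3 w X 2 x t)
                          (family3 w X 3 x t) (family3 w X 4 x t) (family3 w X 5 x t)).
Proof.
  intros HU Hw Hws (S1 & S2 & S3) Hd.
  assert (T1 := fun n => smooth2_dtower U w _ n HU Hw Hws S1).
  assert (T2 := fun n => smooth2_dtower U w _ n HU Hw Hws S2).
  assert (T3 := fun n => smooth2_dtower U w _ n HU Hw Hws S3).
  unfold family3, spaceQ, det3 in *. cbn [fst snd] in *.
  set (x1 := dtower w (fun h u => fst (fst (X h u)))) in *.
  set (x2 := dtower w (fun h u => snd (fst (X h u)))) in *.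
  set (x3 := dtower w (fun h u => snd (X h u))) in *. clearbody x1 x2 x3.
  smooth_rules; try (apply T1 || apply T2 || apply T3); auto.
Qed.

Lemma tower_step2 (I : R -> Prop) (f g : R -> A2) w (u v : R -> A2) : open I ->
  (forall t, I t -> w t <> 0) -> (forall t, I t -> f t = g t) ->
  (forall t, I t -> is_derive f t (scal (w t) (u t))) ->
  (forall t, I t -> is_derive g t (scal (w t) (v t))) ->
  forall t, I t -> u t = v t.
Proof.
  intros HI Hw E Hf Hg t It. apply scal_inj2 with (w t); auto.
  apply (is_derive_unique2 g t); auto.
  apply is_derive_ext_loc with f; auto. apply filter_imp with (2 := HI t It). exact E.
Qed.

Lemma tower_step3 (I : R -> Prop) (f g : R -> A3) w (u v : R -> A3) : open I ->
  (forall t, I t -> w t <> 0) -> (forall t, I t -> f t = g t) ->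
  (forall t, I t -> is_derive f t (scal (w t) (u t))) ->
  (forall t, I t -> is_derive g t (scal (w t) (v t))) ->
  forall t, I t -> u t = v t.
Proof.
  intros HI Hw E Hf Hg t It. apply scal_inj3 with (w t); auto.
  apply (is_derive_unique3 g t); auto.
  apply is_derive_ext_loc with f; auto. apply filter_imp with (2 := HI t It). exact E.
Qed.

Lemma frame2_tower I x e1 e2 w l L1 (X : nat -> R -> A2) : open I ->
  frame2 I x e1 e2 w l -> (forall t, I t -> is_derive l t (w t * L1 t)) ->
  tower_on I w 4 X -> (forall t, I t -> X 0%nat t = x t) ->
  forall t, I t ->
    X 1%nat t = e1 t /\ X 2%nat t = e2 t /\
    X 3%nat t = comb2 (- l t) 0 (e1 t) (e2 t) /\
    X 4%nat t = comb2 (- L1 t) (- l t) (e1 t) (e2 t).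
Proof.
  intros HI HF Hl HX E0.
  assert (Hw : forall t, I t -> w t <> 0) by (intros t It; apply Rgt_not_eq, (HF t It)).
  assert (E1 : forall t, I t -> X 1%nat t = e1 t).
  { apply (tower_step2 I (X 0%nat) x w _ _ HI Hw E0);
      intros t It; [apply HX; [lia|assumption]|apply (HF t It)]. }
  assert (E2 : forall t, I t -> X 2%nat t = e2 t).
  { apply (tower_step2 I (X 1%nat) e1 w _ _ HI Hw E1);
      intros t It; [apply HX; [lia|assumption]|apply (HF t It)]. }
  assert (E3 : forall t, I t -> X 3%nat t = comb2 (- l t) 0 (e1 t) (e2 t)).
  { apply (tower_step2 I (X 2%nat) e2 w _ _ HI Hw E2);
      intros t It; [apply HX; [lia|assumption]|].
    destruct (HF t It) as (_ & _ & _ & _ & H).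
    replace (scal (w t) (comb2 (- l t) 0 (e1 t) (e2 t))) with (scal (- l t * w t) (e1 t)); auto.
    unfold comb2. destruct (e1 t), (e2 t). vec_unfold. f_equal; ring. }
  intros t It. split; [|split; [|split]]; auto. revert t It.
  apply (tower_step2 I (X 3%nat) (fun t => comb2 (- l t) 0 (e1 t) (e2 t)) w _ _ HI Hw E3);
      intros t It; [apply HX; [lia|assumption]|].
  destruct (HF t It) as (_ & _ & _ & H1 & H2).
  assert (H := Hl t It).
  apply is_derive_A2 in H1, H2. destruct H1 as [H11 H12], H2 as [H21 H22].
  apply is_derive_A2. unfold comb2.
  split; vec_unfold; (eapply deriv_val; [derive_rules|]);
    cbv beta; destruct (e1 t), (e2 t); vec_unfold; ring.
Qed.

Lemma frame3_tower I x e1 e2 e3 w l m L1 M1 (X : nat -> R -> A3) : open I ->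
  frame3 I x e1 e2 e3 w l m -> (forall t, I t -> is_derive l t (w t * L1 t)) ->
  (forall t, I t -> is_derive m t (w t * M1 t)) ->
  tower_on I w 5 X -> (forall t, I t -> X 0%nat t = x t) ->
  forall t, I t ->
    X 1%nat t = e1 t /\ X 2%nat t = e2 t /\ X 3%nat t = e3 t /\
    X 4%nat t = comb3 (- m t) (- l t) 0 (e1 t) (e2 t) (e3 t) /\
    X 5%nat t = comb3 (- M1 t) (- (m t + L1 t)) (- l t) (e1 t) (e2 t) (e3 t).
Proof.
  intros HI HF Hl Hm HX E0.
  assert (Hw : forall t, I t -> w t <> 0) by (intros t It; apply Rgt_not_eq, (HF t It)).
  assert (E1 : forall t, I t -> X 1%nat t = e1 t).
  { apply (tower_step3 I (X 0%nat) x w _ _ HI Hw E0);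
      intros t It; [apply HX; [lia|assumption]|apply (HF t It)]. }
  assert (E2 : forall t, I t -> X 2%nat t = e2 t).
  { apply (tower_step3 I (X 1%nat) e1 w _ _ HI Hw E1);
      intros t It; [apply HX; [lia|assumption]|apply (HF t It)]. }
  assert (E3 : forall t, I t -> X 3%nat t = e3 t).
  { apply (tower_step3 I (X 2%nat) e2 w _ _ HI Hw E2);
      intros t It; [apply HX; [lia|assumption]|apply (HF t It)]. }
  assert (E4 : forall t, I t -> X 4%nat t = comb3 (- m t) (- l t) 0 (e1 t) (e2 t) (e3 t)).
  { apply (tower_step3 I (X 3%nat) e3 w _ _ HI Hw E3);
      intros t It; [apply HX; [lia|assumption]|].
    destruct (HF t It) as (_ & _ & _ & _ & _ & H).
    replace (scal (w t) (comb3 (- m t) (- l t) 0 (e1 t) (e2 t) (e3 t)))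
      with (plus (scal (- m t * w t) (e1 t)) (scal (- l t * w t) (e2 t))); auto.
    unfold comb3. destruct (e1 t) as [[? ?] ?], (e2 t) as [[? ?] ?], (e3 t) as [[? ?] ?].
    vec_unfold. f_equal; [f_equal|]; ring. }
  intros t It. split; [|split; [|split; [|split]]]; auto. revert t It.
  apply (tower_step3 I (X 4%nat) (fun t => comb3 (- m t) (- l t) 0 (e1 t) (e2 t) (e3 t)) w _ _ HI Hw E4);
      intros t It; [apply HX; [lia|assumption]|].
  destruct (HF t It) as (_ & _ & _ & H1 & H2 & H3).
  assert (H := Hl t It). assert (H' := Hm t It).
  apply is_derive_A3 in H1, H2, H3.
  destruct H1 as (H11 & H12 & H13), H2 as (H21 & H22 & H23), H3 as (H31 & H32 & H33).
  apply is_derive_A3. unfold comb3.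
  split; [|split]; vec_unfold; (eapply deriv_val; [derive_rules|]);
    cbv beta; destruct (e1 t) as [[? ?] ?], (e2 t) as [[? ?] ?], (e3 t) as [[? ?] ?];
    vec_unfold; ring.
Qed.

Lemma ga_length_Q w0 w l Q t : 0 < w0 t -> 0 < w t -> Q = l t * (w t / w0 t) ^ 2 ->
  ga_length w l t = sqrt (sign Q * Q) * w0 t.
Proof.
  intros H0 H ->. unfold ga_length.
  assert (Hr : 0 < w t / w0 t) by now apply Rdiv_lt_0_compat.
  rewrite sign_mult, (sign_eq_1 ((w t / w0 t) ^ 2)) by now apply pow_lt.
  replace (sign (l t) * 1 * (l t * (w t / w0 t) ^ 2))
    with (sign (l t) * l t * (w t / w0 t) ^ 2) by ring.
  rewrite (sqrt_mult_alt (sign (l t) * l t)).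
  2:{ destruct (Rtotal_order (l t) 0) as [L|[L|L]].
      - rewrite sign_eq_m1 by lra. lra.
      - rewrite L. lra.
      - rewrite sign_eq_1 by lra. lra. }
  rewrite sqrt_pow2 by lra. field. lra.
Qed.

(** * Extremality of the space curve *)

Lemma dtower_D1_support (I : R -> Prop) delta w f x0 n a b : open I -> 0 < delta ->
  I a -> I b -> a <= b -> (forall t, I t -> w t <> 0) -> smooth1 I w ->
  smooth2 (band delta I) f ->
  (forall eta t, Rabs eta < delta -> I t -> ~ (a <= t <= b) -> f eta t = x0 t) ->
  dtower w (D1 f) n 0 a = 0 /\ dtower w (D1 f) n 0 b = 0.
Proof.
  intros HI Hd Ia Ib Hab Hw Hws Hf Hz.
  apply (dtower_support I delta); auto using smooth2_D1.
  intros t It Ht. apply is_derive_unique.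
  apply is_derive_ext_loc with (fun _ => x0 t); [|apply deriv_const].
  exists (mkposreal _ Hd). intros z Hz'. change (Rabs (z - 0) < delta) in Hz'.
  rewrite Rminus_0_r in Hz'. symmetry. now apply Hz.
Qed.

Lemma family2_support I delta w X x0 n a b : open I -> 0 < delta ->
  I a -> I b -> a <= b -> (forall t, I t -> w t <> 0) -> smooth1 I w ->
  smooth_family2 (band delta I) X ->
  (forall eta t, Rabs eta < delta -> I t -> ~ (a <= t <= b) -> X eta t = x0 t) ->
  family2 w (variation2 X) n 0 a = zero /\ family2 w (variation2 X) n 0 b = zero.
Proof.
  intros HI Hd Ia Ib Hab Hw Hws (S1 & S2) Hz.
  destruct (dtower_D1_support I delta w _ (fun t => fst (x0 t)) n a b HI Hd Ia Ib Hab Hw Hws S1)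
    as [A1 B1]. { intros. now rewrite Hz. }
  destruct (dtower_D1_support I delta w _ (fun t => snd (x0 t)) n a b HI Hd Ia Ib Hab Hw Hws S2)
    as [A2 B2]. { intros. now rewrite Hz. }
  split; apply injective_projections; assumption.
Qed.

Lemma family3_support I delta w X x0 n a b : open I -> 0 < delta ->
  I a -> I b -> a <= b -> (forall t, I t -> w t <> 0) -> smooth1 I w ->
  smooth_family3 (band delta I) X ->
  (forall eta t, Rabs eta < delta -> I t -> ~ (a <= t <= b) -> X eta t = x0 t) ->
  family3 w (variation3 X) n 0 a = zero /\ family3 w (variation3 X) n 0 b = zero.
Proof.
  intros HI Hd Ia Ib Hab Hw Hws (S1 & S2 & S3) Hz.
  destruct (dtower_D1_support I delta w _ (fun t => fst (fst (x0 t))) n a b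
    HI Hd Ia Ib Hab Hw Hws S1) as [A1 B1]. { intros. now rewrite Hz. }
  destruct (dtower_D1_support I delta w _ (fun t => snd (fst (x0 t))) n a b
    HI Hd Ia Ib Hab Hw Hws S2) as [A2 B2]. { intros. now rewrite Hz. }
  destruct (dtower_D1_support I delta w _ (fun t => snd (x0 t)) n a b
    HI Hd Ia Ib Hab Hw Hws S3) as [A3 B3]. { intros. now rewrite Hz. }
  split; (apply injective_projections; [apply injective_projections|]); assumption.
Qed.

Lemma smooth_family2_coords I delta X : smooth_family coords2 I delta X ->
  smooth_family2 (band delta I) X.
Proof.
  intros H. split; intros n x t [Hx Ht];
    [apply (H fst)|apply (H snd)]; simpl; auto.
Qed.

Lemma smooth_family3_coords I delta X : smooth_family coords3 I delta X ->
  smooth_family3 (band delta I) X.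
Proof.
  intros H. split; [|split]; intros n x t [Hx Ht];
    [apply (H (fun p => fst (fst p)))|apply (H (fun p => snd (fst p)))|apply (H snd)];
    simpl; auto.
Qed.

(** [h] is [|l|^(-1/2)], the factor that turns affine length into general-affine length,
    with its successive derivatives along [w dt]. *)
Definition weight_tower (I : R -> Prop) (w l : R -> R) (eps : R) (h : nat -> R -> R) : Prop :=
  (forall t, I t -> h 0%nat t = / sqrt (eps * l t)) /\
  (forall n t, I t -> is_derive (h n) t (w t * h (S n) t)).

Lemma weight_square (eps l : R) : (eps = 1 \/ eps = -1) -> 0 < eps * l ->
  l * (/ sqrt (eps * l) * / sqrt (eps * l)) = eps.
Proof.
  intros He Hp. assert (0 < sqrt (eps * l)) by now apply sqrt_lt_R0.
  rewrite <- Rinv_mult, sqrt_sqrt by lra.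
  destruct He as [-> | ->]; field; lra.
Qed.

(** Differentiating [l h^2 = eps]. *)
Lemma weight_relation I w l L1 eps h t : open I -> (eps = 1 \/ eps = -1) ->
  (forall t, I t -> 0 < eps * l t) -> (forall t, I t -> w t <> 0) ->
  weight_tower I w l eps h -> (forall t, I t -> is_derive l t (w t * L1 t)) -> I t ->
  h 0%nat t <> 0 /\ L1 t * h 0%nat t + 2 * (l t * h 1%nat t) = 0.
Proof.
  intros HI He Hp Hw [H0 HS] Hl It.
  assert (Hn : h 0%nat t <> 0).
  { rewrite H0 by auto. apply Rinv_neq_0_compat, Rgt_not_eq, sqrt_lt_R0, Hp, It. }
  split; auto.
  assert (E : forall z, I z -> eps = l z * (h 0%nat z * h 0%nat z)).
  { intros z Iz. rewrite H0 by auto. symmetry. apply weight_square; auto. }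
  assert (H := deriv_eq_on I _ _ t _ _ HI It E (deriv_const eps t)
     (deriv_mult _ _ t _ _ (Hl t It) (deriv_mult _ _ t _ _ (HS 0%nat t It) (HS 0%nat t It)))).
  assert (G : (w t * h 0%nat t) * (L1 t * h 0%nat t + 2 * (l t * h 1%nat t)) = 0)
    by (etransitivity; [|symmetry; exact H]; cbv beta; ring).
  apply Rmult_integral in G. destruct G as [G|G]; auto.
  apply Rmult_integral in G. destruct G as [G|G]; [now apply Hw in G|contradiction].
Qed.

Ltac rewrite_all_zero :=
  repeat match goal with H : _ = 0 |- _ => rewrite H; clear H end.

(** If [m] is the derivative of [l] and [h] solves [h'''' + l h'' = 0], the variation of the
    length density of any deformation is the exact derivative found above, whose primitive
    vanishes at the ends of the support. *)
Theorem space_extremal (I : R -> Prop) (y e1 e2 e3 : R -> A3) (w l m M1 : R -> R) (eps : R)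
    (h : nat -> R -> R) :
  is_open_interval I -> frame3 I y e1 e2 e3 w l m -> smooth1 I w ->
  (eps = 1 \/ eps = -1) -> (forall t, I t -> 0 < eps * l t) ->
  (forall t, I t -> is_derive l t (w t * m t)) ->
  (forall t, I t -> is_derive m t (w t * M1 t)) ->
  weight_tower I w l eps h ->
  (forall t, I t -> h 4%nat t + l t * h 2%nat t = 0) ->
  ga_extremal3 I y.
Proof.
  intros HII HF Hws He Hp Hl Hm Hh Hel X delta a b (Hd & Hab & Ia & Ib & Hsm & HX0 & Hsupp & Hno)
    wf lf Hwl.
  destruct (HII) as (HI & [i0 Hi0] & Hcon).
  assert (HU := open2_band delta I HI). set (U := band delta I) in *.
  assert (HS := smooth_family3_coords I delta X Hsm). fold U in HS.
  assert (Hw : forall t, I t -> 0 < w t) by (intros t It; apply (HF t It)).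
  assert (Hw0 : forall t, I t -> w t <> 0) by (intros t It; apply Rgt_not_eq, Hw, It).
  assert (HUw : forall x t, U x t -> w t <> 0) by (intros x t [_ It]; auto).
  assert (HUI : forall x t, U x t -> I t) by (intros x t [_ It]; auto).
  assert (HUws : smooth2 U (fun _ t => w t))
    by (apply smooth1_smooth2 with I; auto using open2_strip).
  assert (B0 : forall t, I t -> U 0 t) by (intros; split; auto; now rewrite Rabs_R0).
  assert (HT := fun N eta Heta => family3_tower U I w X N eta HU HUw HUws HS
                  (fun t It => conj Heta It)).
  assert (HQ : forall eta t, Rabs eta < delta -> I t ->
    det3 (family3 w X 1 eta t) (family3 w X 2 eta t) (family3 w X 3 eta t) <> 0 /\
    spaceQ (family3 w X 1 eta t) (family3 w X 2 eta t) (family3 w X 3 eta t)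
       (family3 w X 4 eta t) (family3 w X 5 eta t) = lf eta t * (wf eta t / w t) ^ 2 /\
    0 < wf eta t).
  { intros eta t Heta It. destruct (Hwl eta Heta) as (mf & f1 & f2 & f3 & HFe).
    destruct (HFe t It) as (Hind & Hwe & _).
    assert (HFe' : frame3 I (fun t => family3 w X 0 eta t) f1 f2 f3 (wf eta) (lf eta) mf).
    { apply (frame3_ext I (X eta)); auto. intros z _. unfold family3; simpl.
      now destruct (X eta z) as [[? ?] ?]. }
    destruct (spaceQ_frame I w _ f1 f2 f3 _ _ mf HI Hw (HT 5%nat eta Heta) HFe' t It) as [E1 E2].
    split; [|split]; auto. rewrite E1. apply Rmult_integral_contrapositive_currified.
    - apply pow_nonzero, Rgt_not_eq, Rdiv_lt_0_compat; auto.
    - now apply lin_indep3_det. }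
  set (Q := fun eta t => spaceQ (family3 w X 1 eta t) (family3 w X 2 eta t) (family3 w X 3 eta t)
       (family3 w X 4 eta t) (family3 w X 5 eta t)) in *.
  assert (HF0 : forall t, I t -> family3 w X 0 0 t = y t).
  { intros t It. unfold family3; simpl. rewrite HX0 by auto. now destruct (y t) as [[? ?] ?]. }
  assert (Z0 : Rabs 0 < delta) by now rewrite Rabs_R0.
  assert (HB := frame3_tower I y e1 e2 e3 w l m m M1 (fun n t => family3 w X n 0 t) HI HF Hl Hm
                 (HT 5%nat 0 Z0) HF0).
  assert (HQ0 : forall t, I t -> Q 0 t = l t).
  { intros t It.
    assert (HF' : frame3 I (fun t => family3 w X 0 0 t) e1 e2 e3 w l m)
      by (apply (frame3_ext I y); auto; intros; symmetry; auto).
    destruct (spaceQ_frame I w _ e1 e2 e3 _ _ m HI Hw (HT 5%nat 0 Z0) HF' t It) as [_ E2].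
    unfold Q. rewrite E2. field. auto. }
  destruct (length_variation I delta eps a b Q (fun eta => ga_length (wf eta) (lf eta)) w)
    as (g & Hg1 & Hg2 & Hg3); auto.
  { apply smooth2_spaceQ; auto. intros x t [Hx It]. now apply HQ. }
  { intros eta t Heta It. destruct (HQ eta t Heta It) as (_ & E & Hwe). unfold Q. rewrite E.
    apply Rmult_integral_contrapositive_currified.
    - apply (Hno eta Heta) with (w := wf eta); auto.
    - apply pow_nonzero, Rgt_not_eq, Rdiv_lt_0_compat; auto. }
  { intros t It. rewrite HQ0; auto. }
  { intros eta t Heta It. destruct (HQ eta t Heta It) as (_ & E & Hwe).
    exact (ga_length_Q w (wf eta) (lf eta) _ t (Hw t It) Hwe E). }
  replace 0 with (RInt g a b) at 2; auto.
  set (V := fun n t => family3 w (variation3 X) n 0 t).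
  assert (HV : tower_on I w 5 V).
  { apply (family3_tower U); auto. now apply smooth_family3_variation. }
  set (d := det3 (e1 i0) (e2 i0) (e3 i0)).
  assert (Hdc : forall t, I t -> det3 (e1 t) (e2 t) (e3 t) = d).
  { intros t It. apply (interval_constant I (fun z => det3 (e1 z) (e2 z) (e3 z))); auto.
    intros z Iz. now apply (frame3_det_const I y e1 e2 e3 w l m). }
  assert (Hd0 : d <> 0) by (apply lin_indep3_det, (HF i0 Hi0)).
  set (A := fun n t => det3 (e1 t) (e2 t) (V n t)).
  set (B := fun n t => det3 (e1 t) (e3 t) (V n t)).
  set (C := fun n t => det3 (e2 t) (e3 t) (V n t)).
  assert (HA : forall n t, (n < 5)%nat -> I t ->
    is_derive (A n) t (w t * (B n t + A (S n) t))).
  { intros n t Hn It. destruct (HF t It) as (_ & _ & _ & H1 & H2 & H3).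
    eapply deriv_val; [apply deriv_det3; [exact H1|exact H2|now apply HV]|].
    unfold A, B, C. destruct (V n t) as [[? ?] ?], (V (S n) t) as [[? ?] ?], (e1 t) as [[? ?] ?],
      (e2 t) as [[? ?] ?], (e3 t) as [[? ?] ?]. vec_unfold. ring. }
  assert (HBd : forall n t, (n < 5)%nat -> I t ->
    is_derive (B n) t (w t * (C n t - l t * A n t + B (S n) t))).
  { intros n t Hn It. destruct (HF t It) as (_ & _ & _ & H1 & H2 & H3).
    eapply deriv_val; [apply deriv_det3; [exact H1|exact H3|now apply HV]|].
    unfold A, B, C. destruct (V n t) as [[? ?] ?], (V (S n) t) as [[? ?] ?], (e1 t) as [[? ?] ?],
      (e2 t) as [[? ?] ?], (e3 t) as [[? ?] ?]. vec_unfold. ring. }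
  assert (HC : forall n t, (n < 5)%nat -> I t ->
    is_derive (C n) t (w t * (m t * A n t + C (S n) t))).
  { intros n t Hn It. destruct (HF t It) as (_ & _ & _ & H1 & H2 & H3).
    eapply deriv_val; [apply deriv_det3; [exact H2|exact H3|now apply HV]|].
    unfold A, B, C. destruct (V n t) as [[? ?] ?], (V (S n) t) as [[? ?] ?], (e1 t) as [[? ?] ?],
      (e2 t) as [[? ?] ?], (e3 t) as [[? ?] ?]. vec_unfold. ring. }
  assert (HE : forall n, (A n a = 0 /\ B n a = 0 /\ C n a = 0) /\
                         (A n b = 0 /\ B n b = 0 /\ C n b = 0)).
  { intros n. destruct (family3_support I delta w X y n a b) as [Va Vb]; auto.
    fold (V n a) in Va. fold (V n b) in Vb. unfold A, B, C. rewrite Va, Vb.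
    vec_unfold. repeat split; ring. }
  (* The primitive of [space_concomitant]. *)
  set (Phi := fun z => 2 / 3 * (h 0%nat z * (A 4%nat z + l z * A 2%nat z + m z * A 1%nat z))
      + (h 0%nat z * B 3%nat z - 2 / 3 * (h 1%nat z * A 3%nat z))
      - (h 0%nat z * (C 2%nat z - l z * A 2%nat z) + / 3 * (h 1%nat z * B 2%nat z)
         - 2 / 3 * (h 2%nat z * A 2%nat z))
      + (4 / 3 * (h 1%nat z * (C 1%nat z - l z * A 1%nat z)) - / 3 * (h 2%nat z * B 1%nat z)
         - 2 / 3 * (h 3%nat z * A 1%nat z) - 2 / 3 * (l z * h 1%nat z * A 1%nat z))
      - (h 2%nat z * (C 0%nat z - l z * A 0%nat z) - h 3%nat z * B 0%nat z)).
  (* [1/2] comes from the derivative of the square root, [1/d] from pairing with the frame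
     by determinants instead of the dual frame. *)
  apply (RInt_exact I (fun z => eps / (2 * d) * Phi z)); auto.
  2:{ destruct (HE 0%nat) as [(? & ? & ?) _], (HE 1%nat) as [(? & ? & ?) _],
        (HE 2%nat) as [(? & ? & ?) _], (HE 3%nat) as [(? & ? & ?) _], (HE 4%nat) as [(? & ? & ?) _].
      unfold Phi. rewrite_all_zero. ring. }
  2:{ destruct (HE 0%nat) as [_ (? & ? & ?)], (HE 1%nat) as [_ (? & ? & ?)],
        (HE 2%nat) as [_ (? & ? & ?)], (HE 3%nat) as [_ (? & ? & ?)], (HE 4%nat) as [_ (? & ? & ?)].
      unfold Phi. rewrite_all_zero. ring. }
  intros t It.
  destruct (HB t It) as (E1 & E2 & E3 & E4 & E5).
  assert (Hdt : det3 (e1 t) (e2 t) (e3 t) <> 0) by now rewrite Hdc.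
  assert (Hvar := fun n => family3_variation U w X n 0 t HU HUw HUws HS (B0 t It)).
  assert (Hq := spaceQ_variation _ _ _ _ _ _ _ _ _ _ _ _ _ (l t) (m t) (m t) (M1 t) 0
     (Hvar 1%nat) (Hvar 2%nat) (Hvar 3%nat) (Hvar 4%nat) (Hvar 5%nat) E1 E2 E3 E4 E5 Hdt).
  rewrite (Hg3 t _ It Hq), HQ0, Hdc by auto.
  destruct (weight_relation I w l m eps h t) as [Hh0 Hhr]; auto.
  destruct Hh as [Hh0' HhS].
  assert (Hh3 : is_derive (h 3%nat) t (w t * (- l t * h 2%nat t))).
  { eapply deriv_val; [now apply HhS|]. assert (H := Hel t It). f_equal. lra. }
  assert (HP := space_concomitant w l m m (h 0%nat) (h 1%nat) (h 2%nat) (h 3%nat)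
     (A 0%nat) (A 1%nat) (A 2%nat) (A 3%nat) (A 4%nat) (B 0%nat) (B 1%nat) (B 2%nat) (B 3%nat)
     (C 0%nat) (C 1%nat) (C 2%nat) (M1 t) (A 5%nat t) (B 4%nat t) (C 3%nat t) t
     (HhS 0%nat t It) (HhS 1%nat t It) (HhS 2%nat t It) Hh3 (Hl t It) (Hm t It)
     (HA 0%nat t ltac:(lia) It) (HA 1%nat t ltac:(lia) It) (HA 2%nat t ltac:(lia) It)
     (HA 3%nat t ltac:(lia) It) (HA 4%nat t ltac:(lia) It)
     (HBd 0%nat t ltac:(lia) It) (HBd 1%nat t ltac:(lia) It) (HBd 2%nat t ltac:(lia) It)
     (HBd 3%nat t ltac:(lia) It)
     (HC 0%nat t ltac:(lia) It) (HC 1%nat t ltac:(lia) It) (HC 2%nat t ltac:(lia) It)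
     Hh0 Hhr eq_refl).
  eapply deriv_val; [apply deriv_scal; exact HP|].
  rewrite Hh0' by auto. unfold A, B, C, V. field. split; auto.
  apply Rgt_not_eq, sqrt_lt_R0, Hp, It.
Qed.

(** * Smoothness and existence of plane frames *)

Lemma dtower_local (K : R -> Prop) w f g n x x' t : open K -> K t ->
  (forall u, K u -> f x u = g x' u) -> dtower w f n x t = dtower w g n x' t.
Proof.
  intros HK Kt H. revert t Kt. induction n; intros t Kt; auto. simpl. f_equal.
  apply Derive_ext_loc. apply filter_imp with (2 := HK t Kt). exact IHn.
Qed.

Lemma smooth_curve_family2 I x : open I -> smooth_curve coords2 I x ->
  smooth_family2 (strip I) (fun _ t => x t).
Proof.
  intros HI Hx. split; apply (smooth1_iff I); auto; intros n t It;
    [apply (Hx fst)|apply (Hx snd)]; simpl; auto.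
Qed.

(** The weight [w] is the cube root of [det (x', x'')] up to a constant, and [l] is then a
    rational expression in derivatives of the curve; smoothness of the curve passes to both. *)
Lemma frame2_smooth I x e1 e2 w l : is_open_interval I -> smooth_curve coords2 I x ->
  frame2 I x e1 e2 w l -> smooth1 I w /\ smooth1 I l.
Proof.
  intros HII Hx HF. destruct (HII) as (HI & [i0 Hi0] & Hcon).
  assert (HU := open2_strip I HI).
  assert (HS := smooth_curve_family2 I x HI Hx).
  set (X := fun _ t : R => x t) in *.
  assert (Hw : forall t, I t -> 0 < w t) by (intros t It; apply (HF t It)).
  assert (Hw0 : forall t, I t -> w t <> 0) by (intros t It; apply Rgt_not_eq, Hw, It).
  set (c := det2 (e1 i0) (e2 i0)).
  assert (Hc : forall t, I t -> det2 (e1 t) (e2 t) = c).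
  { intros t It. apply (interval_constant I (fun z => det2 (e1 z) (e2 z))); auto.
    intros z Iz. now apply (frame2_det_const I x e1 e2 w l). }
  assert (Hc0 : c <> 0) by (apply lin_indep2_det, (HF i0 Hi0)).
  assert (HF' : forall w0, frame2 I (fun t => family2 w0 X 0 0 t) e1 e2 w l).
  { intros w0. apply (frame2_ext I x); auto. intros z _. unfold family2, X; simpl.
    now destruct (x z). }
  assert (H1s : smooth2 (strip I) (fun _ _ => 1)) by now apply smooth2_const.
  assert (H1 : forall t, I t ->
    det2 (family2 (fun _ => 1) X 1 0 t) (family2 (fun _ => 1) X 2 0 t) / c = w t ^ 3).
  { intros t It.
    destruct (planeQ_frame I (fun _ => 1) (fun n t => family2 (fun _ => 1) X n 0 t) e1 e2 w l)
      with (t := t) as [E _]; auto.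
    - intros; lra.
    - now apply (family2_tower (strip I)).
    - rewrite E, Hc by auto. field. auto. }
  assert (Sw : smooth1 I w).
  { destruct HS as (S1 & S2).
    assert (T1 := fun n => smooth2_dtower (strip I) (fun _ => 1) _ n HU
                     (fun _ _ _ => R1_neq_R0) H1s S1).
    assert (T2 := fun n => smooth2_dtower (strip I) (fun _ => 1) _ n HU
                     (fun _ _ _ => R1_neq_R0) H1s S2).
    set (D := fun _ t : R => det2 (family2 (fun _ => 1) X 1 0 t) (family2 (fun _ => 1) X 2 0 t) / c).
    assert (HD : smooth2 (strip I) D).
    { unfold D, Rdiv, det2, family2. cbn [fst snd].
      apply smooth2_ext with (fun x t =>
        (dtower (fun _ => 1) (fun h u => fst (X h u)) 1 x t *
         dtower (fun _ => 1) (fun h u => snd (X h u)) 2 x t -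
         dtower (fun _ => 1) (fun h u => snd (X h u)) 1 x t *
         dtower (fun _ => 1) (fun h u => fst (X h u)) 2 x t) * / c); auto.
      smooth_rules; auto. }
    apply smooth2_ext with (fun x t => Rpower (D x t) (/ 3)); auto.
    - intros z t It. unfold D. rewrite H1 by auto.
      rewrite <- Rpower_pow by auto. rewrite Rpower_mult.
      replace (INR 3 * / 3) with 1 by (simpl; field). now apply Rpower_1, Hw.
    - apply (smooth2_comp (strip I) (fun z => 0 < z) D (fun z => Rpower z (/ 3))); auto.
      + apply open2_strip, open_gt.
      + intros z t It. unfold D. rewrite H1 by auto. now apply pow_lt, Hw.
      + apply smooth1_Rpower. }
  split; auto.
  assert (HQ : forall t, I t ->
    det2 (family2 w X 1 0 t) (family2 w X 2 0 t) = c /\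
    planeQ (family2 w X 1 0 t) (family2 w X 2 0 t) (family2 w X 3 0 t) (family2 w X 4 0 t) = l t).
  { intros t It.
    destruct (planeQ_frame I w (fun n t => family2 w X n 0 t) e1 e2 w l)
      with (t := t) as [E1 E2]; auto.
    - apply (family2_tower (strip I)); auto.
    - rewrite E1, E2, Hc by auto. split; field; auto. }
  assert (Hcst : forall n z t, family2 w X n z t = family2 w X n 0 t).
  { intros n z t. unfold family2.
    f_equal; apply (dtower_local (fun _ => True)); auto using open_true. }
  apply smooth2_ext with (fun x t => planeQ (family2 w X 1 x t) (family2 w X 2 x t)
                          (family2 w X 3 x t) (family2 w X 4 x t)); auto.
  - intros z t It. rewrite !(Hcst _ z). now apply HQ.
  - apply smooth2_planeQ; auto. intros z t It. rewrite !(Hcst _ z).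
    destruct (HQ t It) as [-> _]. auto.
Qed.

Lemma weight_tower_exists I w l eps : open I -> (forall t, I t -> w t <> 0) ->
  smooth1 I w -> smooth1 I l -> (forall t, I t -> 0 < eps * l t) ->
  exists h, weight_tower I w l eps h /\ forall n, smooth1 I (h n).
Proof.
  intros HI Hw Hws Hls Hp.
  assert (HU := open2_strip I HI).
  assert (S0 : smooth2 (strip I) (fun _ t => / sqrt (eps * l t))).
  { apply (smooth2_inv (strip I) (fun _ t => sqrt (eps * l t))); auto.
    - intros z t It. apply Rgt_not_eq, sqrt_lt_R0, Hp, It.
    - apply (smooth2_comp (strip I) (fun z => 0 < z) (fun _ t => eps * l t) sqrt);
        auto using smooth1_sqrt.
      + apply open2_strip, open_gt.
      + apply (smooth2_mult (strip I) (fun _ _ => eps) (fun _ t => l t)); auto.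
        now apply smooth2_const. }
  set (f := fun _ t : R => / sqrt (eps * l t)) in *.
  exists (fun n t => dtower w f n 0 t). split; [split|].
  - intros t It. reflexivity.
  - intros n t It. apply (dtower_derive2 (strip I)); auto.
  - intros n. apply smooth2_ext with (dtower w f n); auto.
    + intros z t It. apply (dtower_local (fun _ => True)); auto using open_true.
    + apply smooth2_dtower; auto.
Qed.

(** With [w] the cube root of [det (x', x'') / c], the vectors [e1 = x'/w] and [e2 = e1'/w]
    have constant determinant [c]; differentiating it shows that [e2'] is parallel to [e1]. *)
Lemma frame2_exists I (x : R -> A2) c : open I ->
  smooth1 I (fun t => fst (x t)) -> smooth1 I (fun t => snd (x t)) -> c <> 0 ->
  (forall t, I t -> 0 < det2 (deriv2 1 x t) (deriv2 2 x t) / c) ->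
  exists w l, invariants2 I x w l.
Proof.
  intros HI S1 S2 Hc Hp.
  assert (HU := open2_strip I HI).
  set (x1 := fun t => fst (x t)) in *. set (x2 := fun t => snd (x t)) in *.
  set (D := fun t => (Derive x1 t * Derive (Derive x2) t
                      - Derive x2 t * Derive (Derive x1) t) * / c).
  assert (HD : forall t, I t -> 0 < D t) by exact Hp.
  assert (S1' := smooth1_Derive I x1 S1). assert (S2' := smooth1_Derive I x2 S2).
  assert (S1'' := smooth1_Derive I _ S1'). assert (S2'' := smooth1_Derive I _ S2').
  assert (SD : smooth1 I D).
  { unfold smooth1, D. smooth_rules; auto. }
  set (w := fun t => Rpower (D t) (/ 3)).
  assert (Hw : forall t, 0 < w t) by (intros; apply exp_pos).
  assert (Hw0 : forall t, w t <> 0) by (intros t; apply Rgt_not_eq, Hw).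
  assert (Hw3 : forall t, I t -> w t ^ 3 = D t).
  { intros t It. unfold w. rewrite <- Rpower_pow by apply exp_pos. rewrite Rpower_mult.
    replace (/ 3 * INR 3) with 1 by (simpl; field). now apply Rpower_1, HD. }
  assert (Sw : smooth1 I w).
  { apply (smooth2_comp (strip I) (fun z => 0 < z) (fun _ t => D t) (fun z => Rpower z (/ 3)));
      auto using smooth1_Rpower. apply open2_strip, open_gt. }
  set (p1 := fun t => Derive x1 t / w t). set (p2 := fun t => Derive x2 t / w t).
  assert (Sp1 : smooth1 I p1) by (unfold smooth1, p1; smooth_rules; auto).
  assert (Sp2 : smooth1 I p2) by (unfold smooth1, p2; smooth_rules; auto).
  assert (Sp1' := smooth1_Derive I p1 Sp1). assert (Sp2' := smooth1_Derive I p2 Sp2).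
  set (q1 := fun t => Derive p1 t / w t). set (q2 := fun t => Derive p2 t / w t).
  assert (Sq1 : smooth1 I q1) by (unfold smooth1, q1; smooth_rules; auto).
  assert (Sq2 : smooth1 I q2) by (unfold smooth1, q2; smooth_rules; auto).
  set (e1 := fun t => (p1 t, p2 t) : A2). set (e2 := fun t => (q1 t, q2 t) : A2).
  assert (Hp1 : forall t, I t -> is_derive p1 t (w t * q1 t)).
  { intros t It. eapply deriv_val; [now apply (smooth1_derive I)|]. unfold q1. field. auto. }
  assert (Hp2 : forall t, I t -> is_derive p2 t (w t * q2 t)).
  { intros t It. eapply deriv_val; [now apply (smooth1_derive I)|]. unfold q2. field. auto. }
  assert (Hdet : forall t, I t -> p1 t * q2 t - p2 t * q1 t = c).
  { intros t It.
    assert (W := smooth1_derive I w t Sw It).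
    assert (X1 := smooth1_derive I _ t S1' It). assert (X2 := smooth1_derive I _ t S2' It).
    assert (E1 := deriv_unique _ _ _ _ (smooth1_derive I p1 t Sp1 It)
                   (deriv_div _ w t _ _ (Hw0 t) X1 W)).
    assert (E2 := deriv_unique _ _ _ _ (smooth1_derive I p2 t Sp2 It)
                   (deriv_div _ w t _ _ (Hw0 t) X2 W)).
    unfold q1, q2. rewrite E1, E2. unfold p1, p2.
    transitivity ((D t * c) / w t ^ 3); [unfold D; field; auto|].
    rewrite Hw3 by auto. assert (D t <> 0) by (apply Rgt_not_eq, HD, It). field. auto. }
  exists w, (fun t => - (Derive q1 t * q2 t - Derive q2 t * q1 t) / (c * w t)), e1, e2.
  intros t It. split; [|split; [|split; [|split]]].
  - apply lin_indep2_det. unfold det2, e1, e2; simpl. now rewrite Hdet.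
  - apply Hw.
  - apply is_derive_A2. split; simpl;
      (eapply deriv_val; [now apply (smooth1_derive I)|]);
      unfold p1, p2, scal; simpl; unfold mult; simpl; fold x1 x2; field; auto.
  - apply is_derive_A2. split; [now apply Hp1|now apply Hp2].
  - assert (Q1 := smooth1_derive I q1 t Sq1 It). assert (Q2 := smooth1_derive I q2 t Sq2 It).
    assert (E : p1 t * Derive q2 t - p2 t * Derive q1 t = 0).
    { assert (H := deriv_eq_on I _ _ t _ _ HI It Hdet
        (deriv_minus _ _ t _ _ (deriv_mult _ _ t _ _ (Hp1 t It) Q2)
           (deriv_mult _ _ t _ _ (Hp2 t It) Q1)) (deriv_const c t)).
      cbv beta in H. lra. }
    assert (Hd := Hdet t It).
    assert (F1 : Derive q1 t * c = (Derive q1 t * q2 t - Derive q2 t * q1 t) * p1 t).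
    { rewrite <- Hd. transitivity ((Derive q1 t * q2 t - Derive q2 t * q1 t) * p1 t
        + q1 t * (p1 t * Derive q2 t - p2 t * Derive q1 t)); [ring|]. rewrite E. ring. }
    assert (F2 : Derive q2 t * c = (Derive q1 t * q2 t - Derive q2 t * q1 t) * p2 t).
    { rewrite <- Hd. transitivity ((Derive q1 t * q2 t - Derive q2 t * q1 t) * p2 t
        + q2 t * (p1 t * Derive q2 t - p2 t * Derive q1 t)); [ring|]. rewrite E. ring. }
    apply is_derive_A2. split; simpl.
    + eapply deriv_val; [exact Q1|]. unfold scal; simpl; unfold mult; simpl.
      apply Rmult_eq_reg_r with c; auto. rewrite F1. field. auto.
    + eapply deriv_val; [exact Q2|]. unfold scal; simpl; unfold mult; simpl.
      apply Rmult_eq_reg_r with c; auto. rewrite F2. field. auto.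
Qed.

(** * The Euler-Lagrange equation of the plane curve *)

Lemma bump_test (I : R -> Prop) (F : R -> R) : is_open_interval I ->
  (forall t, I t -> continuous F t) ->
  (forall a b, I a -> I b -> a < b -> RInt (fun t => bump a b t * F t) a b = 0) ->
  forall t, I t -> F t = 0.
Proof.
  intros (HI & _ & Hcon) HF H0 t0 It0.
  assert (W : forall s, s * F t0 <= 0).
  { intros s. destruct (Rle_dec (s * F t0) 0) as [H|H]; auto. exfalso.
    assert (HsF : forall t, I t -> continuous (fun z => s * F z) t).
    { intros t It. apply (continuous_scal_r s F). now apply HF. }
    assert (Hpos : locally t0 (fun t => 0 < s * F t)).
    { apply (HsF t0 It0). apply (open_gt 0). lra. }
    destruct (filter_and _ _ Hpos (HI t0 It0)) as [d Hd].
    assert (Hd0 := cond_pos d).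
    assert (HdI : forall t, t0 - d / 2 <= t <= t0 + d / 2 -> 0 < s * F t /\ I t).
    { intros t Ht. apply Hd. change (Rabs (t - t0) < d). apply Rabs_lt_between. lra. }
    assert (Ia : I (t0 - d / 2)) by (apply HdI; lra).
    assert (Ib : I (t0 + d / 2)) by (apply HdI; lra).
    set (a := t0 - d / 2) in *. set (b := t0 + d / 2) in *.
    assert (Hab : a < b) by (unfold a, b; lra).
    assert (Hbc : forall t, continuous (bump a b) t).
    { intros t. apply (smooth1_continuous (fun _ => True)); auto using smooth1_bump. }
    assert (C : forall t, I t -> continuous (fun t => bump a b t * F t) t).
    { intros t It. apply (continuous_mult (bump a b) F); auto. }
    assert (P : 0 < RInt (fun t => s * (bump a b t * F t)) a b).
    { apply RInt_gt_0; auto.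
      - intros t Ht. assert (B := bump_pos a b t Ht).
        replace (s * (bump a b t * F t)) with (bump a b t * (s * F t)) by ring.
        apply Rmult_lt_0_compat; auto. apply HdI; lra.
      - intros t Ht. apply (continuous_scal_r s (fun t => bump a b t * F t)), C, HdI; lra. }
    assert (E : RInt (fun t => s * (bump a b t * F t)) a b
                = s * RInt (fun t => bump a b t * F t) a b).
    { apply (RInt_scal (V := R_CompleteNormedModule) (fun t => bump a b t * F t) a b s).
      apply (ex_RInt_continuous (V := R_CompleteNormedModule)). intros t Ht.
      rewrite Rmin_left, Rmax_right in Ht by lra. apply C, HdI; lra. }
    rewrite E, H0 in P by auto. lra. }
  assert (W1 := W 1). assert (W2 := W (-1)). lra.
Qed.

(** The numerator of [planeQ] over [det2 X1 X2 ^ 2]: being polynomial, it is smooth before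
    the family is known to be nondegenerate. *)
Definition planeN (X1 X2 X3 X4 : A2) : R :=
  (4 * det2 X2 X3 + det2 X1 X4) * det2 X1 X2 * / 3 - 5 / 9 * det2 X1 X3 ^ 2.

Lemma planeQ_N X1 X2 X3 X4 : det2 X1 X2 <> 0 ->
  planeQ X1 X2 X3 X4 = planeN X1 X2 X3 X4 / det2 X1 X2 ^ 2.
Proof. intros H. unfold planeQ, planeN. field. auto. Qed.

Lemma smooth2_det2_family U w X i j : open2 U -> (forall x t, U x t -> w t <> 0) ->
  smooth2 U (fun _ t => w t) -> smooth_family2 U X ->
  smooth2 U (fun x t => det2 (family2 w X i x t) (family2 w X j x t)).
Proof.
  intros HU Hw Hws (S1 & S2).
  assert (T1 := fun n => smooth2_dtower U w _ n HU Hw Hws S1).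
  assert (T2 := fun n => smooth2_dtower U w _ n HU Hw Hws S2).
  unfold family2, det2. cbn [fst snd]. smooth_rules; (apply T1 || apply T2).
Qed.

Lemma family2_deriv2_det U I w X eta t : open I -> open2 U -> (forall x t, U x t -> w t <> 0) ->
  smooth2 U (fun _ t => w t) -> smooth1 I w -> smooth_family2 U X ->
  (forall t, I t -> U eta t) -> I t ->
  det2 (deriv2 1 (X eta) t) (deriv2 2 (X eta) t)
  = w t ^ 3 * det2 (family2 w X 1 eta t) (family2 w X 2 eta t).
Proof.
  intros HI HU Hw Hws Hw1 HS HUI It.
  assert (HT := family2_tower U I w X 2 eta HU Hw Hws HS HUI).
  assert (E : forall z, I z ->
     Derive (fun u => fst (X eta u)) z = w z * fst (family2 w X 1 eta z) /\
     Derive (fun u => snd (X eta u)) z = w z * snd (family2 w X 1 eta z)).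
  { intros z Iz. assert (H := HT 0%nat z ltac:(lia) Iz). apply is_derive_A2 in H.
    destruct H as [H1 H2]. split; now apply is_derive_unique. }
  assert (H := HT 1%nat t ltac:(lia) It). apply is_derive_A2 in H. destruct H as [H1 H2].
  assert (W := smooth1_derive I w t Hw1 It).
  assert (E2 : Derive (Derive (fun u => fst (X eta u))) t
    = Derive w t * fst (family2 w X 1 eta t) + w t * (w t * fst (family2 w X 2 eta t)) /\
     Derive (Derive (fun u => snd (X eta u))) t
    = Derive w t * snd (family2 w X 1 eta t) + w t * (w t * snd (family2 w X 2 eta t))).
  { split; apply is_derive_unique.
    - apply (deriv_ext_on I (fun z => w z * fst (family2 w X 1 eta z))); auto.
      + intros z Iz. symmetry. now apply E.
      + apply (deriv_mult w (fun z => fst (family2 w X 1 eta z))); auto.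
    - apply (deriv_ext_on I (fun z => w z * snd (family2 w X 1 eta z))); auto.
      + intros z Iz. symmetry. now apply E.
      + apply (deriv_mult w (fun z => snd (family2 w X 1 eta z))); auto. }
  destruct (E t It) as [Ea Eb], E2 as [Ec Ed].
  unfold deriv2, det2, Derive_n. cbn [fst snd].
  change (fun x : R => Derive (fun u => fst (X eta u)) x) with (Derive (fun u => fst (X eta u))).
  change (fun x : R => Derive (fun u => snd (X eta u)) x) with (Derive (fun u => snd (X eta u))).
  rewrite Ea, Eb, Ec, Ed. ring.
Qed.

Definition push (x : R -> A2) (phi : R -> R) (v : A2) (eta t : R) : A2 :=
  (fst (x t) + eta * (phi t * fst v), snd (x t) + eta * (phi t * snd v)).

Lemma smooth_family2_push I x phi v : open I -> smooth_curve coords2 I x ->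
  smooth1 I phi -> smooth_family2 (strip I) (push x phi v).
Proof.
  intros HI Hx Hphi. destruct (smooth_curve_family2 I x HI Hx) as [S1 S2].
  assert (HU := open2_strip I HI).
  assert (Hid : smooth2 (strip I) (fun eta _ => eta)) by (intros n; now apply Ck_fst).
  split; unfold push; cbn [fst snd]; smooth_rules; auto.
Qed.

Lemma push_zero x phi v t : push x phi v 0 t = x t.
Proof. unfold push. rewrite !Rmult_0_l, !Rplus_0_r. now destruct (x t). Qed.

Lemma variation2_push x phi v eta t :
  variation2 (push x phi v) eta t = scal (phi t) v.
Proof.
  unfold variation2, D1, push. cbn [fst snd].
  assert (E : forall p c, Derive (fun z : R => p + z * c) eta = c).
  { intros p c. apply is_derive_unique. eapply deriv_val.
    - apply deriv_plus; [apply deriv_const|].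
      apply deriv_mult; [apply deriv_id|apply deriv_const].
    - cbv beta. ring. }
  rewrite !E. now destruct v.
Qed.

(** Nondegeneracy and the absence of inflections are the positivity of two continuous
    functions, which persists for small [eta] over the compact support; elsewhere the curve
    does not move. *)
Lemma push_deformation I x e1 e2 w l eps c a b v phi : is_open_interval I ->
  smooth_curve coords2 I x -> frame2 I x e1 e2 w l -> smooth1 I w ->
  (forall t, I t -> det2 (e1 t) (e2 t) = c) -> (eps = 1 \/ eps = -1) ->
  (forall t, I t -> 0 < eps * l t) -> I a -> I b -> a <= b ->
  smooth1 I phi -> (forall t, ~ (a <= t <= b) -> phi t = 0) ->
  exists delta,
    compact_deformation coords2 nondegenerate2 invariants2 I x (push x phi v) delta a b /\
    (forall eta, Rabs eta < delta -> exists w' l', invariants2 I (push x phi v eta) w' l').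
Proof.
  intros HII Hx HF Hws Hc He Hp Ia Ib Hab Hphi Hout.
  destruct (HII) as (HI & _ & Hcon).
  assert (HU := open2_strip I HI).
  set (X := push x phi v).
  assert (HS : smooth_family2 (strip I) X) by now apply smooth_family2_push.
  assert (Hw : forall t, I t -> 0 < w t) by (intros t It; apply (HF t It)).
  assert (Hw0 : forall t, I t -> w t <> 0) by (intros t It; apply Rgt_not_eq, Hw, It).
  assert (HUw : forall x t, strip I x t -> w t <> 0) by (intros z t It; auto).
  assert (HT := fun N eta => family2_tower (strip I) I w X N eta HU HUw Hws HS (fun t It => It)).
  assert (Hc0 : c <> 0).
  { rewrite <- (Hc a Ia). apply lin_indep2_det, (HF a Ia). }
  assert (HF0 : frame2 I (fun t => family2 w X 0 0 t) e1 e2 w l).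
  { apply (frame2_ext I x); auto. intros t It. unfold family2, X; simpl.
    rewrite !Rmult_0_l, !Rplus_0_r. now destruct (x t). }
  set (P := fun eta t => det2 (family2 w X 1 eta t) (family2 w X 2 eta t) / c).
  set (N := fun eta t => eps * planeN (family2 w X 1 eta t) (family2 w X 2 eta t)
                           (family2 w X 3 eta t) (family2 w X 4 eta t)).
  assert (SP : smooth2 (strip I) P).
  { assert (S := fun i j => smooth2_det2_family (strip I) w X i j HU HUw Hws HS).
    unfold P. smooth_rules; auto. }
  assert (SN : smooth2 (strip I) N).
  { assert (S := fun i j => smooth2_det2_family (strip I) w X i j HU HUw Hws HS).
    unfold N, planeN.
    apply (smooth2_mult (strip I) (fun _ _ => eps)); [assumption|now apply smooth2_const|].
    assert (C := fun k => smooth2_const (strip I) k HU).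
    repeat match goal with
    | |- smooth2 _ (fun x y => @?f x y - @?g x y) => apply (smooth2_minus _ f g); auto
    | |- smooth2 _ (fun x y => @?f x y + @?g x y) => apply (smooth2_plus _ f g); auto
    | |- smooth2 _ (fun x y => (@?f x y) ^ 2) => apply (smooth2_pow _ f 2); auto
    | |- smooth2 _ (fun x y => @?f x y * @?g x y) => apply (smooth2_mult _ f g); auto
    end. }
  assert (H0 : forall t, I t -> 0 < P 0 t /\ 0 < N 0 t).
  { intros t It.
    destruct (planeQ_frame I w _ e1 e2 w l HI Hw (HT 4%nat 0) HF0 t It) as [E1 E2].
    assert (E1' : det2 (family2 w X 1 0 t) (family2 w X 2 0 t) = c).
    { rewrite E1, Hc by auto. field. auto. }
    rewrite planeQ_N, E1' in E2 by now rewrite E1'.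
    unfold P, N. rewrite E1'. split.
    - replace (c / c) with 1 by (field; auto). lra.
    - replace (planeN _ _ _ _) with (l t * c ^ 2).
      + replace (eps * (l t * c ^ 2)) with (eps * l t * c ^ 2) by ring.
        apply Rmult_lt_0_compat; auto. apply pow2_gt_0; auto.
      + apply Rmult_eq_reg_r with (/ c ^ 2); [|apply Rinv_neq_0_compat, pow_nonzero; auto].
        etransitivity; [|symmetry; exact E2]. field. auto. }
  destruct (compact_pos P a b Hab) as (dP & HdP & HP).
  { intros t Ht. apply (smooth2_continuity (strip I)); auto. now apply (Hcon a b). }
  { intros t Ht. apply H0. now apply (Hcon a b). }
  destruct (compact_pos N a b Hab) as (dN & HdN & HN).
  { intros t Ht. apply (smooth2_continuity (strip I)); auto. now apply (Hcon a b). }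
  { intros t Ht. apply H0. now apply (Hcon a b). }
  set (delta := Rmin dP dN).
  assert (Hd : 0 < delta) by now apply Rmin_pos.
  assert (Hfix : forall eta t n, I t -> ~ (a <= t <= b) -> family2 w X n eta t = family2 w X n 0 t).
  { intros eta t n It Ht.
    assert (HK := open_outside I a b HI Hab).
    unfold family2. f_equal; apply (dtower_local _ w _ _ n eta 0 t HK (conj It Ht));
      intros u [Iu Hu]; unfold X, push; simpl; rewrite (Hout u Hu); ring. }
  assert (Hpos : forall eta t, Rabs eta < delta -> I t -> 0 < P eta t /\ 0 < N eta t).
  { intros eta t Heta It.
    assert (M1 := Rmin_l dP dN : delta <= _). assert (M2 := Rmin_r dP dN : delta <= _).
    destruct (Rle_dec a t) as [Hat|Hat]; [destruct (Rle_dec t b) as [Htb|Htb]|].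
    - split; [apply HP|apply HN]; lra.
    - unfold P, N. rewrite !(Hfix eta t) by (auto; lra). now apply H0.
    - unfold P, N. rewrite !(Hfix eta t) by (auto; lra). now apply H0. }
  assert (Hdet : forall eta t, Rabs eta < delta -> I t ->
     det2 (family2 w X 1 eta t) (family2 w X 2 eta t) <> 0).
  { intros eta t Heta It E. destruct (Hpos eta t Heta It) as [H _]. unfold P in H.
    rewrite E in H. unfold Rdiv in H. rewrite Rmult_0_l in H. lra. }
  assert (Hdd := fun eta t => family2_deriv2_det (strip I) I w X eta t HI HU HUw Hws Hws HS
                   (fun t It => It)).
  exists delta. split.
  - split; [exact Hd|]. split; [exact Hab|]. split; [exact Ia|]. split; [exact Ib|].
    split; [|split; [|split]].
    + intros p Hpin n eta t _ It. simpl in Hpin.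
      destruct Hpin as [<-|[<-|[]]]; [apply (proj1 HS)|apply (proj2 HS)]; exact It.
    + intros t It. apply push_zero.
    + intros eta t _ It Ht. unfold X, push. rewrite (Hout t Ht), !Rmult_0_l, !Rmult_0_r, !Rplus_0_r.
      now destruct (x t).
    + intros eta Heta. split.
      * intros t It. apply lin_indep2_det. rewrite Hdd by auto.
        apply Rmult_integral_contrapositive_currified; auto. now apply pow_nonzero, Hw0.
      * intros w' l' (f1 & f2 & HF') t It El.
        assert (HF'' : frame2 I (fun t => family2 w X 0 eta t) f1 f2 w' l').
        { apply (frame2_ext I (X eta)); auto. }
        destruct (planeQ_frame I w _ f1 f2 w' l' HI Hw (HT 4%nat eta) HF'' t It) as [_ E2].
        rewrite El, Rmult_0_l, planeQ_N in E2 by auto.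
        destruct (Hpos eta t Heta It) as [_ H]. unfold N in H.
        apply Rmult_integral in E2. destruct E2 as [E2|E2].
        -- rewrite E2 in H. lra.
        -- revert E2. apply Rinv_neq_0_compat, pow_nonzero. auto.
  - intros eta Heta. destruct HS as [S1 S2].
    apply (frame2_exists I (X eta) c); auto.
    + unfold X, push. simpl. destruct (smooth_curve_family2 I x HI Hx) as [S1' _].
      unfold smooth1. assert (H : smooth2 (strip I) (fun _ t => phi t)) by exact Hphi.
      smooth_rules; auto.
    + unfold X, push. simpl. destruct (smooth_curve_family2 I x HI Hx) as [_ S2'].
      unfold smooth1. assert (H : smooth2 (strip I) (fun _ t => phi t)) by exact Hphi.
      smooth_rules; auto.
    + intros t It. rewrite Hdd by auto.
      replace (w t ^ 3 * det2 (family2 w X 1 eta t) (family2 w X 2 eta t) / c)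
        with (w t ^ 3 * P eta t) by (unfold P; field; auto).
      apply Rmult_lt_0_compat; [now apply pow_lt, Hw|]. now apply Hpos.
Qed.

(** Testing extremality on pushes of all small arcs leaves the Euler-Lagrange equation, which
    in affine arclength reads [h'''' + l h'' = 0] with [h = |l|^(-1/2)]. *)
Theorem plane_euler_lagrange (I : R -> Prop) x e1 e2 w l eps (h : nat -> R -> R) :
  is_open_interval I -> smooth_curve coords2 I x -> frame2 I x e1 e2 w l ->
  ga_extremal2 I x -> (eps = 1 \/ eps = -1) -> (forall t, I t -> 0 < eps * l t) ->
  weight_tower I w l eps h -> (forall n, smooth1 I (h n)) ->
  forall t, I t -> h 4%nat t + l t * h 2%nat t = 0.
Proof.
  intros HII Hx HF Hext He Hp Hh Hhs.
  destruct (frame2_smooth I x e1 e2 w l HII Hx HF) as [Hws Hls].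
  destruct (HII) as (HI & [i0 Hi0] & Hcon).
  assert (HUs := open2_strip I HI).
  assert (Hw : forall t, I t -> 0 < w t) by (intros t It; apply (HF t It)).
  assert (Hw0 : forall t, I t -> w t <> 0) by (intros t It; apply Rgt_not_eq, Hw, It).
  set (c := det2 (e1 i0) (e2 i0)).
  assert (Hc : forall t, I t -> det2 (e1 t) (e2 t) = c).
  { intros t It. apply (interval_constant I (fun z => det2 (e1 z) (e2 z))); auto.
    intros z Iz. now apply (frame2_det_const I x e1 e2 w l). }
  assert (Hc0 : c <> 0) by (apply lin_indep2_det, (HF i0 Hi0)).
  set (L1 := fun t => Derive l t / w t).
  assert (Hl : forall t, I t -> is_derive l t (w t * L1 t)).
  { intros t It. eapply deriv_val; [now apply (smooth1_derive I)|]. unfold L1. field. auto. }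
  set (E := fun t => h 4%nat t + l t * h 2%nat t).
  assert (HEc : forall t, I t -> continuous E t).
  { intros t It. apply (smooth1_continuous I); auto.
    assert (H2 : smooth2 (strip I) (fun _ t => h 2%nat t)) by apply Hhs.
    assert (H4 : smooth2 (strip I) (fun _ t => h 4%nat t)) by apply Hhs.
    unfold smooth1, E. smooth_rules; auto. }
  assert (Hweak : forall v t, I t -> w t * det2 (e1 t) v * E t = 0).
  2:{ intros t It. assert (H := Hweak (e2 t) t It). rewrite Hc in H by auto.
      apply Rmult_integral in H. destruct H as [H|H]; auto. exfalso. revert H.
      apply Rmult_integral_contrapositive_currified; auto. }
  intros v.
  assert (HGc : forall t, I t -> continuous (fun t => w t * det2 (e1 t) v * E t) t).
  { intros t It. apply (continuous_mult (fun t => w t * det2 (e1 t) v) E); auto.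
    apply (continuous_mult w (fun t => det2 (e1 t) v)).
    - now apply (smooth1_continuous I).
    - apply (ex_derive_continuous (K := R_AbsRing) (V := R_NormedModule)).
      destruct (HF t It) as (_ & _ & _ & H1 & _). eexists.
      apply (deriv_det2 e1 (fun _ => v)); [exact H1|].
      apply (is_derive_const (K := R_AbsRing) v). }
  apply bump_test; auto.
  intros a b Ia Ib Hab.
  assert (Hbs : smooth1 I (bump a b))
    by (apply (smooth1_restrict I (fun _ => True)); auto using smooth1_bump).
  destruct (push_deformation I x e1 e2 w l eps c a b v (bump a b)) as (delta & Hdef & Hinv); auto.
  { lra. }
  { intros t Ht. apply bump_zero. lra. }
  set (X := push x (bump a b) v) in *.
  (* Extremality is tested against some choice of invariants for each curve. *)
  set (inv := fun eta => epsilon (inhabits (w, l))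
     (fun p => invariants2 I (X eta) (fst p) (snd p))).
  assert (Hwl : forall eta, Rabs eta < delta ->
     invariants2 I (X eta) (fst (inv eta)) (snd (inv eta))).
  { intros eta Heta. apply (epsilon_spec (inhabits (w, l))
      (fun p => invariants2 I (X eta) (fst p) (snd p))).
    destruct (Hinv eta Heta) as (w' & l' & H). now exists (w', l'). }
  assert (HL := Hext X delta a b Hdef (fun eta => fst (inv eta)) (fun eta => snd (inv eta)) Hwl).
  destruct Hdef as (Hd & Hab' & _ & _ & Hsm & HX0 & Hsupp & Hno).
  assert (HU := open2_band delta I HI). set (U := band delta I) in *.
  assert (HS := smooth_family2_coords I delta X Hsm). fold U in HS.
  assert (HUw : forall x t, U x t -> w t <> 0) by (intros z t [_ It]; auto).
  assert (HUI : forall x t, U x t -> I t) by (intros z t [_ It]; auto).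
  assert (HUws : smooth2 U (fun _ t => w t)) by (apply smooth1_smooth2 with I; auto).
  assert (B0 : forall t, I t -> U 0 t) by (intros; split; auto; now rewrite Rabs_R0).
  assert (HT := fun N eta Heta => family2_tower U I w X N eta HU HUw HUws HS
                  (fun t It => conj Heta It)).
  assert (HQ : forall eta t, Rabs eta < delta -> I t ->
    det2 (family2 w X 1 eta t) (family2 w X 2 eta t) <> 0 /\
    planeQ (family2 w X 1 eta t) (family2 w X 2 eta t) (family2 w X 3 eta t)
       (family2 w X 4 eta t) = snd (inv eta) t * (fst (inv eta) t / w t) ^ 2 /\
    0 < fst (inv eta) t).
  { intros eta t Heta It. destruct (Hwl eta Heta) as (f1 & f2 & HFe).
    destruct (HFe t It) as (Hind & Hwe & _).
    assert (HFe' : frame2 I (fun t => family2 w X 0 eta t) f1 f2 (fst (inv eta)) (snd (inv eta)))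
      by (apply (frame2_ext I (X eta)); auto).
    destruct (planeQ_frame I w _ f1 f2 _ _ HI Hw (HT 4%nat eta Heta) HFe' t It) as [E1 E2].
    split; [|split]; auto. rewrite E1. apply Rmult_integral_contrapositive_currified.
    - apply pow_nonzero, Rgt_not_eq, Rdiv_lt_0_compat; auto.
    - now apply lin_indep2_det. }
  set (Q := fun eta t => planeQ (family2 w X 1 eta t) (family2 w X 2 eta t)
       (family2 w X 3 eta t) (family2 w X 4 eta t)) in *.
  assert (HF0 : forall t, I t -> family2 w X 0 0 t = x t).
  { intros t It. transitivity (X 0 t); [reflexivity|auto]. }
  assert (Z0 : Rabs 0 < delta) by now rewrite Rabs_R0.
  assert (HB := frame2_tower I x e1 e2 w l L1 (fun n t => family2 w X n 0 t) HI HF Hl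
                 (HT 4%nat 0 Z0) HF0).
  assert (HQ0 : forall t, I t -> Q 0 t = l t).
  { intros t It.
    assert (HF' : frame2 I (fun t => family2 w X 0 0 t) e1 e2 w l)
      by (apply (frame2_ext I x); auto; intros; symmetry; auto).
    destruct (planeQ_frame I w _ e1 e2 w l HI Hw (HT 4%nat 0 Z0) HF' t It) as [_ E2].
    unfold Q. rewrite E2. field. auto. }
  destruct (length_variation I delta eps a b Q
      (fun eta => ga_length (fst (inv eta)) (snd (inv eta))) w) as (g & Hg1 & Hg2 & Hg3); auto.
  { apply smooth2_planeQ; auto. intros z t [Hz It]. now apply HQ. }
  { intros eta t Heta It. destruct (HQ eta t Heta It) as (_ & E' & Hwe). unfold Q. rewrite E'.
    apply Rmult_integral_contrapositive_currified.
    - apply (proj2 (Hno eta Heta)) with (w := fst (inv eta)); auto.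
    - apply pow_nonzero, Rgt_not_eq, Rdiv_lt_0_compat; auto. }
  { intros t It. rewrite HQ0; auto. }
  { intros eta t Heta It. destruct (HQ eta t Heta It) as (_ & E' & Hwe).
    exact (ga_length_Q w (fst (inv eta)) (snd (inv eta)) _ t (Hw t It) Hwe E'). }
  assert (Hg0 : RInt g a b = 0) by exact (deriv_unique _ _ _ _ Hg1 HL).
  set (V := fun n t => family2 w (variation2 X) n 0 t).
  assert (HV : tower_on I w 4 V).
  { apply (family2_tower U); auto. now apply smooth_family2_variation. }
  set (A := fun n t => det2 (e1 t) (V n t)).
  set (B := fun n t => det2 (e2 t) (V n t)).
  assert (HA : forall n t, (n < 4)%nat -> I t ->
    is_derive (A n) t (w t * (B n t + A (S n) t))).
  { intros n t Hn It. destruct (HF t It) as (_ & _ & _ & H1 & H2).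
    eapply deriv_val; [apply deriv_det2; [exact H1|now apply HV]|].
    unfold A, B. destruct (V n t), (V (S n) t), (e1 t), (e2 t). vec_unfold. ring. }
  assert (HBd : forall n t, (n < 4)%nat -> I t ->
    is_derive (B n) t (w t * (B (S n) t - l t * A n t))).
  { intros n t Hn It. destruct (HF t It) as (_ & _ & _ & H1 & H2).
    eapply deriv_val; [apply deriv_det2; [exact H2|now apply HV]|].
    unfold A, B. destruct (V n t), (V (S n) t), (e1 t), (e2 t). vec_unfold. ring. }
  assert (HE : forall n, (A n a = 0 /\ B n a = 0) /\ (A n b = 0 /\ B n b = 0)).
  { intros n. destruct (family2_support I delta w X x n a b) as [Va Vb]; auto.
    fold (V n a) in Va. fold (V n b) in Vb. unfold A, B. rewrite Va, Vb.
    vec_unfold. repeat split; ring. }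
  assert (HA0 : forall t, A 0%nat t = bump a b t * det2 (e1 t) v).
  { intros t. unfold A, V.
    replace (family2 w (variation2 X) 0 0 t) with (scal (bump a b t) v).
    - destruct (e1 t), v. vec_unfold. ring.
    - symmetry. transitivity (variation2 X 0 t); [reflexivity|apply variation2_push]. }
  set (Phi := fun z => / 3 * (h 0%nat z * (A 3%nat z + l z * A 1%nat z))
      + (h 0%nat z * B 2%nat z - / 3 * (h 1%nat z * A 2%nat z))
      + (A 1%nat z * (l z * h 0%nat z + / 3 * h 2%nat z) - 2 / 3 * (h 1%nat z * B 1%nat z))
      + / 3 * (B 0%nat z * h 2%nat z - A 0%nat z * h 3%nat z)).
  set (F := fun t => bump a b t * (w t * det2 (e1 t) v * E t)).
  assert (HFc : forall t, I t -> continuous F t).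
  { intros t It. apply (continuous_mult (bump a b) (fun t => w t * det2 (e1 t) v * E t)).
    - now apply (smooth1_continuous I).
    - now apply HGc. }
  (* [1/2] from the square root, [1/3] from the Euler-Lagrange term of
     [plane_concomitant], [1/c] from pairing by determinants. *)
  set (q := eps / (6 * c)).
  assert (Hq0 : q <> 0).
  { unfold q. destruct He as [-> | ->]; apply Rmult_integral_contrapositive_currified;
      try lra; apply Rinv_neq_0_compat; lra. }
  assert (HqF : forall t, I t -> continuous (fun t => q * F t) t).
  { intros t It. apply (continuous_scal_r q F); auto. }
  assert (HIab : forall t, Rmin a b <= t <= Rmax a b -> I t).
  { intros t. rewrite Rmin_left, Rmax_right by lra. now apply Hcon. }
  assert (HR : RInt (fun t => g t - q * F t) a b = 0).
  { apply (RInt_exact I (fun z => eps / (2 * c) * Phi z)); auto.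
    2:{ intros t It. apply (continuous_minus g (fun t => q * F t)); auto. }
    2:{ destruct (HE 0%nat) as [(? & ?) _], (HE 1%nat) as [(? & ?) _],
          (HE 2%nat) as [(? & ?) _], (HE 3%nat) as [(? & ?) _].
        unfold Phi. rewrite_all_zero. ring. }
    2:{ destruct (HE 0%nat) as [_ (? & ?)], (HE 1%nat) as [_ (? & ?)],
          (HE 2%nat) as [_ (? & ?)], (HE 3%nat) as [_ (? & ?)].
        unfold Phi. rewrite_all_zero. ring. }
    intros t It.
    destruct (HB t It) as (E1 & E2 & E3 & E4).
    assert (Hdt : det2 (e1 t) (e2 t) <> 0) by now rewrite Hc.
    assert (Hvar := fun n => family2_variation U w X n 0 t HU HUw HUws HS (B0 t It)).
    assert (Hq := planeQ_variation _ _ _ _ _ _ _ _ _ _ (l t) (L1 t) 0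
       (Hvar 1%nat) (Hvar 2%nat) (Hvar 3%nat) (Hvar 4%nat) E1 E2 E3 E4 Hdt).
    rewrite (Hg3 t _ It Hq), HQ0, Hc by auto.
    destruct (weight_relation I w l L1 eps h t) as [Hh0 Hhr]; auto.
    destruct Hh as [Hh0' HhS].
    assert (HP := plane_concomitant w l L1 (h 0%nat) (h 1%nat) (h 2%nat) (h 3%nat)
       (A 0%nat) (A 1%nat) (A 2%nat) (A 3%nat) (B 0%nat) (B 1%nat) (B 2%nat)
       (h 4%nat t) (A 4%nat t) (B 3%nat t) t
       (HhS 0%nat t It) (HhS 1%nat t It) (HhS 2%nat t It) (HhS 3%nat t It) (Hl t It)
       (HA 0%nat t ltac:(lia) It) (HA 1%nat t ltac:(lia) It) (HA 2%nat t ltac:(lia) It)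
       (HA 3%nat t ltac:(lia) It)
       (HBd 0%nat t ltac:(lia) It) (HBd 1%nat t ltac:(lia) It) (HBd 2%nat t ltac:(lia) It)
       Hh0 Hhr).
    eapply deriv_val; [apply deriv_scal; exact HP|].
    rewrite HA0, Hh0' by auto. unfold F, E, q, A, B, V.
    set (v1 := family2 _ _ 1 0 t). set (v2 := family2 _ _ 2 0 t).
    set (v3 := family2 _ _ 3 0 t). set (v4 := family2 _ _ 4 0 t).
    field. split; auto. apply Rgt_not_eq, sqrt_lt_R0, Hp, It. }
  assert (Eg : RInt (fun t => g t - q * F t) a b = RInt g a b - q * RInt F a b).
  { assert (Eq : RInt (fun t => q * F t) a b = q * RInt F a b).
    { apply (RInt_scal (V := R_CompleteNormedModule) F a b q).
      apply (ex_RInt_continuous (V := R_CompleteNormedModule)); auto. }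
    rewrite <- Eq.
    apply (RInt_minus (V := R_CompleteNormedModule) g (fun t => q * F t));
      apply (ex_RInt_continuous (V := R_CompleteNormedModule)); auto. }
  rewrite Eg, Hg0 in HR. fold F.
  apply Rmult_eq_reg_l with q; auto. lra.
Qed.

(** * Space curves with given invariants *)

Lemma Rpower_three_halves x : 0 < x -> Rpower x (3 / 2) = x * sqrt x.
Proof.
  intros Hx. replace (3 / 2) with (1 + / 2) by lra.
  now rewrite Rpower_plus, Rpower_1, Rpower_sqrt.
Qed.

Lemma sign_mul_abs x eps : sign x = eps -> sign x * x = eps * x.
Proof. now intros ->. Qed.

Lemma deriv3_tower I y N : smooth_curve coords3 I y ->
  tower_on I (fun _ => 1) N (fun n => deriv3 n y).
Proof.
  intros Hy n t _ It. apply is_derive_A3.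
  assert (E : forall f, ex_derive_n f (S n) t ->
    is_derive (Derive_n f n) t (scal 1 (Derive_n f (S n) t))).
  { intros f Hf. eapply deriv_val; [apply Derive_correct, Hf|].
    unfold scal; simpl; unfold mult; simpl. ring. }
  split; [|split]; apply E;
    [apply (Hy (fun p => fst (fst p)))|apply (Hy (fun p => snd (fst p)))|apply (Hy snd)];
    simpl; auto.
Qed.

Lemma frame3_nondegenerate I y e1 e2 e3 w l m : open I -> smooth_curve coords3 I y ->
  frame3 I y e1 e2 e3 w l m -> nondegenerate3 I y.
Proof.
  intros HI Hy HF t It. apply lin_indep3_det.
  assert (HF' : frame3 I (deriv3 0 y) e1 e2 e3 w l m).
  { apply (frame3_ext I y); auto. intros z _. unfold deriv3; simpl.
    now destruct (y z) as [[? ?] ?]. }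
  destruct (spaceQ_frame I (fun _ => 1) _ e1 e2 e3 w l m HI (fun _ _ => Rlt_0_1)
              (deriv3_tower I y 5 Hy) HF' t It) as [E _].
  rewrite E. destruct (HF t It) as (Hi & Hw & _).
  apply Rmult_integral_contrapositive_currified.
  - apply pow_nonzero. lra.
  - now apply lin_indep3_det.
Qed.

(** Lifting a plane curve along the contact form [dz = x1 dx2 - x2 dx1] keeps [w] and [l],
    and the third invariant of the lift is the derivative of [l]. *)
Lemma contact_lift (I : R -> Prop) (x e1 e2 : R -> A2) (w l L1 z : R -> R) (c : R) :
  frame2 I x e1 e2 w l -> (forall t, I t -> det2 (e1 t) (e2 t) = c) ->
  (forall t, I t -> is_derive l t (w t * L1 t)) ->
  (forall t, I t -> is_derive z t (w t * det2 (x t) (e1 t))) ->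
  frame3 I (fun t => (x t, z t)) (fun t => (e1 t, det2 (x t) (e1 t)))
    (fun t => (e2 t, det2 (x t) (e2 t)))
    (fun t => (scal (- l t) (e1 t), c - l t * det2 (x t) (e1 t))) w l L1.
Proof.
  intros HF Hc Hl Hz t It.
  destruct (HF t It) as (Hi & Hw & H0 & H1 & H2).
  assert (Hct := Hc t It). assert (Hlt := Hl t It).
  assert (D1' := deriv_det2 _ _ t _ _ H0 H1). assert (D2' := deriv_det2 _ _ t _ _ H0 H2).
  split; [|split; [exact Hw|split; [|split; [|split]]]].
  - apply lin_indep3_det. apply lin_indep2_det in Hi. revert Hct Hi. unfold det2 at 1 2.
    destruct (e1 t) as [p q], (e2 t) as [p' q'], (x t) as [u v]. vec_unfold. intros E Hi.
    match goal with |- ?g <> 0 => replace g with ((p * q' - q * p') * (p * q' - q * p')) end.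
    + now apply Rmult_integral_contrapositive_currified.
    + rewrite <- E. ring.
  - exact (is_derive_pair x z t _ _ H0 (Hz t It)).
  - assert (D := is_derive_pair e1 (fun t => det2 (x t) (e1 t)) t _ _ H1 D1').
    replace (scal (w t) (e2 t, det2 (x t) (e2 t)))
      with (scal (w t) (e2 t), det2 (scal (w t) (e1 t)) (e1 t) + det2 (x t) (scal (w t) (e2 t)));
      [exact D|].
    destruct (e1 t), (e2 t), (x t). vec_unfold. f_equal. ring.
  - assert (D := is_derive_pair e2 (fun t => det2 (x t) (e2 t)) t _ _ H2 D2').
    match type of D with is_derive _ _ ?a => match goal with |- is_derive _ _ ?b =>
      replace b with a; [exact D|] end end.
    rewrite <- Hct.
    destruct (e1 t), (e2 t), (x t). vec_unfold. f_equal; [f_equal|]; ring.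
  - apply is_derive_A3. apply is_derive_A2 in H1. destruct H1 as [H11 H12].
    split; [|split].
    + vec_unfold. eapply deriv_val; [derive_rules|].
      destruct (e1 t), (e2 t). vec_unfold. ring.
    + vec_unfold. eapply deriv_val; [derive_rules|].
      destruct (e1 t), (e2 t). vec_unfold. ring.
    + cbn [snd]. eapply deriv_val.
      * apply deriv_minus; [apply deriv_const|]. apply deriv_mult; [exact Hlt|exact D1'].
      * cbv beta. destruct (e1 t), (e2 t), (x t). vec_unfold. ring.
Qed.

Lemma frame3_reparam (I J : R -> Prop) (tau tau' : R -> R) x e1 e2 e3 w l m :
  (forall s, J s -> I (tau s)) -> (forall s, J s -> is_derive tau s (tau' s)) ->
  (forall s, J s -> 0 < tau' s) -> frame3 I x e1 e2 e3 w l m ->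
  frame3 J (fun s => x (tau s)) (fun s => e1 (tau s)) (fun s => e2 (tau s))
    (fun s => e3 (tau s)) (fun s => w (tau s) * tau' s) (fun s => l (tau s)) (fun s => m (tau s)).
Proof.
  intros HIJ Ht Htp HF s Js.
  destruct (HF (tau s) (HIJ s Js)) as (Hi & Hw & H0 & H1 & H2 & H3).
  assert (T := Ht s Js).
  assert (G : forall (f : R -> A3) v v', is_derive f (tau s) v -> scal (tau' s) v = v' ->
     is_derive (fun s => f (tau s)) s v').
  { intros f v v' Hf <-. now apply (is_derive_comp f tau). }
  split; [exact Hi|]. split; [apply Rmult_lt_0_compat; auto|].
  split; [|split; [|split]]; (eapply G; [eassumption|]);
    destruct (e1 (tau s)) as [[? ?] ?], (e2 (tau s)) as [[? ?] ?], (e3 (tau s)) as [[? ?] ?];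
    vec_unfold; repeat apply injective_projections; cbn; ring.
Qed.

Lemma frame3_rescale (I : R -> Prop) y e1 e2 e3 w l m w' l' m' lam :
  0 < lam -> (forall t, I t -> w' t = w t / lam) -> (forall t, I t -> l' t = lam ^ 2 * l t) ->
  (forall t, I t -> m' t = lam ^ 3 * m t) ->
  frame3 I y e1 e2 e3 w l m ->
  frame3 I y (fun t => scal lam (e1 t)) (fun t => scal (lam ^ 2) (e2 t))
    (fun t => scal (lam ^ 3) (e3 t)) w' l' m'.
Proof.
  intros Hlam Ew El Em HF t It. rewrite Ew, El, Em by auto.
  destruct (HF t It) as (Hi & Hw & H0 & H1 & H2 & H3).
  assert (G : forall (f : R -> A3) (k : R) (v v' : A3), is_derive f t v -> scal k v = v' ->
     is_derive (fun s => scal k (f s) : A3) t v').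
  { intros f k v v' Hf <-. apply is_derive_A3 in Hf. destruct Hf as (F1 & F2 & F3).
    apply is_derive_A3. split; [|split].
    - exact (deriv_scal _ k t _ F1).
    - exact (deriv_scal _ k t _ F2).
    - exact (deriv_scal _ k t _ F3). }
  split; [|split; [apply Rdiv_lt_0_compat; auto|split; [|split; [|split]]]].
  - apply lin_indep3_det. apply lin_indep3_det in Hi.
    replace (det3 _ _ _) with (lam ^ 6 * det3 (e1 t) (e2 t) (e3 t)).
    + apply Rmult_integral_contrapositive_currified; auto. apply pow_nonzero; lra.
    + destruct (e1 t) as [[? ?] ?], (e2 t) as [[? ?] ?], (e3 t) as [[? ?] ?]. vec_unfold. ring.
  - replace (scal (w t / lam) (scal lam (e1 t))) with (scal (w t) (e1 t)); auto.
    destruct (e1 t) as [[? ?] ?]. vec_unfold. f_equal; [f_equal|]; field; lra.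
  - eapply G; [eassumption|].
    destruct (e2 t) as [[? ?] ?]. vec_unfold. f_equal; [f_equal|]; field; lra.
  - eapply G; [eassumption|].
    destruct (e3 t) as [[? ?] ?]. vec_unfold. f_equal; [f_equal|]; field; lra.
  - eapply G; [eassumption|].
    destruct (e1 t) as [[? ?] ?], (e2 t) as [[? ?] ?]. vec_unfold.
    f_equal; [f_equal|]; field; lra.
Qed.

(** The data [k] determine [l] up to a positive constant, hence [w] and [m] as well; the
    constant is absorbed by rescaling the frame. *)
Lemma normalized_frame (J : R -> Prop) k M eps y W L m0 : is_open_interval J ->
  (eps = 1 \/ eps = -1) -> (forall s, J s -> 0 < eps * L s) ->
  (forall s, J s -> is_derive L s (L s * k s)) ->
  (forall s, J s -> W s = / sqrt (eps * L s)) ->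
  (forall s, J s -> m0 s = M s * Rpower (eps * L s) (3 / 2)) ->
  space_curve_with_data J k M eps y ->
  exists e1 e2 e3, frame3 J y e1 e2 e3 W L m0.
Proof.
  intros HJ He Hp HL HW Hm (_ & _ & w & l & m & (e1 & e2 & e3 & HF) & Hs & Hpar & Hk & HM).
  destruct (HJ) as (HJo & [s0 Hs0] & _).
  assert (Hpl : forall s, J s -> 0 < eps * l s).
  { intros s Js. apply sign_eps; auto. now apply Hs. }
  assert (Hne : forall s, J s -> l s <> 0) by (intros s Js; now apply Hs).
  assert (Hga : forall s, J s -> sqrt (eps * l s) * w s = 1).
  { intros s Js. assert (H := deriv_unique _ _ _ _ (Hpar s Js) (deriv_id s)).
    unfold ga_length in H. rewrite (sign_mul_abs _ eps) in H; auto. now apply Hs. }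
  assert (Hl : forall s, J s -> is_derive l s (l s * k s)).
  { intros s Js. eapply deriv_val; [now apply Hk|].
    unfold ga_length. rewrite (sign_mul_abs _ eps) by now apply Hs.
    rewrite Hga by auto. ring. }
  set (r := L s0 / l s0).
  assert (Hr : forall s, J s -> L s = r * l s).
  { intros s Js. assert (E : L s / l s = r).
    { apply (interval_constant J (fun s => L s / l s)); auto.
      intros t Jt. eapply deriv_val;
        [exact (deriv_div L l t _ _ (Hne t Jt) (HL t Jt) (Hl t Jt))|]. field. auto. }
    rewrite <- E. field. auto. }
  assert (Hr0 : 0 < r).
  { assert (H1 := Hp s0 Hs0). assert (H2 := Hpl s0 Hs0).
    replace r with ((eps * L s0) / (eps * l s0)).
    - now apply Rdiv_lt_0_compat.
    - unfold r. field. split; auto. destruct He; lra. }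
  assert (Hlam : 0 < sqrt r) by now apply sqrt_lt_R0.
  assert (Hlam2 : sqrt r * sqrt r = r) by (apply sqrt_sqrt; lra).
  assert (Hsq : forall s, J s -> sqrt (eps * L s) = sqrt r * sqrt (eps * l s)).
  { intros s Js. rewrite (Hr s Js).
    replace (eps * (r * l s)) with (r * (eps * l s)) by ring.
    apply sqrt_mult_alt. lra. }
  exists (fun s => scal (sqrt r) (e1 s)), (fun s => scal (sqrt r ^ 2) (e2 s)),
    (fun s => scal (sqrt r ^ 3) (e3 s)).
  apply (frame3_rescale J y e1 e2 e3 w l m); auto.
  - intros s Js. rewrite HW, Hsq by auto. assert (H := Hga s Js).
    assert (0 < sqrt (eps * l s)) by (apply sqrt_lt_R0; auto).
    apply Rmult_eq_reg_l with (sqrt (eps * l s)); [|lra].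
    unfold Rdiv. rewrite <- Rmult_assoc, H. field. lra.
  - intros s Js. rewrite (Hr s Js). simpl. rewrite Rmult_1_r, Hlam2. ring.
  - intros s Js. rewrite Hm, HM by auto.
    rewrite !Rpower_three_halves by auto. rewrite Hsq by auto.
    assert (0 < sqrt (eps * l s)) by (apply sqrt_lt_R0; auto).
    assert (0 < eps * l s) by auto.
    replace (L s) with (sqrt r * sqrt r * l s) by (rewrite Hlam2; symmetry; auto). field.
    split; [lra|]. split; auto. destruct He; lra.
Qed.

(** * Congruence of space curves and linear complexes *)

(** The linear map carrying the frame [f] to the frame [e], by Cramer's rule. *)
Definition frame_map (f1 f2 f3 e1 e2 e3 : A3) (p : A3) : A3 :=
  comb3 (det3 p f2 f3 / det3 f1 f2 f3) (det3 f1 p f3 / det3 f1 f2 f3)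
    (det3 f1 f2 p / det3 f1 f2 f3) e1 e2 e3.

Lemma is_linear_frame_map f1 f2 f3 e1 e2 e3 : is_linear (frame_map f1 f2 f3 e1 e2 e3).
Proof.
  assert (Hx : is_linear (fun p : A3 => fst (fst p))).
  { apply (is_linear_comp (fun p : A3 => fst p) (fun q : A2 => fst q));
      apply is_linear_fst. }
  assert (Hy : is_linear (fun p : A3 => snd (fst p))).
  { apply (is_linear_comp (fun p : A3 => fst p) (fun q : A2 => snd q));
      [apply is_linear_fst|apply is_linear_snd]. }
  assert (Hz : is_linear (fun p : A3 => snd p)) by apply is_linear_snd.
  assert (S : forall (a : R) (g : A3 -> R), is_linear g -> is_linear (fun p => a * g p)).
  { intros a g Hg. apply (is_linear_comp g (fun u : R => a * u)); auto.
    apply (is_linear_scal_r (V := R_NormedModule) a). intros; apply Rmult_comm. }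
  assert (P : forall g g' : A3 -> R, is_linear g -> is_linear g' ->
            is_linear (fun p => g p + g' p)).
  { intros g g' Hg Hg'.
    apply (is_linear_comp (fun p => (g p, g' p)) (fun q : R * R => fst q + snd q)).
    - now apply (is_linear_prod g g').
    - apply (is_linear_plus (V := R_NormedModule)). }
  assert (F : forall a b c : R,
     is_linear (fun p : A3 => a * fst (fst p) + b * snd (fst p) + c * snd p)).
  { intros a b c. apply P; [apply P|]; apply S; assumption. }
  assert (G : forall g : A3 -> R,
     (exists a b c, forall p, g p = a * fst (fst p) + b * snd (fst p) + c * snd p) ->
     is_linear g).
  { intros g (a & b & c & E). apply is_linear_ext with (2 := F a b c).
    intros p. now rewrite E. }
  destruct f1 as [[a1 a2] a3], f2 as [[b1 b2] b3], f3 as [[c1 c2] c3],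
    e1 as [[p1 p2] p3], e2 as [[q1 q2] q3], e3 as [[r1 r2] r3].
  unfold frame_map.
  set (d := det3 _ _ _).
  assert (K : forall u v w : R, exists a b c, forall p : A3,
     det3 p (b1, b2, b3) (c1, c2, c3) / d * u + det3 (a1, a2, a3) p (c1, c2, c3) / d * v
     + det3 (a1, a2, a3) (b1, b2, b3) p / d * w = a * fst (fst p) + b * snd (fst p) + c * snd p).
  { intros u v w. clearbody d.
    exists ((b2 * c3 - b3 * c2) / d * u + (c2 * a3 - c3 * a2) / d * v + (a2 * b3 - a3 * b2) / d * w),
      ((b3 * c1 - b1 * c3) / d * u + (c3 * a1 - c1 * a3) / d * v + (a3 * b1 - a1 * b3) / d * w),
      ((b1 * c2 - b2 * c1) / d * u + (c1 * a2 - c2 * a1) / d * v + (a1 * b2 - a2 * b1) / d * w).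
    intros [[x y] z]. unfold det3; simpl. unfold Rdiv. ring. }
  apply (is_linear_prod
    (fun p => (det3 p (b1, b2, b3) (c1, c2, c3) / d * p1 + det3 (a1, a2, a3) p (c1, c2, c3) / d * q1
     + det3 (a1, a2, a3) (b1, b2, b3) p / d * r1,
     det3 p (b1, b2, b3) (c1, c2, c3) / d * p2 + det3 (a1, a2, a3) p (c1, c2, c3) / d * q2
     + det3 (a1, a2, a3) (b1, b2, b3) p / d * r2))
    (fun p => det3 p (b1, b2, b3) (c1, c2, c3) / d * p3 + det3 (a1, a2, a3) p (c1, c2, c3) / d * q3
     + det3 (a1, a2, a3) (b1, b2, b3) p / d * r3)).
  - apply (is_linear_prod
      (fun p => det3 p (b1, b2, b3) (c1, c2, c3) / d * p1 + det3 (a1, a2, a3) p (c1, c2, c3) / d * q1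
        + det3 (a1, a2, a3) (b1, b2, b3) p / d * r1)
      (fun p => det3 p (b1, b2, b3) (c1, c2, c3) / d * p2 + det3 (a1, a2, a3) p (c1, c2, c3) / d * q2
        + det3 (a1, a2, a3) (b1, b2, b3) p / d * r2)); apply G, K.
  - apply G, K.
Qed.

Lemma frame_map_inverse f1 f2 f3 e1 e2 e3 p : det3 f1 f2 f3 <> 0 -> det3 e1 e2 e3 <> 0 ->
  frame_map e1 e2 e3 f1 f2 f3 (frame_map f1 f2 f3 e1 e2 e3 p) = p.
Proof.
  intros Hf He. unfold frame_map.
  set (a := det3 p f2 f3 / _). set (b := det3 f1 p f3 / _). set (c := det3 f1 f2 p / _).
  replace (det3 (comb3 a b c e1 e2 e3) e2 e3) with (a * det3 e1 e2 e3).
  2:{ clearbody a b c. unfold comb3. destruct e1 as [[? ?] ?], e2 as [[? ?] ?], e3 as [[? ?] ?].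
      vec_unfold. ring. }
  replace (det3 e1 (comb3 a b c e1 e2 e3) e3) with (b * det3 e1 e2 e3).
  2:{ clearbody a b c. unfold comb3. destruct e1 as [[? ?] ?], e2 as [[? ?] ?], e3 as [[? ?] ?].
      vec_unfold. ring. }
  replace (det3 e1 e2 (comb3 a b c e1 e2 e3)) with (c * det3 e1 e2 e3).
  2:{ clearbody a b c. unfold comb3. destruct e1 as [[? ?] ?], e2 as [[? ?] ?], e3 as [[? ?] ?].
      vec_unfold. ring. }
  replace (a * det3 e1 e2 e3 / det3 e1 e2 e3) with a by (field; auto).
  replace (b * det3 e1 e2 e3 / det3 e1 e2 e3) with b by (field; auto).
  replace (c * det3 e1 e2 e3 / det3 e1 e2 e3) with c by (field; auto).
  unfold a, b, c, comb3. clear a b c. revert Hf. clear.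
  destruct f1 as [[? ?] ?], f2 as [[? ?] ?], f3 as [[? ?] ?], p as [[? ?] ?].
  vec_unfold. intros Hf. repeat apply injective_projections; cbn; field; auto.
Qed.

Lemma frame_map_frame f1 f2 f3 e1 e2 e3 : det3 f1 f2 f3 <> 0 ->
  frame_map f1 f2 f3 e1 e2 e3 f1 = e1.
Proof.
  destruct f1 as [[? ?] ?], f2 as [[? ?] ?], f3 as [[? ?] ?], e1 as [[? ?] ?],
    e2 as [[? ?] ?], e3 as [[? ?] ?]. unfold frame_map, comb3.
  vec_unfold. intros Hf. repeat apply injective_projections; cbn; field; auto.
Qed.

Lemma constant_A3 (I : R -> Prop) (f : R -> A3) : is_open_interval I ->
  (forall t, I t -> is_derive f t zero) -> forall a b, I a -> I b -> f a = f b.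
Proof.
  intros HI Hf a b Ia Ib.
  assert (H : forall t, I t -> is_derive (fun u => fst (fst (f u))) t 0 /\
    is_derive (fun u => snd (fst (f u))) t 0 /\ is_derive (fun u => snd (f u)) t 0).
  { intros t It. apply (is_derive_A3 f t zero). auto. }
  repeat apply injective_projections.
  - apply (interval_constant I (fun u => fst (fst (f u)))); auto. intros t It. now apply H.
  - apply (interval_constant I (fun u => snd (fst (f u)))); auto. intros t It. now apply H.
  - apply (interval_constant I (fun u => snd (f u))); auto. intros t It. now apply H.
Qed.

(** Two frames with the same invariants obey the same linear system, so the map carrying
    one to the other does not move. *)
Lemma frame3_congruent (J : R -> Prop) y y' f1 f2 f3 e1 e2 e3 w l m : is_open_interval J ->
  frame3 J y f1 f2 f3 w l m -> frame3 J y' e1 e2 e3 w l m ->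
  exists g, general_affine3 g /\ forall s, J s -> y' s = g (y s).
Proof.
  intros HJ HF HE. destruct (HJ) as (HJo & [s0 Hs0] & _).
  assert (Hf : forall s, J s -> det3 (f1 s) (f2 s) (f3 s) <> 0)
    by (intros s Js; apply lin_indep3_det, (HF s Js)).
  assert (He : forall s, J s -> det3 (e1 s) (e2 s) (e3 s) <> 0)
    by (intros s Js; apply lin_indep3_det, (HE s Js)).
  set (A := frame_map (f1 s0) (f2 s0) (f3 s0) (e1 s0) (e2 s0) (e3 s0)).
  set (B := frame_map (e1 s0) (e2 s0) (e3 s0) (f1 s0) (f2 s0) (f3 s0)).
  assert (HA : forall s p, J s ->
    A p = frame_map (f1 s) (f2 s) (f3 s) (e1 s) (e2 s) (e3 s) p).
  { intros s p Js.
    apply (constant_A3 J (fun s => frame_map (f1 s) (f2 s) (f3 s) (e1 s) (e2 s) (e3 s) p)); auto.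
    clear s Js. intros s Js.
    assert (D0 := frame3_det_const J y f1 f2 f3 w l m s HF Js).
    assert (Hd := Hf s Js).
    destruct (HF s Js) as (_ & _ & _ & F1 & F2 & F3).
    destruct (HE s Js) as (_ & _ & _ & E1 & E2 & E3).
    assert (P0 : is_derive (fun _ : R => p) s (zero : A3))
      by apply (is_derive_const (K := R_AbsRing) p).
    assert (Q1 := deriv_div _ _ s _ _ Hd (deriv_det3 (fun _ => p) f2 f3 s _ _ _ P0 F2 F3) D0).
    assert (Q2 := deriv_div _ _ s _ _ Hd (deriv_det3 f1 (fun _ => p) f3 s _ _ _ F1 P0 F3) D0).
    assert (Q3 := deriv_div _ _ s _ _ Hd (deriv_det3 f1 f2 (fun _ => p) s _ _ _ F1 F2 P0) D0).
    apply is_derive_A3 in E1, E2, E3.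
    destruct E1 as (E11 & E12 & E13), E2 as (E21 & E22 & E23), E3 as (E31 & E32 & E33).
    apply is_derive_A3. unfold frame_map, comb3, scal, plus, zero; simpl.
    unfold scal, plus, zero; simpl. unfold mult; simpl.
    assert (R : forall (u1 u2 u3 : R -> R) a1 a2 a3,
      is_derive u1 s a1 -> is_derive u2 s a2 -> is_derive u3 s a3 ->
      a1 = w s * u2 s -> a2 = w s * u3 s -> a3 = - m s * w s * u1 s + - l s * w s * u2 s ->
      is_derive (fun s => det3 p (f2 s) (f3 s) / det3 (f1 s) (f2 s) (f3 s) * u1 s
        + det3 (f1 s) p (f3 s) / det3 (f1 s) (f2 s) (f3 s) * u2 s
        + det3 (f1 s) (f2 s) p / det3 (f1 s) (f2 s) (f3 s) * u3 s) s 0).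
    { intros u1 u2 u3 a1 a2 a3 U1 U2 U3 -> -> ->. eapply deriv_val.
      - apply deriv_plus; [apply deriv_plus|]; apply deriv_mult;
          [exact Q1|exact U1|exact Q2|exact U2|exact Q3|exact U3].
      - cbv beta. revert Hd. clear.
        destruct (f1 s) as [[? ?] ?], (f2 s) as [[? ?] ?], (f3 s) as [[? ?] ?], p as [[? ?] ?].
        vec_unfold. intros Hd. field. auto. }
    split; [|split]; eapply R; try eassumption; reflexivity. }
  set (v := plus (y' s0) (opp (A (y s0)))).
  exists (fun p => plus (A p) v). split.
  - exists A, B, v. split; [apply is_linear_frame_map|]. split; [|split]; auto.
    + intros p. apply frame_map_inverse; auto.
    + intros p. apply frame_map_inverse; auto.
  - intros s Js.
    assert (E : plus (y' s) (opp (A (y s))) = v).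
    { apply (constant_A3 J (fun s => plus (y' s) (opp (A (y s))))); auto.
      clear s Js. intros s Js.
      destruct (HF s Js) as (_ & _ & F0 & _). destruct (HE s Js) as (_ & _ & E0 & _).
      assert (LA : is_linear A) by apply is_linear_frame_map.
      assert (H := is_derive_linear A y s _ LA F0).
      assert (HA1 : A (scal (w s) (f1 s)) = scal (w s) (e1 s)).
      { rewrite (linear_scal A LA). f_equal. rewrite (HA s) by auto.
        apply frame_map_frame; auto. }
      rewrite HA1 in H.
      assert (H' := is_derive_minus _ _ s _ _ E0 H).
      rewrite minus_eq_zero in H'. exact H'. }
    rewrite <- E. destruct (y' s) as [[? ?] ?], (A (y s)) as [[? ?] ?].
    vec_unfold. repeat apply injective_projections; cbn; ring.
Qed.

(** When [m] is the derivative of [l], [c = e3 + l e1] is a constant vector and so is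
    [a = e1 x e2 - y x c]; pairing [a] with [e1] gives a linear relation among the Pluecker
    coordinates of the tangent. *)
Lemma frame3_linear_complex (J : R -> Prop) y e1 e2 e3 w l m : is_open_interval J ->
  frame3 J y e1 e2 e3 w l m -> (forall s, J s -> is_derive l s (w s * m s)) ->
  in_linear_complex J y.
Proof.
  intros HJ HF Hl. destruct (HJ) as (HJo & [s0 Hs0] & _).
  set (c := fun s => plus (e3 s) (scal (l s) (e1 s)) : A3).
  assert (Hc : forall s, J s -> is_derive c s zero).
  { intros s Js. assert (Ls := Hl s Js).
    destruct (HF s Js) as (_ & _ & _ & F1 & F2 & F3).
    apply is_derive_A3 in F1, F3. destruct F1 as (F11 & F12 & F13), F3 as (F31 & F32 & F33).
    apply is_derive_A3. unfold c.
    split; [|split]; vec_unfold; (eapply deriv_val; [derive_rules|]);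
      destruct (e1 s) as [[? ?] ?], (e2 s) as [[? ?] ?]; vec_unfold; ring. }
  assert (Ec : forall s, J s -> c s = c s0) by (intros; apply (constant_A3 J c); auto).
  set (cr := fun u v : A3 =>
    (snd (fst u) * snd v - snd u * snd (fst v),
     snd u * fst (fst v) - fst (fst u) * snd v,
     fst (fst u) * snd (fst v) - snd (fst u) * fst (fst v)) : A3).
  set (a := fun s => minus (cr (e1 s) (e2 s)) (cr (y s) (c s)) : A3).
  assert (Ha : forall s, J s -> is_derive a s zero).
  { intros s Js. assert (Cs := Hc s Js).
    destruct (HF s Js) as (_ & _ & F0 & F1 & F2 & F3).
    assert (Dcr : forall (u v : R -> A3) (u' v' : A3), is_derive u s u' -> is_derive v s v' ->
      is_derive (fun z => cr (u z) (v z)) s (plus (cr u' (v s)) (cr (u s) v'))).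
    { intros u v u' v' U V. apply is_derive_A3 in U, V.
      destruct U as (U1 & U2 & U3), V as (V1 & V2 & V3). apply is_derive_A3.
      unfold cr. split; [|split]; vec_unfold; (eapply deriv_val; [derive_rules|]);
        cbv beta; ring. }
    assert (D := is_derive_minus _ _ s _ _ (Dcr _ _ _ _ F1 F2) (Dcr _ _ _ _ F0 Cs)).
    match type of D with is_derive _ _ ?v => assert (EV : v = zero); [|rewrite EV in D; exact D] end.
    unfold c, cr. destruct (e1 s) as [[? ?] ?], (e2 s) as [[? ?] ?], (e3 s) as [[? ?] ?],
      (y s) as [[? ?] ?]. vec_unfold.
    repeat apply injective_projections; cbn; ring. }
  assert (Ea : forall s, J s -> a s = a s0) by (intros; apply (constant_A3 J a); auto).
  destruct (a s0) as [[a1 a2] a3] eqn:Ea0. destruct (c s0) as [[c1 c2] c3] eqn:Ec0.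
  (* The last three Pluecker coordinates are, up to sign and order, the entries of the
     cross product of [y] and its derivative. *)
  exists a1, a2, a3, (- c3), c2, (- c1). split.
  - intros (_ & _ & _ & H3 & H2 & H1).
    destruct (HF s0 Hs0) as (Hi & _). destruct (Hi (l s0) 0 1) as (_ & _ & H); [|lra].
    assert (c1 = 0) by lra. assert (c3 = 0) by lra. subst c1 c2 c3.
    revert Ec0. unfold c. destruct (e1 s0) as [[? ?] ?], (e2 s0) as [[? ?] ?], (e3 s0) as [[? ?] ?].
    vec_unfold. intros E. injection E as G1 G2 G3.
    repeat apply injective_projections; cbn; lra.
  - intros s Js. cbv zeta.
    destruct (HF s Js) as (_ & _ & F0 & _). apply is_derive_A3 in F0.
    destruct F0 as (F01 & F02 & F03).
    assert (T0 : Derive (fun _ : R => 1) s = 0) by apply is_derive_unique, deriv_const.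
    unfold tangent_line, plucker, homogeneous. cbv beta iota.
    apply is_derive_unique in F01, F02, F03.
    change (Derive (fun u : R => fst (fst (y u))) s = fst (fst (scal (w s) (e1 s)))) in F01.
    change (Derive (fun u : R => snd (fst (y u))) s = snd (fst (scal (w s) (e1 s)))) in F02.
    change (Derive (fun u : R => snd (y u)) s = snd (scal (w s) (e1 s))) in F03.
    rewrite T0, F01, F02, F03.
    assert (As := Ea s Js). assert (Cs := Ec s Js).
    unfold a in As. rewrite Cs in As. revert As. unfold cr.
    destruct (e1 s) as [[p1 p2] p3], (e2 s) as [[q1 q2] q3], (y s) as [[y1 y2] y3].
    vec_unfold.
    intros E. injection E as G1 G2 G3. rewrite <- G1, <- G2, <- G3. ring.
Qed.

(** * From extremal plane curves to extremal space curves *)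

Theorem corollary6p4 :
  forall (I : R -> Prop) (x : R -> A2) (w l s k : R -> R) (eps : R),
    is_open_interval I ->
    smooth_curve coords2 I x ->
    nondegenerate2 I x ->
    no_inflection2 I x ->
    ga_extremal2 I x ->
    invariants2 I x w l ->
    (eps = 1 \/ eps = -1) ->
    (forall t, I t -> sign (l t) = eps) ->
    ga_length_parameter I w l s ->
    ga_curvature I w l (fun t => k (s t)) ->
    let J := fun sigma => exists t, I t /\ s t = sigma in
    let M := fun sigma => eps * k sigma in
    (exists y, space_curve_with_data J k M eps y) /\
    (forall y1 y2,
       space_curve_with_data J k M eps y1 ->
       space_curve_with_data J k M eps y2 ->
       exists g, general_affine3 g /\ forall sigma, J sigma -> y2 sigma = g (y1 sigma)) /\
    (forall y, space_curve_with_data J k M eps y ->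
       ga_extremal3 J y /\ in_linear_complex J y).
Proof.
  intros I x w l s k eps HII Hx _ _ Hext (e1 & e2 & HF) He Hsg Hpar Hk J M.
  destruct (HII) as (HI & [i0 Hi0] & Hcon).
  assert (HUI := open2_strip I HI).
  destruct (frame2_smooth I x e1 e2 w l HII Hx HF) as [Hws Hls].
  assert (Hw : forall t, I t -> 0 < w t) by (intros t It; apply (HF t It)).
  assert (Hw0 : forall t, I t -> w t <> 0) by (intros t It; apply Rgt_not_eq, Hw, It).
  assert (Hp : forall t, I t -> 0 < eps * l t) by (intros t It; apply sign_eps; auto).
  assert (Hsq : forall t, I t -> 0 < sqrt (eps * l t))
    by (intros t It; apply sqrt_lt_R0, Hp, It).
  destruct (weight_tower_exists I w l eps HI Hw0 Hws Hls Hp) as (h & Hh & Hhs).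
  assert (Hel := plane_euler_lagrange I x e1 e2 w l eps h HII Hx HF Hext He Hp Hh Hhs).
  set (c := det2 (e1 i0) (e2 i0)).
  assert (Hc : forall t, I t -> det2 (e1 t) (e2 t) = c).
  { intros t It. apply (interval_constant I (fun z => det2 (e1 z) (e2 z))); auto.
    intros z Iz. now apply (frame2_det_const I x e1 e2 w l). }
  set (L1 := fun t => Derive l t / w t).
  assert (Hl : forall t, I t -> is_derive l t (w t * L1 t)).
  { intros t It. eapply deriv_val; [now apply (smooth1_derive I)|]. unfold L1. field. auto. }
  assert (SL1 : smooth1 I L1).
  { assert (S1 : smooth2 (strip I) (fun _ t => Derive l t)) by exact (smooth1_Derive I l Hls).
    assert (S2 : smooth2 (strip I) (fun _ t => w t)) by exact Hws.
    unfold smooth1, L1. smooth_rules; auto. }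
  set (M1 := fun t => Derive L1 t / w t).
  assert (HL1 : forall t, I t -> is_derive L1 t (w t * M1 t)).
  { intros t It. eapply deriv_val; [now apply (smooth1_derive I)|]. unfold M1. field. auto. }
  set (s' := fun t => sqrt (eps * l t) * w t).
  assert (Hs' : forall t, I t -> ga_length w l t = s' t).
  { intros t It. unfold ga_length, s'. now rewrite (sign_mul_abs _ eps) by auto. }
  assert (Hs : forall t, I t -> is_derive s t (s' t)).
  { intros t It. rewrite <- Hs' by auto. now apply Hpar. }
  assert (Hsp : forall t, I t -> 0 < s' t)
    by (intros t It; apply Rmult_lt_0_compat; auto).
  assert (Ss' : smooth1 I s').
  { assert (S1 : smooth2 (strip I) (fun _ t => l t)) by exact Hls.
    apply (smooth2_mult (strip I) (fun _ t => sqrt (eps * l t)) (fun _ t => w t)); auto.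
    apply (smooth2_comp (strip I) (fun z => 0 < z) (fun _ t => eps * l t) sqrt);
      auto using smooth1_sqrt.
    - apply open2_strip, open_gt.
    - smooth_rules; auto. }
  (* The space curve is parametrized by [s], the plane curve by [t = tau s]. *)
  destruct (inverse_function I s s' HII Hs Hsp) as (HJ & tau & Hts & Htau).
  change (image I s) with J in HJ.
  destruct (HJ) as (HJo & _ & _).
  assert (HUJ := open2_strip J HJo).
  assert (Stau : smooth1 J tau) by exact (inverse_smooth I s s' tau HI HJo Hsp Ss' Hts Htau).
  assert (HtI : forall u, J u -> I (tau u) /\ s (tau u) = u).
  { intros u (t & It & <-). now rewrite Hts. }
  set (tau' := fun u => / s' (tau u)).
  assert (Htau' : forall u, J u -> is_derive tau u (tau' u)).
  { intros u (t & It & <-). unfold tau'. rewrite Hts by auto. auto. }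
  assert (Htp : forall u, J u -> 0 < tau' u).
  { intros u Ju. apply Rinv_0_lt_compat, Hsp, HtI, Ju. }
  (* [w], [l] and the derivative of [l] for the plane curve, carried to the parameter [s]:
     up to rescaling, these are the invariants of every space curve with the given data. *)
  set (W := fun u => w (tau u) * tau' u).
  set (L := fun u => l (tau u)). set (m := fun u => L1 (tau u)).
  assert (Htr : forall f f1 : R -> R, (forall t, I t -> is_derive f t (w t * f1 t)) ->
    forall u, J u -> is_derive (fun u => f (tau u)) u (W u * f1 (tau u))).
  { intros f f1 Hf u Ju. eapply deriv_val.
    - apply (deriv_comp f tau); [apply Hf, HtI, Ju|apply Htau', Ju].
    - unfold W. ring. }
  assert (HLp : forall u, J u -> 0 < eps * L u) by (intros u Ju; apply Hp, HtI, Ju).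
  assert (HLk : forall t, I t -> w t * L1 t = l t * (k (s t) * s' t)).
  { intros t It. rewrite <- Hs' by auto. exact (deriv_unique _ _ _ _ (Hl t It) (Hk t It)). }
  assert (HLd : forall u, J u -> is_derive L u (L u * k u)).
  { intros u Ju. destruct (HtI u Ju) as [It Es]. eapply deriv_val; [now apply (Htr l L1)|].
    unfold W, tau', L. assert (E := HLk _ It). rewrite Es in E.
    transitivity (w (tau u) * L1 (tau u) * / s' (tau u)); [ring|]. rewrite E. field.
    apply Rgt_not_eq, Hsp, It. }
  assert (HW : forall u, J u -> W u = / sqrt (eps * L u)).
  { intros u Ju. destruct (HtI u Ju) as [It _]. unfold W, tau', s', L.
    assert (H1 := Hw0 _ It). assert (H2 := Hsq _ It). field. split; lra. }
  assert (Hm : forall u, J u -> m u = M u * Rpower (eps * L u) (3 / 2)).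
  { intros u Ju. destruct (HtI u Ju) as [It Es]. rewrite Rpower_three_halves by auto.
    unfold m, M, L. assert (E := HLk _ It). rewrite Es in E. unfold s' in E.
    apply Rmult_eq_reg_l with (w (tau u)); auto. rewrite E.
    destruct He as [-> | ->]; ring. }
  assert (HLd' : forall u, J u -> is_derive L u (W u * m u)) by (apply (Htr l L1 Hl)).
  assert (Hnorm := fun y => normalized_frame J k M eps y W L m HJ He HLp HLd HW Hm).
  split; [|split].
  - destruct (smooth_curve_family2 I x HI Hx) as [S1 S2].
    set (x1 := fun t => fst (x t)). set (x2 := fun t => snd (x t)).
    assert (S1' : smooth2 (strip I) (fun _ t => Derive x1 t)) by exact (smooth1_Derive I x1 S1).
    assert (S2' : smooth2 (strip I) (fun _ t => Derive x2 t)) by exact (smooth1_Derive I x2 S2).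
    (* The third coordinate of the contact lift. *)
    set (z' := fun t => x1 t * Derive x2 t - x2 t * Derive x1 t).
    assert (Sz' : smooth1 I z') by (unfold smooth1, z', x1, x2; smooth_rules; auto).
    set (z := fun t => RInt z' i0 t).
    assert (Hz : forall t, I t -> is_derive z t (z' t)).
    { intros t It. apply (is_derive_RInt z' z i0 t).
      - apply filter_imp with (2 := HI t It). intros v Iv.
        apply (RInt_correct (V := R_CompleteNormedModule)).
        apply (ex_RInt_continuous (V := R_CompleteNormedModule)). intros q Hq.
        apply (smooth1_continuous I); auto. apply (Hcon (Rmin i0 v) (Rmax i0 v)); auto.
        + unfold Rmin. destruct (Rle_dec i0 v); auto.
        + unfold Rmax. destruct (Rle_dec i0 v); auto.
      - now apply (smooth1_continuous I). }
    assert (Hzw : forall t, I t -> is_derive z t (w t * det2 (x t) (e1 t))).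
    { intros t It. eapply deriv_val; [now apply Hz|].
      destruct (HF t It) as (_ & _ & H0 & _). apply is_derive_A2 in H0.
      destruct H0 as [H01 H02]. unfold z', x1, x2.
      apply is_derive_unique in H01, H02.
      change (Derive (fun u : R => fst (x u)) t = fst (scal (w t) (e1 t))) in H01.
      change (Derive (fun u : R => snd (x u)) t = snd (scal (w t) (e1 t))) in H02.
      rewrite H01, H02.
      destruct (x t), (e1 t). vec_unfold. ring. }
    assert (Sz : smooth1 I z) by (apply smooth1_intro with z'; auto).
    assert (HF3 := frame3_reparam I J tau tau' _ _ _ _ _ _ _ (fun u Ju => proj1 (HtI u Ju)) Htau' Htp
      (contact_lift I x e1 e2 w l L1 z c HF Hc Hl Hzw)).
    set (y := fun u => (x (tau u), z (tau u)) : A3) in *.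
    assert (Hy : smooth_curve coords3 J y).
    { assert (G : forall f, smooth1 I f -> smooth1 J (fun u => f (tau u))).
      { intros f Hf. apply (smooth2_comp (strip J) I (fun _ u => tau u) f); auto.
        intros v u Ju. apply HtI, Ju. }
      intros p Hin n u Ju. simpl in Hin.
      destruct Hin as [<-|[<-|[<-|[]]]]; revert n u Ju; apply smooth1_iff; auto.
      - exact (G x1 S1).
      - exact (G x2 S2).
      - exact (G z Sz). }
    exists y. split; [exact Hy|]. split; [exact (frame3_nondegenerate J y _ _ _ _ _ _ HJo Hy HF3)|].
    exists W, L, m.
    assert (HsL : forall u, J u -> sign (L u) = eps) by (intros u Ju; apply Hsg, HtI, Ju).
    assert (Hga : forall u, J u -> ga_length W L u = 1).
    { intros u Ju. unfold ga_length. rewrite (sign_mul_abs _ eps), HW by auto.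
      apply Rinv_r, Rgt_not_eq, sqrt_lt_R0, HLp, Ju. }
    split; [|split; [|split; [|split]]].
    + eexists _, _, _. exact HF3.
    + intros u Ju. split; auto. intros E. assert (H := HLp u Ju). rewrite E in H. lra.
    + intros u Ju. rewrite Hga by auto. apply deriv_id.
    + intros u Ju. rewrite Hga by auto. eapply deriv_val; [now apply HLd|]. ring.
    + intros u Ju. rewrite Hm by auto. field. apply Rgt_not_eq, exp_pos.
  - intros y1 y2 Hy1 Hy2.
    destruct (Hnorm y1 Hy1) as (f1 & f2 & f3 & HF1).
    destruct (Hnorm y2 Hy2) as (g1 & g2 & g3 & HF2).
    exact (frame3_congruent J y1 y2 _ _ _ _ _ _ W L m HJ HF1 HF2).
  - intros y Hy. destruct (Hnorm y Hy) as (f1 & f2 & f3 & HF3).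
    split; [|exact (frame3_linear_complex J y _ _ _ W L m HJ HF3 HLd')].
    apply (space_extremal J y f1 f2 f3 W L m (fun u => M1 (tau u)) eps (fun n u => h n (tau u)));
      auto.
    + assert (G : forall f, smooth1 I f -> smooth2 (strip J) (fun _ u => f (tau u))).
      { intros f Hf. apply (smooth2_comp (strip J) I (fun _ u => tau u) f); auto.
        intros v u Ju. apply HtI, Ju. }
      apply (smooth2_mult (strip J) (fun _ u => w (tau u)) (fun _ u => / s' (tau u))); auto.
      apply (smooth2_inv (strip J) (fun _ u => s' (tau u))); auto.
      intros v u Ju. apply Rgt_not_eq, Hsp, HtI, Ju.
    + exact (Htr L1 M1 HL1).
    + destruct Hh as [Hh0 HhS]. split.
      * intros u Ju. apply Hh0, HtI, Ju.
      * intros n. exact (Htr (h n) (h (S n)) (HhS n)).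
    + intros u Ju. apply Hel, HtI, Ju.
Qed.
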